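(* There are constants $C>0$ and $\eta\in(0,1]$, depending only on the elastic energy density $W_{2D}$, such that for all $L>0$, $\gamma>0$, all integers $N\ge 1$, all $h$ with $0<h\le \eta L$ and all $\alpha\in(0,\pi/2]$ there is $u\in SBV^2_N(\omega_h;\mathbb R^2)$ which satisfies the boundary condition $$Du(x)=R_\alpha\ \text{ for } x_1<-\tfrac L2,\qquad Du(x)=R_{-\alpha}\ \text{ for } x_1>\tfrac L2,$$ such that $u\in W^{1,\infty}(\omega_h\setminus\overline{J_u};\mathbb R^2)$ with $\mathcal H^1(\overline{J_u}\setminus J_u)=0$, $u$ is injective, and $$\mathcal E_h[u]\le C\min\left\{\frac{\alpha^2h^3}{L},\ \alpha^{1/3}\gamma^{2/3}h^{4/3}+\frac{\alpha\gamma^{1/2}h^{3/2}}{N^{1/2}}+\frac{\alpha^2h^3}{LN^2}+\frac{\alpha h^4}{L^2N^2}\right\}.$$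
   Context: For $h,L>0$ let $\omega_h:=(-L,L)\times(0,h)\subset\mathbb R^2$. For $\varphi\in\mathbb R$ let $R_\varphi:=\begin{pmatrix}\cos\varphi&-\sin\varphi\\ \sin\varphi&\cos\varphi\end{pmatrix}$. $SBV(\omega_h;\mathbb R^2)$ is the space of special functions of bounded variation: $u$ integrable whose distributional gradient is a measure of the form $Du=\nabla u\,\mathcal L^2+[u]\otimes\nu\,\mathcal H^1\llcorner J_u$, with $\nabla u\in L^1$, $J_u$ the ($\mathcal H^1$-rectifiable) jump set, $[u]$ the jump, $\nu$ the normal to $J_u$. For an integer $N\ge1$, $SBV^2_N(\omega_h;\mathbb R^2)$ is the set of $u\in SBV(\omega_h;\mathbb R^2)$ with $\nabla u\in L^2(\omega_h;\mathbb R^{2\times2})$ and, up to $\mathcal H^1$-null sets, $J_u\subset(-L,L)\times\{\frac hN,\frac{2h}N,\dots,\frac{(N-1)h}N\}$. The elastic energy density $W_{2D}:\mathbb R^{2\times2}\to[0,\infty)$ is a fixed Borel function such that for some constant $c_W>0$, $\frac1{c_W}\operatorname{dist}^2(\xi,SO(2))\le W_{2D}(\xi)\le c_W\operatorname{dist}^2(\xi,SO(2))$ for all $\xi\in\mathbb R^{2\times 2}$. For $\gamma>0$ the energy is $$\mathcal E_h[u]:=\int_{\omega_h}W_{2D}(\nabla u)\,dx+\gamma\,\mathcal H^1(J_u),\qquad u\in SBV^2_N(\omega_h;\mathbb R^2).$$ In the boundary condition $Du$ is the distributional gradient (so $u$ has no jump there). Injectivity refers to a representative of $u$ defined at every point of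 $\omega_h$. *)

(* Defs.v *)
From HB Require Import structures.
From mathcomp Require Import all_boot all_order all_algebra.
From mathcomp Require Import all_classical all_reals all_analysis.

Set Implicit Arguments.
Unset Strict Implicit.
Unset Printing Implicit Defensive.

Import Order.TTheory GRing.Theory Num.Theory.
Import numFieldNormedType.Exports.

Local Open Scope classical_set_scope.
Local Open Scope ring_scope.

(* Points and vectors of the plane are pairs; indices of coordinates and of
   matrix entries are in 'I_2.  [mplane R] is the type [R * R] with the product
   of the Borel sigma-algebras that is the domain of the product of the library
   Lebesgue measures; the default instance on [R * R] has another display. *)
Notation mplane R := (measurableTypeR R * measurableTypeR R)%type.

Section Plane.
Context {R : realType}.
Implicit Types (x y : R * R) (i j : 'I_2).

Definition crd x i : R := if i == 0 then x.1 else x.2.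

Definition basis_vec j : R * R := if j == 0 then (1, 0) else (0, 1).

Definition dotp x y : R := x.1 * y.1 + x.2 * y.2.

(* The library norm of [R * R] is the maximum norm, hence this one. *)
Definition enorm x : R := Num.sqrt (dotp x x).

Definition frob (A : 'M[R]_2) : R := Num.sqrt (\sum_i \sum_j A i j ^+ 2).

Definition leb2 : set (mplane R) -> \bar R :=
  (lebesgue_measure \x lebesgue_measure)%E.

Definition rotation (phi : R) : 'M[R]_2 :=
  \matrix_(i, j) if i == j then cos phi else
                 if i == 0 then - sin phi else sin phi.

Definition SO2 : set 'M[R]_2 := [set Q | Q *m Q^T = 1%:M /\ \det Q = 1].

Definition dist_SO2 (xi : 'M[R]_2) : R := inf [set frob (xi - Q) | Q in SO2].

(* One-dimensional Hausdorff (outer) measure, w.r.t. the Euclidean distance. *)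
Definition diam (A : set (R * R)) : \bar R :=
  maxe 0%E (ereal_sup [set (enorm (p.1 - p.2))%:E | p in A `*` A]).

Definition hausdorff1_delta (delta : R) (A : set (R * R)) : \bar R :=
  ereal_inf [set (\sum_(0 <= k <oo) diam (F k))%E |
    F in [set F : nat -> set (R * R) |
            A `<=` \bigcup_k F k /\ forall k, (diam (F k) <= delta%:E)%E]].

Definition hausdorff1 (A : set (mplane R)) : \bar R :=
  ereal_sup [set hausdorff1_delta delta A | delta in [set d : R | 0 < d]].

Definition rectifiable1 (A : set (R * R)) : Prop :=
  exists f : nat -> R -> R * R,
    (forall n, exists k : R, forall s t,
        enorm (f n s - f n t) <= k * `|s - t|) /\
    hausdorff1 (A `\` \bigcup_n range (f n)) = 0%E.

End Plane.

Section Distributions.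
Context {R : realType}.
Implicit Types (Omega : set (R * R)) (u : R * R -> R * R)
  (G : R * R -> 'M[R]_2) (phi : R * R -> R).

Definition partial (j : 'I_2) phi : R * R -> R :=
  fun x => 'D_(basis_vec j) phi x.

Fixpoint class_C (n : nat) phi : Prop :=
  continuous phi /\
  if n is m.+1 then
    forall j, (forall x, derivable phi x (basis_vec j)) /\
              class_C m (partial j phi)
  else True.

Definition test_fun Omega phi : Prop :=
  (forall n, class_C n phi) /\
  exists K : set (R * R),
    [/\ compact K, K `<=` Omega & forall x, ~ K x -> phi x = 0].

(* The distributional gradient of [u] in [Omega] is the function [G]. *)
Definition distr_grad_eq Omega u G : Prop :=
  forall phi, test_fun Omega phi -> forall i j : 'I_2,
    (\int[leb2]_(x in Omega) (crd (u x) i * partial j phi x)%:E =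
     - \int[leb2]_(x in Omega) (G x i j * phi x)%:E)%E.

(* W^{1,oo}(Omega; R^2) *)
Definition W1infty Omega u : Prop :=
  (forall i, measurable_fun (Omega : set (mplane R)) (fun x => crd (u x) i)) /\
  (exists M : R, {ae leb2, forall x, Omega x -> enorm (u x) <= M}) /\
  exists G, [/\ forall i j, measurable_fun (Omega : set (mplane R)) (fun x => G x i j),
                exists M : R, {ae leb2, forall x, Omega x -> frob (G x) <= M}
              & distr_grad_eq Omega u G].

End Distributions.

Section SBV.
Context {R : realType}.
Implicit Types (Omega : set (R * R)) (u : R * R -> R * R)
  (G : R * R -> 'M[R]_2) (x a b nu : R * R).

Definition half_ball x nu (r : R) : set (R * R) :=
  [set y | enorm (y - x) < r /\ 0 < dotp (y - x) nu].

(* [a] is the approximate limit of [u] at [x] on the side of [nu]; the factor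
   r^-2 is, up to a constant, the mean over the half ball. *)
Definition one_sided_limit u x nu a : Prop :=
  ((r ^- 2)%:E * \int[leb2]_(y in half_ball x nu r) (enorm (u y - a))%:E)%E
    @[r --> 0^'+] --> (0%E : \bar R).

Definition jump_at u x a b nu : Prop :=
  [/\ enorm nu = 1, a <> b,
      one_sided_limit u x nu a & one_sided_limit u x (- nu) b].

Definition jump_set Omega u : set (R * R) :=
  [set x | Omega x /\ exists a b nu, jump_at u x a b nu].

(* [u] is in SBV(Omega; R^2), with absolutely continuous gradient [G]:
     Du = G L^2 + (up - um) (x) nu H^1 |_ J_u,
   a finite measure.  The triple (up, um, nu) is determined at each jump point
   up to the exchange with (um, up, - nu), which does not affect the tensor
   (up - um) (x) nu. *)
Definition SBV Omega u G : Prop :=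
  [/\ forall i, leb2.-integrable Omega (fun x => (crd (u x) i)%:E),
      forall i j, leb2.-integrable Omega (fun x => (G x i j)%:E),
      rectifiable1 (jump_set Omega u)
    & exists up um nu : R * R -> R * R,
      [/\ forall x, jump_set Omega u x -> jump_at u x (up x) (um x) (nu x),
          forall i j, hausdorff1.-integrable (jump_set Omega u)
            (fun x => (crd (up x - um x) i * crd (nu x) j)%:E)
        & forall phi, test_fun Omega phi -> forall i j : 'I_2,
          (\int[leb2]_(x in Omega) (crd (u x) i * partial j phi x)%:E =
           - (\int[leb2]_(x in Omega) (G x i j * phi x)%:E +
              \int[hausdorff1]_(x in jump_set Omega u)
                (crd (up x - um x) i * crd (nu x) j * phi x)%:E))%E]].

Definition omega (L h : R) : set (R * R) :=
  [set x | - L < x.1 < L /\ 0 < x.2 < h].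

Definition layers (L h : R) (N : nat) : set (R * R) :=
  [set x | - L < x.1 < L /\
           exists2 k : nat, (0 < k < N)%N & x.2 = k%:R * h / N%:R].

(* [u] is in SBV^2_N(omega_h; R^2), and [G] is a representative of its
   absolutely continuous gradient. *)
Definition SBV2 (L h : R) (N : nat) u G : Prop :=
  [/\ SBV (omega L h) u G,
      (\int[leb2]_(x in omega L h) (frob (G x) ^+ 2)%:E < +oo)%E
    & hausdorff1 (jump_set (omega L h) u `\` layers L h N) = 0%E].

Definition elastic_density (W : 'M[R]_2 -> R) : Prop :=
  [/\ forall xi, 0 <= W xi,
      measurable_fun setT (W : g_sigma_algebraType (@open 'M[R]_2) -> R)
    & exists2 cW : R, 0 < cW &
        forall xi, cW^-1 * dist_SO2 xi ^+ 2 <= W xi <= cW * dist_SO2 xi ^+ 2].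

(* The energy E_h[u]; [G] stands for the gradient of [u], whose
   choice among a.e. equal functions is irrelevant. *)
Definition energy (W : 'M[R]_2 -> R) (gamma L h : R) u G : \bar R :=
  (\int[leb2]_(x in omega L h) (W (G x))%:E +
   gamma%:E * hausdorff1 (jump_set (omega L h) u))%E.

End SBV.

(* Main.v *)
Require Import Defs.
From HB Require Import structures.
From mathcomp Require Import all_boot all_order all_algebra.
From mathcomp Require Import all_classical all_reals all_analysis.
From mathcomp Require Import measurable_realfun.
From mathcomp Require Import ring lra.

Set Implicit Arguments.
Unset Strict Implicit.
Unset Printing Implicit Defensive.

Import Order.TTheory GRing.Theory Num.Theory.
Import numFieldNormedType.Exports.

Local Open Scope classical_set_scope.
Local Open Scope ring_scope.

(** The plate is cut along [x2 = k t] for [|x1| < S] into layers of thickness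
[t = q h / N], and each layer is bent separately.  A layer carries its
cross-sections rigidly along a unit-speed curve with piecewise constant
curvature, [u x = c_k x1 + (x2 - k t) n_k x1], so that
[dist (grad u, SO(2)) <= t |curvature|].  On the left half the tangent angle of
[c_k] starts at [alpha], is turned to [- b] along an arc centred at a point
common to all layers, stays at [- b] along a straight ramp, is turned back to
[0] along a second arc and stays there up to the axis; the right half is the
mirror image.  The ramps shorten from one layer to the next, at exactly the rate
that makes all layers meet the axis; in the frame of the ramps the layers are
translates of one curve, the higher layers lying above and behind, hence they do
not cross.  The ramps have length at most
[h (alpha + b - sin b) / (1 - cos b)], of the order of [alpha h / b ^ 2], and fit
into the length [S] if [b ^ 2] is of the order of [alpha h / S].

The elastic energy is of the order of [(alpha + b) ^ 2 t ^ 2 h / S] and there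
are at most [h / t] cuts of length [2 S].  With [t = h] and [S = L / 2] there is
no cut, and the energy is of the order of [alpha ^ 2 h ^ 3 / L].  Otherwise let
[p1] and [p2] be the first two terms of the second bound divided by [gamma]: then
[gamma p1 ^ 3 = alpha h ^ 4] and [gamma N p2 ^ 2 = alpha ^ 2 h ^ 3].  If
[N h <= c p1], take [t = h / N] and [S = min (L / 2) (max p1 p2 / N)]; if [N h] is
larger, take [S] a fixed multiple of [h] and [t] of the order of [h ^ 2 / p1]; and
if [p1] is smaller than a multiple of [h], the plate without cuts suffices. *)

(** Concentric first arcs keep the layers glued on the straight part, but the radius grows by [t]
    from layer to layer, and a longer arc leaves less length for reaching the axis. The ramps exist
    only to make up for this difference. A small [b] is cheap but makes them long, a large [b] makes
    them short but costs bending energy.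

    With [b ^ 2] of the order of [alpha h / S] the energy has, up to constants, three terms:
    [alpha ^ 2 t ^ 2 h / S], [alpha h ^ 2 t ^ 2 / S ^ 2] and the cuts [gamma S h / t]. For
    [t = h / N] the first balances the third at [S N = p2], the second balances it at [S N = p1];
    this is the origin of the two relations for [p1] and [p2]. The last two terms of the bound
    appear when this [S] exceeds [L / 2] and has to be capped.

    On the side of measure theory the obstacle is that the definition of [SBV] integrates against
    [hausdorff1], a bare set function. The jump set lies on finitely many horizontal lines, and on
    its measurable subsets [hausdorff1] agrees with a sum of Lebesgue measures. *)

Lemma nbhs_planeP (R : realType) (p : R * R) (U : set (R * R)) :
  nbhs p U <-> exists2 e : R, 0 < e &
    forall q, `|q.1 - p.1| < e -> `|q.2 - p.2| < e -> U q.
Proof.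
split => [/nbhs_ballP[e /= e0 eU]|[e e0 eU]].
  by exists e => // q q1 q2; apply: eU; split; rewrite /ball /= distrC.
apply/nbhs_ballP; exists e => //= q [].
by rewrite /ball /= distrC => q1; rewrite distrC => q2; exact: eU.
Qed.

(** The integral of a nonnegative function is a supremum over the simple functions below it, and
    this supremum is monotone without any measurability. This form covers half balls and the density
    [W (G x)] directly. *)
Lemma ge0_le_integral_nonmeasurable d (T : measurableType d) (R : realType)
    (mu : {measure set T -> \bar R}) (D E : set T) (f g : T -> \bar R) :
  (forall x, D x -> 0 <= f x)%E -> (forall x, E x -> 0 <= g x)%E ->
  (forall x, D x -> E x /\ (f x <= g x)%E) ->
  (\int[mu]_(x in D) f x <= \int[mu]_(x in E) g x)%E.
Proof.
move=> f0 g0 fg; rewrite (ge0_integralE _ f0) (ge0_integralE _ g0).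
apply: ge_ereal_sup => _ /= [h hf <-]; apply: ereal_sup_ubound; exists h => //= x.
apply: le_trans (hf x) _; rewrite /patch.
have [/set_mem Dx|_] := boolP (x \in D).
  by have [Ex fgx] := fg _ Dx; rewrite mem_set.
by case: ifPn => // /set_mem /g0.
Qed.

(** [mplane] carries a product sigma-algebra. The link to the topology is second countability: an
    open set is the union of the boxes with rational centre and radius that it contains. *)
Lemma measurable_open_plane (R : realType) (U : set (R * R)) :
  open U -> measurable (U : set (mplane R)).
Proof.
move=> oU.
pose B (q : rat * rat * rat) : set (mplane R) :=
  ball (ratr q.1.1 : R) (ratr q.2) `*` ball (ratr q.1.2 : R) (ratr q.2).
have -> : U = \bigcup_(q in [set q | B q `<=` U]) B q.
  apply/seteqP; split => [[x y] Uxy|p [q qU /qU//]].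
  have /nbhs_planeP[e e0 eU] : nbhs (x, y) U by exact: open_nbhs_nbhs.
  have [r] := @rat_in_itvoo R 0 (e / 2) ltac:(lra).
  rewrite in_itv /= => /andP[r0 re].
  have [p] := @rat_in_itvoo R (x - ratr r) (x + ratr r) ltac:(lra).
  have [q] := @rat_in_itvoo R (y - ratr r) (y + ratr r) ltac:(lra).
  rewrite !in_itv /= => /andP[q1 q2] /andP[p1 p2].
  exists (p, q, r) => /=; last first.
    by split; rewrite /= /ball /= ltr_norml; apply/andP; split; lra.
  move=> [x' y'] [/=]; rewrite /ball /= !ltr_norml => /andP[x1 x2] /andP[y1 y2].
  by apply: eU; rewrite /= ltr_norml; apply/andP; split; lra.
rewrite bigcup_mkcond; apply: countable_bigcupT_measurable => // q.
by case: ifP => // _; apply: measurableX; apply: open_measurable; exact: ball_open.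
Qed.

Lemma measurable_continuous_plane (R : realType) (f : R * R -> R) :
  continuous f -> measurable_fun [set: mplane R] (f : mplane R -> R).
Proof.
move=> cf; apply: (measurability _ (RGenOpens.measurableE R)).
move=> _ [_ [a [b ->] <-]]; rewrite setTI; apply: measurable_open_plane.
apply: open_comp => [x _|]; [exact: cf|exact: interval_open].
Qed.

(* [f] is continuous and, off a finite set, differentiable with derivative [g],
   which is continuous there. *)
Definition piecewise_deriv (R : realType) (f g : R -> R) : Prop :=
  continuous f /\ exists E : seq R, forall x, x \notin E ->
    is_derive x 1 f (g x) /\ {for x, continuous g}.

(** * Piecewise C^1 functions and the fundamental theorem of calculus *)

Section PiecewiseDeriv.
Context {R : realType}.
Implicit Types (f g : R -> R) (E : seq R).

Lemma near_notin E x : x \notin E -> \forall y \near x, y \notin E.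
Proof.
elim: E => [|e E IH]; first by move=> _; near=> y; rewrite in_nil.
rewrite inE negb_or => /andP[xe /IH xE].
near=> y; rewrite inE negb_or; apply/andP; split; last by near: y.
near: y; apply: open_nbhs_nbhs; split => //; exact: open_neq.
Unshelve. all: by end_near. Qed.

Lemma piecewise_deriv_eq f g1 g2 E : piecewise_deriv f g1 ->
  (forall x, x \notin E -> g1 x = g2 x) -> piecewise_deriv f g2.
Proof.
move=> [cf [E' fE]] g12; split => //; exists (E ++ E') => x.
rewrite mem_cat negb_or => /andP[xE xE']; have [df cg] := fE _ xE'.
split; first by rewrite -g12.
have : g1 @ x --> g1 x by exact: cg.
rewrite (g12 x xE) => cg'; apply: cvg_trans cg'; apply: near_eq_cvg.
by near=> y; apply: g12; near: y; exact: near_notin.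
Unshelve. all: by end_near. Qed.

Lemma piecewise_deriv_C1 f g : (forall x : R, is_derive x 1 f (g x)) -> continuous g ->
  piecewise_deriv f g.
Proof.
move=> df cg; split; last by exists [::] => x _; split => //; exact: cg.
move=> x; apply/differentiable_continuous/derivable1_diffP; exact: ex_derive.
Qed.

Lemma piecewise_derivD f1 g1 f2 g2 : piecewise_deriv f1 g1 -> piecewise_deriv f2 g2 ->
  piecewise_deriv (fun x => f1 x + f2 x) (fun x => g1 x + g2 x).
Proof.
move=> [c1 [E1 H1]] [c2 [E2 H2]]; split.
  by move=> x; apply: cvgD; [exact: c1|exact: c2].
exists (E1 ++ E2) => x; rewrite mem_cat negb_or => /andP[/H1[d1 e1] /H2[d2 e2]].
by split; [exact: is_deriveD|exact: cvgD].
Qed.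

Lemma piecewise_derivM f1 g1 f2 g2 : piecewise_deriv f1 g1 -> piecewise_deriv f2 g2 ->
  piecewise_deriv (fun x => f1 x * f2 x) (fun x => g1 x * f2 x + f1 x * g2 x).
Proof.
move=> [c1 [E1 H1]] [c2 [E2 H2]]; split.
  by move=> x; apply: cvgM; [exact: c1|exact: c2].
exists (E1 ++ E2) => x; rewrite mem_cat negb_or => /andP[/H1[d1 e1] /H2[d2 e2]].
split.
  apply: (is_derive_eq (is_deriveM d1 d2)).
  by rewrite /GRing.scale /= addrC mulrC.
by apply: cvgD; apply: cvgM => //; [exact: c2|exact: c1].
Qed.

Lemma piecewise_deriv_comp F f g dF : (forall x : R, is_derive x 1 F (dF x)) -> continuous dF ->
  piecewise_deriv f g -> piecewise_deriv (fun x => F (f x)) (fun x => dF (f x) * g x).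
Proof.
move=> hF cF [cf [E H]].
have cFF : continuous F.
  move=> x; apply/differentiable_continuous/derivable1_diffP; exact: ex_derive.
split; first by move=> x; apply: continuous_comp; [exact: cf|exact: cFF].
exists E => x /H[df cg]; split.
  exact: (is_derive1_comp (hF (f x)) df).
apply: cvgM => //; apply: continuous_comp; [exact: cf|exact: cF].
Qed.

Lemma piecewise_deriv_comp_affine f g (a b : R) : a != 0 -> piecewise_deriv f g ->
  piecewise_deriv (fun x => f (a * x + b)) (fun x => a * g (a * x + b)).
Proof.
move=> a0 [cf [E H]].
have da (x : R) : is_derive x 1 (fun x : R => a * x + b) a.
  by apply: is_derive_eq; rewrite /GRing.scale /= mulr1 addr0.
have ca : continuous (fun x : R => a * x + b).
  by move=> x; apply/differentiable_continuous/derivable1_diffP; exact: ex_derive.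
split; first by move=> x; apply: continuous_comp; [exact: ca|exact: cf].
exists [seq a^-1 * (y - b) | y <- E] => x xE.
have /H[df cg] : a * x + b \notin E.
  apply: contra xE => xE; apply/mapP; exists (a * x + b) => //.
  by rewrite addrK mulKf.
split; first by rewrite [X in is_derive _ _ _ X]mulrC; exact: (@is_derive1_comp _ f (fun x => a * x + b) x _ _ df (da x)).
apply: cvgM; first exact: cvg_cst.
apply: continuous_comp; [exact: ca|exact: cg].
Qed.

Lemma piecewise_deriv_cst (c : R) : piecewise_deriv (fun=> c) (fun=> 0).
Proof.
by apply: piecewise_deriv_C1 => x; exact: cvg_cst.
Qed.

Lemma piecewise_derivZ (c : R) f g : piecewise_deriv f g ->
  piecewise_deriv (fun x => c * f x) (fun x => c * g x).
Proof.
move=> H; have := piecewise_derivM (piecewise_deriv_cst c) H.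
by under [X in piecewise_deriv _ X -> _]eq_fun do rewrite mul0r add0r.
Qed.

Lemma measurable_piecewise_continuous g E : (forall x, x \notin E -> {for x, continuous g}) ->
  measurable_fun setT g.
Proof.
move=> cg; pose D := [set x | x \notin E].
have oD : open D by rewrite openE => x xE; exact: near_notin.
have DC : [set x | x \in E] = ~` D.
  apply/seteqP; split => x /=; first by move=> xE; rewrite /D /= xE.
  by move=> /negP; rewrite negbK.
rewrite -(setvU D); apply/measurable_funU.
- by apply: measurableC; exact: open_measurable.
- exact: open_measurable.
split; last by apply: open_continuous_measurable_fun => // x; rewrite inE => /cg.
rewrite -DC => mD Y mY; apply: countable_measurable; first by move=> ?; exact: measurable_set1.
apply: finite_set_countable; apply: (@sub_finite_set _ _ [set x | x \in E]) => [x []//|].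
exact: finite_seq.
Qed.

Lemma eq_derive0_off_finite (H : R -> R) E a b : a <= b ->
  {within `[a, b], continuous H} ->
  (forall x, x \in `]a, b[ -> x \notin E -> is_derive x 1 H 0) -> H a = H b.
Proof.
elim: E a b => [|e E IH] a b; rewrite le_eqVlt => /predU1P[->//|ab] cH dH.
  have [c _] := MVT ab (fun x xab => dH x xab isT) cH.
  by rewrite mul0r => /eqP; rewrite subr_eq0 => /eqP.
have [eab|eab] := boolP (e \in `]a, b[); last first.
  apply: IH (ltW ab) cH _ => x xab xE; apply: dH => //.
  by rewrite inE negb_or xE andbT; apply: contraNneq eab => <-.
move: (eab); rewrite in_itv /= => /andP[ae eb].
have cl : {within `[a, e], continuous H}.
  apply: continuous_subspaceW cH => x; rewrite /= !in_itv /= => /andP[-> xe].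
  exact: le_trans xe (ltW eb).
have dl x : x \in `]a, e[ -> x \notin E -> is_derive x 1 H 0.
  rewrite in_itv /= => /andP[ax xe] xE; apply: dH.
    by rewrite in_itv /= ax (lt_trans xe).
  by rewrite inE negb_or xE andbT lt_eqF.
have cr : {within `[e, b], continuous H}.
  apply: continuous_subspaceW cH => x; rewrite /= !in_itv /= => /andP[ex ->]; rewrite andbT.
  exact: le_trans (ltW ae) ex.
have dr x : x \in `]e, b[ -> x \notin E -> is_derive x 1 H 0.
  rewrite in_itv /= => /andP[ex xb] xE; apply: dH.
    by rewrite in_itv /= xb (lt_trans ae).
  by rewrite inE negb_or xE andbT gt_eqF.
by rewrite (IH a e (ltW ae) cl dl) (IH e b (ltW eb) cr dr).
Qed.

Lemma piecewise_deriv_integrable f g a b M : piecewise_deriv f g ->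
  (forall x, a <= x <= b -> `|g x| <= M) ->
  lebesgue_measure.-integrable `[a, b] (EFin \o g).
Proof.
move=> [_ [E fE]] gM; apply: measurable_bounded_integrable.
- exact: measurable_itv.
- have := lebesgue_measure_itv `[a, b]; rewrite /= => ->.
  by case: ifP => _; rewrite ltry.
- apply: measurable_funTS; apply: (@measurable_piecewise_continuous _ E) => x xE.
  by have [] := fE x xE.
- exists M; split; rewrite ?num_real // => x Mx y; rewrite /= in_itv => /gM gy.
  by rewrite (le_trans gy) // ltW.
Qed.

(** [f] minus the indefinite integral [F] of [g] is continuous and has derivative 0 off the
    exceptional points, hence takes the same value at both ends. The bound [M] makes [g]
    integrable. *)
Lemma piecewise_FTC f g a b M : a <= b -> piecewise_deriv f g ->
  (forall x, a <= x <= b -> `|g x| <= M) ->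
  (\int[lebesgue_measure]_(x in `[a, b]) (g x)%:E = (f b - f a)%:E)%E.
Proof.
rewrite le_eqVlt => /predU1P[-> _ _|ab fg gM].
  by rewrite set_itv1 integral_set1 subrr.
have ig := piecewise_deriv_integrable fg gM.
pose F x := \int[lebesgue_measure]_(t in `[a, x]) g t.
have cF : {within `[a, b], continuous F}.
  by apply: parameterized_integral_continuous => //; exact: ltW.
have [cf [E fE]] := fg.
have : f a - F a = f b - F b.
  apply: (@eq_derive0_off_finite (fun x => f x - F x) E); first exact: ltW.
    by move=> x; apply: cvgB; [exact: (@continuous_subspaceT _ _ `[a, b] f cf)|exact: cF].
  move=> x; rewrite in_itv /= => /andP[ax xb] /fE[df cg].
  have [dF F'] := @continuous_FTC1_closed _ g a x b xb ig ax cg.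
  have dF' : is_derive x 1 F (g x) by rewrite -F' derive1E; exact: derivableP dF.
  by apply: (is_derive_eq (is_deriveB df dF')); rewrite subrr.
have -> : F a = 0 by rewrite /F set_itv1 Rintegral_set1.
rewrite subr0 => ->; rewrite opprB addrCA subrr addr0 /F /Rintegral fineK //.
by apply: integrable_fin_num => //.
Qed.
End PiecewiseDeriv.

(** * One-dimensional Hausdorff measure on horizontal lines *)

(* [mu_ext] needs a measurable carrier; the choice of the sigma-algebra is immaterial. *)
Definition dplane (R : realType) : Type := (R * R)%type.
HB.instance Definition _ (R : realType) := Pointed.on (dplane R).
HB.instance Definition _ (R : realType) := @isMeasurable.Build default_measure_display
  (dplane R) discrete_measurable discrete_measurable0
  discrete_measurableC discrete_measurableU.

Lemma ler1_dist_nat (R : realDomainType) (k l : nat) :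
  k != l -> 1 <= `|k%:R - l%:R| :> R.
Proof.
rewrite neq_ltn => /orP[] kl; last rewrite -natrB ?(ltnW kl) //.
  by rewrite distrC -natrB ?(ltnW kl) // normr_nat ler1n subn_gt0.
by rewrite normr_nat ler1n subn_gt0.
Qed.

Section Hausdorff.
Context {R : realType}.
Implicit Types (A : set (R * R)) (delta : R).
Local Open Scope ereal_scope.

Lemma diam_ge0 A : 0 <= diam A.
Proof. by rewrite /diam le_max lexx. Qed.

Lemma enorm_le_diam A x y : A x -> A y -> (enorm (x - y))%:E <= diam A.
Proof.
by move=> Ax Ay; rewrite /diam le_max; apply/orP; right; apply: ereal_sup_ubound; exists (x, y).
Qed.

Lemma diam_le A (e : R) : (0 <= e)%R ->
  (forall x y, A x -> A y -> (enorm (x - y) <= e)%R) -> diam A <= e%:E.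
Proof.
move=> e0 Ae; rewrite /diam ge_max lee_fin e0 /=; apply: ge_ereal_sup => _ /= [[x y] [/= Ax Ay] <-].
by rewrite lee_fin; exact: Ae.
Qed.

Lemma diam0 : diam (set0 : set (R * R)) = 0.
Proof. by apply/eqP; rewrite eq_le diam_ge0 andbT; apply: diam_le. Qed.

(* Restricting the diameter to sets of diameter at most [delta] realizes the
   premeasure as an outer measure of the library. *)
Let diam_delta (delta : R) (A : set (dplane R)) : \bar R :=
  if diam A <= delta%:E then diam A else +oo.

(** A covering by sets one of which has diameter above [delta] gets the total [+oo] and does not
    affect the infimum. Countable subadditivity is inherited in this way. *)
Lemma hausdorff1_delta_mu_ext delta A : hausdorff1_delta delta A = mu_ext (diam_delta delta) A.
Proof.
apply/eqP; rewrite eq_le; apply/andP; split; apply: le_ereal_inf_tmp => x /= [F].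
- move=> [_ AF] <- {x}.
  have [dF|] := pselect (forall k, diam (F k) <= delta%:E).
    apply: ereal_inf_lbound; exists F => //.
    by apply: eq_eseriesr => k _; rewrite /diam_delta dF.
  move/existsNP => [k Fk]; rewrite (eseries_pinfty _ (k := k)) ?leey//.
    by move=> n _; rewrite /diam_delta; case: ifP => // _; rewrite -ltNye (lt_le_trans _ (diam_ge0 _)).
  by rewrite /diam_delta; case: ifP.
- move=> [AF dF] <- {x}; apply: ereal_inf_lbound; exists F => //.
  by apply: eq_eseriesr => k _; rewrite /diam_delta dF.
Qed.

Lemma hausdorff1_delta_sigma_subadditive delta : (0 <= delta)%R -> sigma_subadditive (hausdorff1_delta delta).
Proof.
move=> d0 F; rewrite hausdorff1_delta_mu_ext.
under eq_eseriesr do rewrite hausdorff1_delta_mu_ext.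
apply: mu_ext_sigma_subadditive => X.
by rewrite /diam_delta; case: ifP => // _; exact: diam_ge0.
Qed.

Lemma hausdorff1_delta_ge0 delta A : 0 <= hausdorff1_delta delta A.
Proof.
by apply: le_ereal_inf_tmp => _ /= [F _ <-]; apply: nneseries_ge0 => k _ _; exact: diam_ge0.
Qed.

Lemma hausdorff1_delta_le delta A : (0 < delta)%R -> hausdorff1_delta delta A <= hausdorff1 A.
Proof. by move=> d0; apply: ereal_sup_ubound; exists delta. Qed.

Lemma hausdorff1_ge0 A : 0 <= hausdorff1 A.
Proof. exact: le_trans (hausdorff1_delta_ge0 1 A) (hausdorff1_delta_le _ _). Qed.

Lemma hausdorff1_sigma_subadditive : sigma_subadditive (@hausdorff1 R).
Proof.
move=> F; apply: ge_ereal_sup => _ /= [delta /= d0 <-].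
apply: le_trans (hausdorff1_delta_sigma_subadditive (ltW d0) F) _.
apply: lee_nneseries => [k _ _|k _]; first exact: hausdorff1_delta_ge0.
exact: hausdorff1_delta_le.
Qed.

Lemma hausdorff1_countable A : countable A -> hausdorff1 A = 0.
Proof.
move=> cA; apply/eqP; rewrite eq_le hausdorff1_ge0 andbT.
apply: ge_ereal_sup => _ /= [delta /= d0 <-].
have d1 (p : R * R) : diam [set p] = 0.
  apply/eqP; rewrite eq_le diam_ge0 andbT; apply: diam_le => // x y -> ->.
  by rewrite subrr /enorm /dotp /= mulr0 addr0 sqrtr0.
suff H (F : nat -> set (R * R)) : A `<=` \bigcup_k F k -> (forall k, diam (F k) = 0) ->
    hausdorff1_delta delta A <= 0.
  have [A0|[f]] := pfcard_geP cA; first by apply: (H (fun=> set0)) => [|k]; rewrite ?A0 ?diam0.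
  apply: (H (fun k => [set f k])) => [p Ap|k]; last exact: d1.
  by have [k _ <-] := 'surj_f Ap; exists k.
move=> AF F0; apply: (@le_trans _ _ (\sum_(0 <= k <oo) diam (F k))).
  by apply: ereal_inf_lbound; exists F => //; split => // k; rewrite F0 lee_fin ltW.
by rewrite eseries0// => k _ _; rewrite F0.
Qed.

Definition slice A (c : R) : set R := [set x | A (x, c)].

Definition hline (E : set R) (c : R) : set (R * R) := [set p | E p.1 /\ p.2 = c].

Lemma enorm_hline (x y c : R) : enorm ((x, c) - (y, c))%R = `|x - y|%R.
Proof. by rewrite /enorm /dotp /= subrr mulr0 addr0 -expr2 sqrtr_sqr. Qed.

Lemma le_norm_enorm (p : R * R) : (`|p.1| <= enorm p)%R /\ (`|p.2| <= enorm p)%R.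
Proof.
by split; rewrite -sqrtr_sqr /enorm /dotp -!expr2 ler_sqrt ?addr_ge0 ?sqr_ge0 // ?lerDl ?lerDr sqr_ge0.
Qed.

Lemma diam_hline_interval (I : set R) (c : R) : is_interval I -> diam (hline I c) <= lebesgue_measure I.
Proof.
move=> iI; rewrite /diam ge_max measure_ge0 /=.
apply: ge_ereal_sup => _ /= [[[x c1] [y c2]] /= [[/= Ix ->] [/= Iy ->]] <-].
rewrite enorm_hline.
wlog xy : x y Ix Iy / (x <= y)%R.
  by move=> H; have [xy|/ltW yx] := leP x y; [exact: H|rewrite distrC; exact: H].
have <- : lebesgue_measure `[x, y]%classic = `|x - y|%:E :> \bar R.
  rewrite lebesgue_measure_itv /= lte_fin; case: ltP => xy'.
    by rewrite -EFinB distrC ger0_norm // subr_ge0.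
  have -> : x = y by apply/eqP; rewrite eq_le xy xy'.
  by rewrite subrr normr0.
apply: le_measure; rewrite ?inE //.
  exact: is_interval_measurable.
by move=> z /=; rewrite in_itv /= => xzy; exact: iI xzy.
Qed.

(** Outer regularity gives an open set around [E] of almost the same length. Its components, cut off
    to the window of length [delta], form an admissible covering, and countable additivity sums
    their lengths. *)
Lemma hausdorff1_delta_hline_le (E : set R) (a c delta : R) :
  (0 < delta)%R -> measurable E -> E `<=` `[a, (a + delta)%R]%classic ->
  hausdorff1_delta delta (hline E c) <= lebesgue_measure E.
Proof.
move=> d0 mE Ea.
have lEoo : lebesgue_measure E < +oo.
  apply: (@le_lt_trans _ _ (lebesgue_measure `[a, (a + delta)%R]%classic)).
    by apply: le_measure; rewrite ?inE.
  by rewrite lebesgue_measure_itv /=; case: ifP => _; rewrite ltry.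
apply/lee_addgt0Pr => e e0.
have [U [oU EU Ue]] := lebesgue_regularity_outer mE lEoo e0.
pose I q := open_disjoint_itv oU q `&` `[a, (a + delta)%R]%classic.
have iI q : is_interval (I q).
  move=> x y [Ix1 Ix2] [Iy1 Iy2] z xzy; split.
    exact: open_disjoint_itv_is_interval xzy.
  by move: Ix2 Iy2 xzy => /=; rewrite !in_itv /= => /andP[? ?] /andP[? ?] /andP[? ?]; apply/andP; split; lra.
have mI q : measurable (I q) by exact: is_interval_measurable.
apply: (@le_trans _ _ (\sum_(0 <= q <oo) diam (hline (I q) c))).
  apply: ereal_inf_lbound; exists (fun q => hline (I q) c) => //; split.
    move=> p [Ep pc]; have /EU := Ep; rewrite (open_disjoint_itv_bigcup oU) => -[q _ Iq].
    by exists q => //; split => //; split => //; exact: Ea.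
  move=> q; apply: diam_le; first exact: ltW.
  move=> [x cx] [y cy] [/= [_ Ix] ->] [/= [_ Iy] ->]; rewrite enorm_hline ler_norml.
  by move: Ix Iy; rewrite /= !in_itv /= => /andP[? ?] /andP[? ?]; apply/andP; split; lra.
apply: (@le_trans _ _ (\sum_(0 <= q <oo) lebesgue_measure (I q))).
  by apply: lee_nneseries => q *; [exact: diam_ge0|exact: diam_hline_interval].
rewrite -measure_semi_bigcup //; last 2 first.
- by apply: trivIset_setIr; exact: open_disjoint_itv_trivIset.
- exact: bigcupT_measurable.
apply: (@le_trans _ _ (lebesgue_measure U)).
  apply: le_measure; rewrite ?inE //; [exact: bigcupT_measurable|exact: open_measurable|].
  by move=> x [q _ [Iq _]]; rewrite (open_disjoint_itv_bigcup oU); exists q.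
have mU : measurable U by exact: open_measurable.
rewrite -(setDUK EU) measureU //; last 2 first.
- exact: measurableD.
- by rewrite setDE setICA setICr setI0.
by apply: leeD => //; exact: ltW.
Qed.

(** The line is divided into half-open windows of length [delta], to each of which the previous
    estimate applies. The lower bound [a] lets natural numbers index the windows. *)
Lemma hausdorff1_hline_le (E : set R) (a c : R) :
  measurable E -> (forall x, E x -> (a < x)%R) ->
  hausdorff1 (hline E c) <= lebesgue_measure E.
Proof.
move=> mE Ea; apply: ge_ereal_sup => _ /= [delta /= d0 <-].
pose P j := `[(a + j%:R * delta)%R, (a + j%:R * delta + delta)%R[%classic.
have EP : E = \bigcup_j (E `&` P j).
  apply/seteqP; split => [x Ex|x [j _ []//]].
  have xa : (0 <= (x - a) / delta)%R by apply: divr_ge0; [rewrite subr_ge0 ltW // Ea|exact: ltW].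
  have := truncn_itv xa; rewrite ler_pdivlMr // ltr_pdivrMr // => /andP[x1 x2].
  exists (Num.truncn ((x - a) / delta)) => //; split => //; rewrite /P /= in_itv /=.
  by move: x1 x2; rewrite -natr1 => x1 x2; apply/andP; split; lra.
have -> : hline E c = \bigcup_j hline (E `&` P j) c.
  rewrite {1}EP; apply/seteqP; split => [p [[j _ Ej] pc]|p [j _ [Ej pc]]].
    by exists j.
  by split => //; exists j.
apply: le_trans (hausdorff1_delta_sigma_subadditive (ltW d0) _) _.
have mEP j : measurable (E `&` P j) by apply: measurableI => //; exact: measurable_itv.
rewrite {2}EP measure_semi_bigcup //; last 2 first.
- apply: trivIset_setIl; apply: ltn_trivIset => j i ij.
  apply/seteqP; split => // x []; rewrite /P /= !in_itv /= => /andP[i1 i2] /andP[j1 j2].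
  have : (i.+1%:R * delta <= j%:R * delta)%R by rewrite ler_wpM2r ?ler_nat // ltW.
  by rewrite -natr1; lra.
- exact: bigcupT_measurable.
apply: lee_nneseries => j *; first exact: hausdorff1_delta_ge0.
apply: (@hausdorff1_delta_hline_le _ (a + j%:R * delta)%R) => // x [_].
by rewrite /P /= !in_itv /= => /andP[-> /ltW].
Qed.

(** A set of diameter at most [t / 2] meets at most one of the lines, so no covering set is counted
    twice, and its slice is no longer than its diameter. *)
Lemma hausdorff1_hlines_ge A (t : R) n : (0 < t)%R ->
  (forall k, measurable (slice A (k%:R * t))) ->
  \sum_(k < n) lebesgue_measure (slice A (k%:R * t)) <= hausdorff1 A.
Proof.
move=> t0 mA; have t20 : (0 < t / 2)%R by lra.
apply: le_trans _ (hausdorff1_delta_le A t20).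
apply: le_ereal_inf_tmp => _ /= [F [AF dF] <-].
have dfin j : (fine (diam (F j)))%:E = diam (F j).
  by rewrite fineK // ge0_fin_numE ?diam_ge0 // (le_lt_trans (dF j)) // ltry.
have d0 j : (0 <= fine (diam (F j)))%R by rewrite -lee_fin dfin diam_ge0.
pose S k j := slice (F j) (k%:R * t).
(* The slice of a covering set may fail to be measurable; it is enclosed in an interval as long as
   the diameter of that set. *)
pose I k j := if S k j == set0 then set0 else
  `[inf (S k j), (inf (S k j) + fine (diam (F j)))%R]%classic.
have mI k j : measurable (I k j) by rewrite /I; case: ifP.
have SI k j : S k j `<=` I k j.
  move=> x Sx; rewrite /I ifF; last by apply/negbTE/set0P; exists x.
  have lb y z : S k j y -> S k j z -> (y - fine (diam (F j)) <= z)%R.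
    move=> Sy Sz; have := @enorm_le_diam (F j) _ _ Sy Sz.
    by rewrite enorm_hline -dfin lee_fin ler_norml => /andP[_]; lra.
  rewrite /= in_itv /=; apply/andP; split.
    by apply: ge_inf => //; exists (x - fine (diam (F j)))%R => y Sy; exact: lb.
  rewrite -lerBlDr; apply: lb_le_inf; first by exists x.
  by move=> y Sy; exact: lb.
have lI k j : lebesgue_measure (I k j) <= diam (F j).
  rewrite /I; case: ifP => _; first by rewrite measure0 diam_ge0.
  rewrite lebesgue_measure_itv /= lte_fin; case: ifP => _; last exact: diam_ge0.
  by rewrite -EFinB addrAC subrr add0r dfin.
apply: (@le_trans _ _ (\sum_(k < n) \sum_(0 <= j <oo) lebesgue_measure (I k j))).
  apply: lee_sum => k _; apply: measure_sigma_subadditive => [j||x Ax]; [exact: mI|exact: mA|].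
  by have [j _ Fj] := AF _ Ax; exists j => //; exact: SI.
rewrite -nneseries_sum; last by move=> *; exact: measure_ge0.
apply: lee_nneseries => j *; first by apply: sume_ge0 => k _; exact: measure_ge0.
have [[k Sk]|noS] := pselect (exists k : 'I_n, S k j !=set0); last first.
  rewrite big1 ?diam_ge0 // => k _; rewrite /I ifT ?measure0 //.
  by apply/negPn/negP => /set0P Sk; apply: noS; exists k.
rewrite (bigD1 k) //= big1 ?adde0 ?lI // => l lk; rewrite /I ifT ?measure0 //.
apply/negPn/negP => /set0P [y Sy]; case: Sk => x Sx.
have : (t <= t / 2)%R; last by lra.
rewrite -lee_fin; apply: le_trans (dF j); apply: le_trans (@enorm_le_diam (F j) _ _ Sx Sy).
rewrite lee_fin; apply: le_trans _ (le_norm_enorm _).2; rewrite /=.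
rewrite -mulrBl normrM (gtr0_norm t0) -{1}[t]mul1r ler_wpM2r ?(ltW t0) //.
by apply: ler1_dist_nat; rewrite eq_sym.
Qed.

Lemma measurable_slice (A : set (mplane R)) c : measurable A -> measurable (slice A c).
Proof.
move=> mA; have := measurable_ysection c mA; congr measurable.
by apply/seteqP; split => x; rewrite /ysection /= inE.
Qed.

Lemma hausdorff1_hlines (A : set (mplane R)) (t a : R) n : (0 < t)%R -> measurable A ->
  (forall p, A p -> (a < p.1)%R /\ exists2 k, (k < n)%N & p.2 = (k%:R * t)%R) ->
  hausdorff1 A = \sum_(k < n) lebesgue_measure (slice A (k%:R * t)).
Proof.
move=> t0 mA Al; apply/eqP; rewrite eq_le; apply/andP; split; last first.
  by apply: hausdorff1_hlines_ge => // k; exact: measurable_slice.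
pose F k : set (R * R) := if (k < n)%N then hline (slice A (k%:R * t)) (k%:R * t) else set0.
have AE : A = \bigcup_k F k.
  apply/seteqP; split => [p Ap|p [k _]].
    have [_ [k kn pk]] := Al _ Ap; exists k => //; rewrite /F kn; split => //.
    by rewrite /slice /= -pk -surjective_pairing.
  by rewrite /F; case: ifP => // _ [+ pk]; rewrite /slice /= -pk -surjective_pairing.
rewrite {1}AE; apply: le_trans (hausdorff1_sigma_subadditive _) _.
rewrite (nneseries_split 0 n) ?add0n; last by move=> *; exact: hausdorff1_ge0.
rewrite [X in _ + X]eseries0 ?adde0; last first.
  by move=> k nk _; rewrite /F ltnNge nk /= hausdorff1_countable.
rewrite big_mkord; apply: lee_sum => k _; rewrite /F ltn_ord.
apply: (@hausdorff1_hline_le _ a); first exact: measurable_slice.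
by move=> x /Al [].
Qed.
End Hausdorff.

(** * Integration against the Hausdorff measure on horizontal lines *)

Definition hline_map (R : realType) (c : R) (s : measurableTypeR R) : mplane R := (s, c).

Lemma measurable_line (R : realType) (c : R) : measurable_fun setT (@hline_map R c).
Proof. by apply: measurable_fun_pair => //; exact: measurable_cst. Qed.

Import HBNNSimple.

(** [hausdorff1] enters the integral as a set function, to which theorems about measures do not
    apply. The integral over [D] only sees the values on measurable subsets of [D], so [hausdorff1]
    can be exchanged for a measure that agrees with it there. *)
Lemma eq_integral_set_function d (T : measurableType d) (R : realType)
    (m1 m2 : set T -> \bar R) (D : set T) (f : T -> \bar R) : 
  (forall A, measurable A -> A `<=` D -> m1 A = m2 A) ->
  (\int[m1]_(x in D) f x = \int[m2]_(x in D) f x)%E.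
Proof.
move=> m12.
have key (g : T -> \bar R) : (forall x, ~ D x -> g x = 0%E) ->
    forall h : {nnsfun T >-> R}, (forall x, (h x)%:E <= g x)%E -> sintegral m1 h = sintegral m2 h.
  (* The level set of the value 0 may leave [D], but it carries the factor 0. The other level sets
     lie in [D], because [0 <= h <= g] and [g] vanishes outside. *)
  move=> g0 h hg; apply: eq_fsbigr => r _; have [->|r0] := eqVneq r 0; first by rewrite !mul0e.
  congr (_ * _)%E; apply: m12.
    by rewrite -[X in measurable X]setTI; exact: measurable_funP.
  move=> x /= hx; apply: contrapT => Dx.
  have := hg x; rewrite g0 // lee_fin hx => r_le0; have : 0 <= h x by exact: fun_ge0. 
  rewrite hx => r_ge0.
  by move/eqP: r0; apply; apply/eqP; rewrite eq_le r_le0.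
rewrite /integral; congr (_ - _)%E; congr ereal_sup; apply/seteqP; split => y /= [h hf <-];
  exists h => //.
- by apply/esym/(key _ _ h hf) => x Dx; rewrite funeposE patchN ?maxxx //; apply/negP => /set_mem.
- by apply/(key _ _ h hf) => x Dx; rewrite funeposE patchN ?maxxx //; apply/negP => /set_mem.
- by apply/esym/(key _ _ h hf) => x Dx; rewrite funenegE patchN ?oppe0 ?maxxx //; apply/negP => /set_mem.
- by apply/(key _ _ h hf) => x Dx; rewrite funenegE patchN ?oppe0 ?maxxx //; apply/negP => /set_mem.
Qed.

Section IntegralHausdorff.
Context {R : realType}.
Variables (A : set (mplane R)) (t a : R) (n : nat).
Hypotheses (t0 : 0 < t) (mA : measurable A).
Hypothesis Al : forall p, A p -> a < p.1 /\ exists2 k, (k < n)%N & p.2 = k%:R * t.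

(** Lebesgue measure transported to the line at height [k t]; the sum of these measures over [k < n]
    agrees with [hausdorff1] on the measurable subsets of [A]. *)
Let m_ (k : nat) : {measure set (mplane R) -> \bar R} :=
  measure_function_pushforward__canonical__measure_function_Measure
    (lebesgue_measure_lebesgue_measure__canonical__measure_function_Measure R)
    (measurable_line (k%:R * t)).

(** The formula holds for nonnegative functions first. For signed [g] the positive and negative
    parts are regrouped line by line, which is legitimate because [g] is bounded and the slices have
    finite length. *)
Lemma integral_hausdorff1_hlines (g : mplane R -> R) (M : R) :
  measurable_fun setT g -> (forall p, A p -> `|g p| <= M) ->
  (forall k, (k < n)%N -> (lebesgue_measure (slice A (k%:R * t)) < +oo)%E) ->
  hausdorff1.-integrable A (EFin \o g) /\
  (\int[hausdorff1]_(x in A) (g x)%:E =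
   \sum_(k < n) \int[lebesgue_measure]_(s in slice A (k%:R * t)%R) (g (s, k%:R * t))%:E)%E.
Proof.
move=> mg gM lA.
have HmE B : measurable B -> B `<=` A -> hausdorff1 B = msum m_ n B.
  by move=> mB BA; rewrite (@hausdorff1_hlines R B t a n t0 mB) // => p /BA; exact: Al.
have pre k : hline_map (k%:R * t) @^-1` A = slice A (k%:R * t) by [].
have msl k : measurable (slice A (k%:R * t)) by exact: measurable_slice.
have intk k : (k < n)%N -> lebesgue_measure.-integrable (slice A (k%:R * t)) (fun s => (g (s, k%:R * t))%:E).
  move=> kn; apply: measurable_bounded_integrable; [exact: msl|exact: lA| |].
    by apply: measurable_funTS; apply: (measurableT_comp mg); exact: measurable_line.
  by exists M; split; rewrite ?num_real // => x Mx y Ay /=; rewrite (le_trans (gM _ Ay)) // ltW.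
have ge0E (f : mplane R -> \bar R) : (forall x, 0 <= f x)%E -> measurable_fun setT f ->
   (\int[hausdorff1]_(x in A) f x = \sum_(k < n) \int[lebesgue_measure]_(s in slice A (k%:R * t)%R) f (s, (k%:R * t)%R))%E.
  move=> f0 mf; rewrite (eq_integral_set_function f HmE) ge0_integral_measure_sum //; last exact: measurable_funTS.
  apply: eq_bigr => k _; rewrite ge0_integral_pushforward //; first exact: measurable_line.
  exact: measurable_funTS.
have mEg : measurable_fun setT (EFin \o g) by exact/measurable_EFinP.
split.
  apply/integrableP; split; first exact: measurable_funTS.
  rewrite (ge0E (fun x => `|(g x)%:E|)%E) //; last exact: measurableT_comp.
  by apply: lte_sum_pinfty => k _; have /integrableP[] := intk k (ltn_ord k).
rewrite (eq_integral_set_function _ HmE) integralE -!(eq_integral_set_function _ HmE) !ge0E //; last 2 first.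
- exact: measurable_funeneg.
- exact: measurable_funepos.
pose gk k (s : measurableTypeR R) := (g (s, k%:R * t))%:E.
have gN k s : (((EFin \o g)^\-)%E (s, k%:R * t) = ((gk k)^\-)%E s) by rewrite !funenegE.
have gP k s : (((EFin \o g)^\+)%E (s, k%:R * t) = ((gk k)^\+)%E s) by rewrite !funeposE.
rewrite -fin_num_sumeN; last first.
  move=> k _; rewrite (eq_integral ((gk k)^\-)%E) => [|s _]; last exact: gN.
  by apply: integrable_neg_fin_num; [exact: msl|exact: (intk k (ltn_ord k))].
rewrite -big_split /=; apply: eq_bigr => k _.
rewrite [RHS]integralE; congr (_ - _)%E; apply: eq_integral => s _; [exact: gP|exact: gN].
Qed.

End IntegralHausdorff.

Lemma continuous_bounded_itv (R : realType) (f : R -> R) (a b : R) :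
  continuous f -> exists2 M, 0 <= M & forall x, a <= x <= b -> `|f x| <= M.
Proof.
move=> cf; have [ab|ba] := leP a b; last first.
  by exists 0 => // x /andP[ax xb]; have := le_trans ax xb; rewrite leNgt ba.
have cnf : {within `[a, b], continuous (fun x => `|f x|)}.
  by apply: continuous_subspaceT => x; apply: cvg_norm; exact: cf.
have [c _ cM] := EVT_max ab cnf.
by exists `|f c| => // x xab; apply: cM; rewrite in_itv.
Qed.

(** * Integration by parts on a layered plate *)

Section TestFunction.
Context {R : realType}.
Variables (Omega : set (R * R)) (phi : R * R -> R).
Hypothesis tphi : test_fun Omega phi.

Lemma test_fun_continuous : continuous phi.
Proof. by case: tphi => /(_ 0%N)[]. Qed.

Lemma test_fun_partial_continuous j : continuous (partial j phi).
Proof. by case: tphi => /(_ 1%N)[_ /(_ j)[_ []]]. Qed.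

Lemma test_fun_derivable j x : derivable phi x (basis_vec j).
Proof. by case: tphi => /(_ 1%N)[_ /(_ j)[]]. Qed.

Lemma test_fun_support : exists K : set (R * R), [/\ compact K, closed K, K `<=` Omega,
  (forall x, ~ K x -> phi x = 0) & (forall j x, ~ K x -> partial j phi x = 0)].
Proof.
have [_ [K [cK KO phi0]]] := tphi.
have clK : closed K by apply: compact_closed cK; exact: norm_hausdorff.
exists K; split => // j x nKx.
have oK : open (~` K) by exact: closed_openC.
rewrite /partial (@near_eq_derive _ _ _ phi (cst 0)); first exact: derive_cst.
near=> y; apply: phi0; near: y; exact: open_nbhs_nbhs.
Unshelve. all: by end_near. Qed.

Lemma test_fun_partial0 (x1 x2 : R) :
  is_derive x1 1 (fun s => phi (s, x2)) (partial 0 phi (x1, x2)).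
Proof.
have d := @test_fun_derivable 0 (x1, x2).
have E : (fun h : R => h^-1 *: (((fun s => phi (s, x2)) \o shift x1) (h *: 1) - phi (x1, x2))) =
         (fun h : R => h^-1 *: ((phi \o shift (x1, x2)) (h *: basis_vec 0) - phi (x1, x2))).
  apply/funext => h; congr (_ *: (_ - _)); rewrite /= /shift /=; congr phi.
  by rewrite -[RHS]/(h * 1 + x1, h * 0 + x2) mulr0 add0r.
by split; [rewrite /derivable E|rewrite /partial /derive E].
Qed.

Lemma test_fun_partial1 (x1 x2 : R) :
  is_derive x2 1 (fun s => phi (x1, s)) (partial 1 phi (x1, x2)).
Proof.
have d := @test_fun_derivable 1 (x1, x2).
have E : (fun h : R => h^-1 *: (((fun s => phi (x1, s)) \o shift x2) (h *: 1) - phi (x1, x2))) =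
         (fun h : R => h^-1 *: ((phi \o shift (x1, x2)) (h *: basis_vec 1) - phi (x1, x2))).
  apply/funext => h; congr (_ *: (_ - _)); rewrite /= /shift /=; congr phi.
  by rewrite -[RHS]/(h * 0 + x1, h * 1 + x2) mulr0 add0r.
by split; [rewrite /derivable E|rewrite /partial /derive E].
Qed.

Lemma continuous_pair_l (f : R * R -> R) x2 : continuous f -> continuous (fun s => f (s, x2)).
Proof.
move=> cf s; apply: (@continuous_comp _ _ _ (fun s => (s, x2)) f); last exact: cf.
exact: (cvg_pair cvg_id (cvg_cst x2)).
Qed.

Lemma continuous_pair_r (f : R * R -> R) x1 : continuous f -> continuous (fun s => f (x1, s)).
Proof.
move=> cf s; apply: (@continuous_comp _ _ _ (fun s => (x1, s)) f); last exact: cf.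
exact: (cvg_pair (cvg_cst x1) cvg_id).
Qed.

Lemma compact_supported_bounded (K : set (R * R)) (f : R * R -> R) :
  compact K -> continuous f -> (forall x, ~ K x -> f x = 0) ->
  exists2 M, 0 <= M & forall x, `|f x| <= M.
Proof.
move=> cK cf f0.
have [K0|nK] := pselect (K !=set0); last first.
  by exists 0 => // x; rewrite f0 ?normr0 // => Kx; apply: nK; exists x.
have [c _ cM] := @compact_EVT_max _ _ (fun x => `|f x|) K K0 cK
  (@continuous_subspaceT _ _ K _ (fun x => cvg_norm (cf x))).
exists `|f c| => // x; have [Kx|/f0 ->] := pselect (K x); last by rewrite normr0.
by apply: cM; rewrite inE.
Qed.

Lemma test_fun_bounded : exists2 M, 0 <= M &
  forall x, `|phi x| <= M /\ forall j, `|partial j phi x| <= M.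
Proof.
have [K [cK _ _ phi0 dphi0]] := test_fun_support.
have [M0 M00 H0] := compact_supported_bounded cK test_fun_continuous phi0.
have [M1 M10 H1] := compact_supported_bounded cK (@test_fun_partial_continuous 0) (dphi0 0).
have [M2 M20 H2] := compact_supported_bounded cK (@test_fun_partial_continuous 1) (dphi0 1).
exists (M0 + M1 + M2); first by rewrite !addr_ge0.
move=> x; split; first by have := H0 x; lra.
move=> j; have := H1 x; have := H2 x.
by case: j => -[|[|//]] jl; [rewrite (_ : Ordinal jl = 0)|rewrite (_ : Ordinal jl = 1)];
  try exact: val_inj; lra.
Qed.

End TestFunction.

(** Layers are half-open: a height [k t] belongs to the layer above it. Negative heights are
    assigned to layer 0. *)
Definition layer (R : realType) (t x : R) : nat := Num.truncn (x / t).

Section Layer.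
Context {R : realType}.
Variable t : R.
Hypothesis t0 : 0 < t.

Lemma layer_eq k x : k%:R * t <= x < k.+1%:R * t -> layer t x = k.
Proof.
move=> /andP[kx xk]; apply: truncn_def.
by rewrite ler_pdivlMr // ltr_pdivrMr // kx xk.
Qed.

Lemma layer_itv x : 0 <= x -> (layer t x)%:R * t <= x < (layer t x).+1%:R * t.
Proof.
move=> x0; have := @truncn_itv _ (x / t) (divr_ge0 x0 (ltW t0)).
by rewrite ler_pdivlMr // ltr_pdivrMr.
Qed.

Lemma layer_lt x k : x < k%:R * t -> 0 <= x -> (layer t x < k)%N.
Proof.
move=> xk x0; have /andP[lx _] := layer_itv x0.
by rewrite -(ltr_nat R) -(ltr_pM2r t0) (le_lt_trans lx).
Qed.

Lemma measurable_layer_preimage k : measurable [set x : measurableTypeR R | layer t x = k].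
Proof.
have mle i : measurable [set x : measurableTypeR R | (layer t x <= i)%N].
  rewrite (_ : [set x | _] = `]-oo, (i.+1%:R * t)[%classic); first exact: measurable_itv.
  by apply/seteqP; split => x; rewrite /layer /= truncn_le_nat in_itv /= ltr_pdivrMr.
case: k => [|k].
  by rewrite (_ : [set x | _] = [set x | (layer t x <= 0)%N]) //;
    apply/seteqP; split => x /=; [move=> ->|rewrite leqn0 => /eqP].
rewrite (_ : [set x | _] = [set x | (layer t x <= k.+1)%N] `\` [set x | (layer t x <= k)%N]).
  exact: measurableD.
apply/seteqP; split => x /=; first by move=> ->; rewrite leqnn ltnn.
by move=> [xk /negP]; rewrite -ltnNge => kx; apply/eqP; rewrite eqn_leq xk.
Qed.

Lemma measurable_layer_fun (q : nat -> R -> R) : (forall k, measurable_fun setT (q k)) ->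
  measurable_fun [set: mplane R] (fun x : mplane R => q (layer t x.2) x.1).
Proof.
move=> mq _ Y mY; rewrite setTI.
have -> : (fun x : mplane R => q (layer t x.2) x.1) @^-1` Y =
    \bigcup_k ((q k @^-1` Y) `*` [set x : measurableTypeR R | layer t x = k] : set (mplane R)).
  apply/seteqP; split => [x Yx|x [k _ [/= Yx lk]]]; last by rewrite /= lk.
  by exists (layer t x.2).
apply: bigcupT_measurable => k; apply: measurableX; last exact: measurable_layer_preimage.
by rewrite -[X in measurable X]setTI; exact: mq.
Qed.

End Layer.

Section Rectangle.
Context {R : realType}.
Variables (L h : R).
Hypotheses (L0 : 0 < L) (h0 : 0 < h).

Lemma omegaE : omega L h = `]-L, L[%classic `*` `]0, h[%classic.
Proof.
by apply/seteqP; split => x /=; rewrite /omega /= !in_itv /= => -[-> ->].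
Qed.

Lemma measurable_omega : measurable (omega L h : set (mplane R)).
Proof. by rewrite omegaE; apply: measurableX; exact: measurable_itv. Qed.

Lemma leb2_box (a b c d : R) : a <= b -> c <= d ->
  leb2 (`]a, b[%classic `*` `]c, d[%classic) = ((b - a) * (d - c))%:E.
Proof.
move=> ab cd; rewrite /leb2 product_measure1E; try exact: measurable_itv.
have := lebesgue_measure_itv `]a, b[; rewrite /= => ->.
have := lebesgue_measure_itv `]c, d[; rewrite /= => ->.
rewrite !lte_fin; move: ab cd; rewrite !le_eqVlt => /predU1P[->|ab].
  by rewrite ltxx subrr mul0r mul0e.
move=> /predU1P[->|cd]; first by rewrite ltxx subrr mulr0 mule0.
by rewrite ab cd -!EFinB -EFinM.
Qed.

Lemma leb2_omega : leb2 (omega L h) = (2 * L * h)%:E.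
Proof.
rewrite omegaE leb2_box ?(ltW h0) //; last by rewrite (@le_trans _ _ 0) // ?oppr_le0 ltW.
by congr (_%:E); ring.
Qed.

Lemma integrable_omega (F : R * R -> R) (C : R) :
  measurable_fun [set: mplane R] (F : mplane R -> R) ->
  (forall x, omega L h x -> `|F x| <= C) ->
  leb2.-integrable (omega L h : set (mplane R)) (fun x => (F x)%:E).
Proof.
move=> mF FC; apply: measurable_bounded_integrable.
- exact: measurable_omega.
- by change (leb2 (omega L h) < +oo)%E; rewrite leb2_omega ltry.
- exact: measurable_funTS.
- exists C; split; rewrite ?num_real // => y Cy x /FC Fx.
  by rewrite /= (le_trans Fx) // ltW.
Qed.

Lemma integral_omegaT (F : R * R -> R) : (forall x, ~ omega L h x -> F x = 0) ->
  (\int[leb2]_(x in omega L h) (F x)%:E = \int[leb2]_x (F x)%:E)%E.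
Proof.
move=> F0; rewrite /leb2 integral_mkcond; apply: eq_integral => x _.
by rewrite patchE; case: ifPn => // /negP xO; rewrite F0 // => Ox; apply: xO; rewrite inE.
Qed.

Lemma integrable_plane (F : R * R -> R) (C : R) :
  measurable_fun [set: mplane R] (F : mplane R -> R) ->
  (forall x, `|F x| <= C) -> (forall x, ~ omega L h x -> F x = 0) ->
  leb2.-integrable [set: mplane R] (fun x => (F x)%:E).
Proof.
move=> mF FC F0; have /integrable_mkcond := @integrable_omega F C mF (fun x _ => FC x).
move=> /(_ measurable_omega); congr (is_true (integrable _ _ _)).
apply/funext => x; rewrite patchE; case: ifPn => // /negP xO.
by rewrite F0 // => Ox; apply: xO; rewrite inE.
Qed.

End Rectangle.

Lemma integral_support d (T : measurableType d) (R : realType)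
    (mu : {measure set T -> \bar R}) (D : set T) (f : T -> \bar R) :
  (forall x, ~ D x -> f x = 0%E) -> (\int[mu]_x f x = \int[mu]_(x in D) f x)%E.
Proof.
move=> f0; rewrite [RHS]integral_mkcond; apply: eq_integral => x _.
by rewrite patchE; case: ifPn => // /negP xD; rewrite f0 // => Dx; apply: xD; rewrite inE.
Qed.

(** Regroups the boundary terms: on the left they are collected by layers, on the right by the
    interfaces on which they live. *)
Lemma sum_by_parts (V : comPzRingType) (A P : nat -> V) m :
  \sum_(k < m.+1) (A k.+1 - P k) =
  A m.+1 - P 0%N - \sum_(k < m.+1 | (0 < k)%N) (P k - A k).
Proof.
elim: m => [|m IH]; first by rewrite [in RHS]big_mkcond !big_ord1 /= subr0.
rewrite big_ord_recr /= {}IH [in RHS]big_mkcond [in RHS]big_ord_recr /= -[in RHS]big_mkcond /=.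
ring.
Qed.

Section ScalarPlate.
Context {R : realType}.
Variables (t L h : R) (M : nat) (p n dp dn : nat -> R -> R) (B : R).
Hypotheses (t0 : 0 < t) (L0 : 0 < L) (h0 : 0 < h) (hM : h <= M%:R * t).
Hypothesis pp : forall k, piecewise_deriv (p k) (dp k).
Hypothesis pn : forall k, piecewise_deriv (n k) (dn k).
Hypothesis dpB : forall k x, `|dp k x| <= B.
Hypothesis dnB : forall k x, `|dn k x| <= B.

(** One component of a layered map: on layer [k] the curve component [p k] is extended linearly in
    the height, with slope [n k]. [plate1] and [plate2] are the partial derivatives inside a
    layer. *)
Definition plate (x : R * R) : R :=
  p (layer t x.2) x.1 + (x.2 - (layer t x.2)%:R * t) * n (layer t x.2) x.1.
Definition plate1 (x : R * R) : R :=
  dp (layer t x.2) x.1 + (x.2 - (layer t x.2)%:R * t) * dn (layer t x.2) x.1.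
Definition plate2 (x : R * R) : R := n (layer t x.2) x.1.

Let mpw (f g : R -> R) : piecewise_deriv f g -> measurable_fun setT f /\ measurable_fun setT g.
Proof.
move=> [cf [E fE]]; split; first exact: continuous_measurable_fun.
by apply: (@measurable_piecewise_continuous _ _ E) => x /fE[].
Qed.

Lemma measurable_layer_height :
  measurable_fun [set: mplane R] ((fun x => x.2 - (layer t x.2)%:R * t) : mplane R -> R).
Proof.
apply: measurable_funB; first exact: measurable_snd.
by apply: (@measurable_layer_fun R t t0 (fun k _ => k%:R * t)) => k; exact: measurable_cst.
Qed.

Lemma measurable_plate : measurable_fun [set: mplane R] (plate : mplane R -> R).
Proof.
apply: measurable_funD; first by apply: measurable_layer_fun => // k; case: (mpw (pp k)).
apply: measurable_funM; first exact: measurable_layer_height.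
by apply: measurable_layer_fun => // k; case: (mpw (pn k)).
Qed.

Lemma measurable_plate1 : measurable_fun [set: mplane R] (plate1 : mplane R -> R).
Proof.
apply: measurable_funD; first by apply: measurable_layer_fun => // k; case: (mpw (pp k)).
apply: measurable_funM; first exact: measurable_layer_height.
by apply: measurable_layer_fun => // k; case: (mpw (pn k)).
Qed.

Lemma measurable_plate2 : measurable_fun [set: mplane R] (plate2 : mplane R -> R).
Proof. by apply: measurable_layer_fun => // k; case: (mpw (pn k)). Qed.

Lemma layer_omega x : omega L h x ->
  (layer t x.2 < M)%N /\ 0 <= x.2 - (layer t x.2)%:R * t <= t.
Proof.
move=> [_ /andP[x0 xh]]; split; first by apply: layer_lt => //; [exact: lt_le_trans hM|exact: ltW].
have := layer_itv t0 (ltW x0); rewrite -natr1 mulrDl mul1r => /andP[? ?].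
by apply/andP; split; lra.
Qed.

Lemma bounded_layer (q : nat -> R -> R) : (forall k, continuous (q k)) ->
  exists2 C, 0 <= C & forall x, omega L h x -> `|q (layer t x.2) x.1| <= C.
Proof.
move=> cq.
have [C HC] : {C : nat -> R & forall k, 0 <= C k /\ forall x, -L <= x <= L -> `|q k x| <= C k}.
  apply: (@choice _ _ (fun k C => 0 <= C /\ forall x, -L <= x <= L -> `|q k x| <= C)) => k.
  by have [M' M0 H] := continuous_bounded_itv (-L) L (cq k); exists M'.
exists (\sum_(k < M) C k); first by apply: sumr_ge0 => k _; have [] := HC k.
move=> x Ox; have [lM _] := layer_omega Ox.
rewrite (bigD1 (Ordinal lM)) //=; apply: ler_wpDr.
  by apply: sumr_ge0 => k _; have [] := HC k.
by apply: (HC _).2; move: Ox => [/andP[? ?] _]; apply/andP; split; exact: ltW.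
Qed.

Lemma bounded_plate : exists2 C, 0 <= C & forall x, omega L h x ->
  [/\ `|plate x| <= C, `|plate1 x| <= C & `|plate2 x| <= C].
Proof.
have [C1 C10 H1] := bounded_layer (fun k => (pp k).1).
have [C2 C20 H2] := bounded_layer (fun k => (pn k).1).
have B0 : 0 <= B by exact: le_trans (normr_ge0 _) (dpB 0 0).
exists (C1 + t * C2 + B + t * B + C2).
  by rewrite !addr_ge0 // ?mulr_ge0 // ltW.
have tC : 0 <= t * C2 by rewrite mulr_ge0 // ltW.
have tB : 0 <= t * B by rewrite mulr_ge0 // ltW.
move=> x Ox; have [_ /andP[r0 rt]] := layer_omega Ox.
have b (q r C : R) : 0 <= r <= t -> `|q| <= C -> `|r * q| <= t * C.
  by move=> /andP[? ?] ?; rewrite normrM; apply: ler_pM => //; rewrite ger0_norm.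
have rr : 0 <= x.2 - (layer t x.2)%:R * t <= t by rewrite r0 rt.
split; rewrite /plate /plate1 /plate2.
- apply: le_trans (ler_normD _ _) _.
  by have := H1 _ Ox; have := b _ _ _ rr (H2 _ Ox); lra.
- apply: le_trans (ler_normD _ _) _.
  by have := dpB (layer t x.2) x.1; have := b _ _ _ rr (dnB (layer t x.2) x.1); lra.
- by have := H2 _ Ox; lra.
Qed.

Variable phi : R * R -> R.
Hypothesis tphi : test_fun (omega L h) phi.

Lemma test_fun_omega0 x : ~ omega L h x -> phi x = 0 /\ forall j, partial j phi x = 0.
Proof.
have [K [_ _ KO phi0 dphi0]] := test_fun_support tphi.
by move=> nO; split => [|j]; [apply: phi0|apply: dphi0] => /KO.
Qed.

Lemma bounded_plate_test : exists2 C, 0 <= C & forall x j,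
  [/\ `|plate x * partial j phi x| <= C, `|plate1 x * phi x| <= C & `|plate2 x * phi x| <= C].
Proof.
have [C1 C10 H1] := bounded_plate.
have [C2 C20 H2] := test_fun_bounded tphi.
exists (C1 * C2); first exact: mulr_ge0.
move=> x j; have [Ox|nO] := pselect (omega L h x).
  have [? ? ?] := H1 _ Ox; have [? H] := H2 x.
  by rewrite !normrM; split; apply: ler_pM => //.
by have [-> /(_ j) ->] := test_fun_omega0 nO; rewrite !mulr0 normr0; split; exact: mulr_ge0.
Qed.

Let mphi : measurable_fun [set: mplane R] (phi : mplane R -> R).
Proof. by apply: measurable_continuous_plane; exact: test_fun_continuous tphi. Qed.

Let mdphi j : measurable_fun [set: mplane R] (partial j phi : mplane R -> R).
Proof. by apply: measurable_continuous_plane; exact: (@test_fun_partial_continuous _ _ _ tphi j). Qed.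

(** The partial derivatives of [plate * phi] inside a layer. *)
Let F1 x := plate x * partial 0 phi x + plate1 x * phi x.
Let F2 x := plate x * partial 1 phi x + plate2 x * phi x.

Let F_bounded : exists2 C, 0 <= C & forall x, `|F1 x| <= C /\ `|F2 x| <= C.
Proof.
have [C C0 H] := bounded_plate_test; exists (C + C); first exact: addr_ge0.
move=> x; have [? ? ?] := H x 0; have [? _ _] := H x 1.
by split; (apply: le_trans (ler_normD _ _) _; exact: lerD).
Qed.

Let F_omega x : ~ omega L h x -> F1 x = 0 /\ F2 x = 0.
Proof.
move=> /test_fun_omega0 [phi0 dphi0].
by rewrite /F1 /F2 phi0 !dphi0 !mulr0 !addr0.
Qed.

Let mF1 : measurable_fun [set: mplane R] (F1 : mplane R -> R).
Proof.
by apply: measurable_funD; apply: measurable_funM => //; [exact: measurable_plate|exact: measurable_plate1].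
Qed.

Let mF2 : measurable_fun [set: mplane R] (F2 : mplane R -> R).
Proof.
by apply: measurable_funD; apply: measurable_funM => //; [exact: measurable_plate|exact: measurable_plate2].
Qed.

(** Fubini with the inner integral along horizontal lines, which cross no interface: on each of them
    [F1] is the derivative of a function that vanishes at both ends. *)
Lemma integral_plate_partial0 : (\int[leb2]_x (F1 x)%:E = 0)%E.
Proof.
have [C C0 FC] := F_bounded.
have iF : leb2.-integrable [set: mplane R] (fun x => (F1 x)%:E).
  by apply: (integrable_plane L0 h0 mF1 (fun x => (FC x).1)) => x /F_omega[].
rewrite /leb2 -integral21_prod_meas1 //; apply: integral0_eq => y _.
rewrite /fubini_G /=.
rewrite (@integral_support _ _ _ _ (`[-L, L]%classic : set (measurableTypeR R))); last first.
  move=> x xL; rewrite (F_omega _).1 // => -[/andP[Lx xL'] _]; apply: xL.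
  by rewrite /= in_itv /=; apply/andP; split; exact: ltW.
set k := layer t y; set r := y - k%:R * t.
have LL : -L <= L by rewrite ge0_cp // ltW.
have pw : piecewise_deriv (fun s => (p k s + r * n k s) * phi (s, y))
                          (fun s => F1 (s, y)).
  have := piecewise_derivM (piecewise_derivD (pp k) (piecewise_derivZ r (pn k)))
     (piecewise_deriv_C1 (fun s => test_fun_partial0 tphi s y)
        (continuous_pair_l (@test_fun_partial_continuous _ _ _ tphi 0))).
  by congr piecewise_deriv; apply/funext => s; rewrite /F1 addrC.
rewrite (piecewise_FTC LL pw (fun s _ => (FC (s, y)).1)).
have phiL s : `|s| = L -> phi (s, y) = 0.
  move=> sL; apply: (test_fun_omega0 _).1 => -[/= /andP[s1 s2] _].
  by move/eqP: sL; rewrite lt_eqF // ltr_norml s1.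
by rewrite !phiL ?mulr0 ?subrr // ?normrN ger0_norm // ltW.
Qed.

(** Trace from above minus trace from below on the line at height [k t]. At [k = 0] the predecessor
    is again 0 and the value has no meaning; the sums over interfaces run over [0 < k]. *)
Definition plate_jump (k : nat) (s : R) : R := p k s - (p k.-1 s + t * n k.-1 s).

Let integral_layers (x : R) m : (\int[lebesgue_measure]_(y in `[0%R, (m%:R * t)%R[) (F2 (x, y))%:E =
  (\sum_(k < m) ((p k x + t * n k x) * phi (x, k.+1%:R * t) - p k x * phi (x, k%:R * t))%R)%:E)%E.
Proof.
have [C C0 FC] := F_bounded.
have mF y : measurable_fun [set: measurableTypeR R] (fun y => F2 (x, y)).
  by apply: (measurableT_comp mF2); apply: measurable_fun_pair => //; exact: measurable_cst.
elim: m => [|m IH]; first by rewrite mul0r big_ord0 set_itv_ge ?bnd_simp ?ltxx // integral_set0.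
have mt : m%:R * t <= m.+1%:R * t by rewrite ler_wpM2r ?ler_nat // ltW.
have m0 : 0 <= m%:R * t by rewrite mulr_ge0 // ltW.
have -> : `[0, m.+1%:R * t[%classic = `[0, m%:R * t[%classic `|` `[m%:R * t, m.+1%:R * t[%classic :> set R.
  by rewrite -itv_bndbnd_setU // bnd_simp.
rewrite integral_setU //; last 2 first.
- by apply/measurable_EFinP; apply: measurable_funTS; exact: mF.
- apply/disj_setPRL => y /=; rewrite !in_itv /= => /andP[my _] /andP[_].
  by rewrite ltNge my.
rewrite {}IH big_ord_recr /= EFinD; congr (_ + _)%E.
pose q y := p m x + (y - m%:R * t) * n m x.
pose F y := q y * partial 1 phi (x, y) + n m x * phi (x, y).
(* On the half-open strip [F2] coincides with [F], which is continuous across the upper edge; the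
   fundamental theorem is applied to [F] on the closed strip. *)
rewrite (eq_integral (fun y : measurableTypeR R => (F y)%:E)); last first.
  move=> y; rewrite inE /= in_itv /= => my.
  by rewrite /F2 /F /plate /plate2 /= (layer_eq t0 my).
have dq (y : R) : is_derive y 1 q (n m x).
  apply: is_derive_eq; rewrite /GRing.scale /=; ring.
have cn : continuous (fun _ : R => n m x) by move=> y; exact: cvg_cst.
have dF : piecewise_deriv (fun y => q y * phi (x, y)) F.
  have := piecewise_derivM (piecewise_deriv_C1 dq cn)
    (piecewise_deriv_C1 (test_fun_partial1 tphi x)
        (continuous_pair_r (@test_fun_partial_continuous _ _ _ tphi 1))).
  by move=> H; apply: (piecewise_deriv_eq (E := [::]) H) => s _; rewrite /F addrC.
have cF : continuous F.
  move=> y; apply: cvgD; apply: cvgM; [|exact: (continuous_pair_r (@test_fun_partial_continuous _ _ _ tphi 1))|exact: cvg_cst|exact: (continuous_pair_r (test_fun_continuous tphi))].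
  by apply/differentiable_continuous/derivable1_diffP; exact: ex_derive.
have [C' _ FC'] := continuous_bounded_itv (m%:R * t) (m.+1%:R * t) cF.
rewrite integral_itv_bndo_bndc; last first.
  by apply: measurable_funTS; apply/measurable_EFinP; exact: continuous_measurable_fun.
rewrite (piecewise_FTC mt dF FC') /q subrr mul0r addr0; congr ((_ * _ - _)%:E); congr (_ + _ * _).
by rewrite -natr1; ring.
Qed.

Lemma integrable_plate_jump k :
  lebesgue_measure.-integrable [set: measurableTypeR R]
    (fun s => (plate_jump k s * phi (s, k%:R * t))%:E).
Proof.
pose f s := plate_jump k s * phi (s, k%:R * t).
have cf : continuous f.
  move=> s; apply: cvgM; last exact: (continuous_pair_l (test_fun_continuous tphi)).
  apply: cvgB; first exact: (pp k).1.
  apply: cvgD; first exact: (pp k.-1).1.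
  by apply: cvgM; [exact: cvg_cst|exact: (pn k.-1).1].
have icf : lebesgue_measure.-integrable (`[-L, L]%classic : set (measurableTypeR R)) (EFin \o f).
  apply: continuous_compact_integrable; first exact: segment_compact.
  exact: continuous_subspaceT.
have mI : measurable (`[-L, L]%classic : set (measurableTypeR R)) by exact: measurable_itv.
have := (integrable_mkcond _ mI).1 icf; congr (is_true (integrable _ _ _)).
apply/funext => s; rewrite patchE; case: ifPn => // /negP sL.
rewrite (test_fun_omega0 _).1 ?mulr0 // => -[/= /andP[s1 s2] _]; apply: sL.
by rewrite inE /= in_itv /=; apply/andP; split; exact: ltW.
Qed.

Lemma integral_plate_partial1 : (\int[leb2]_x (F2 x)%:E =
  - \sum_(k < M | (0 < k)%N)
    \int[lebesgue_measure]_s (plate_jump k s * phi (s, k%:R * t))%:E)%E.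
Proof.
have [C C0 FC] := F_bounded.
have iF : leb2.-integrable [set: mplane R] (fun x => (F2 x)%:E).
  by apply: (integrable_plane L0 h0 mF2 (fun x => (FC x).2)) => x /F_omega[].
rewrite /leb2 -integral12_prod_meas1 //.
have M0 : (0 < M)%N by rewrite -(ltr_nat R) -(ltr_pM2r t0) mul0r (lt_le_trans h0 hM).
rewrite (eq_integral (fun s : measurableTypeR R =>
    (\sum_(k < M | (0 < k)%N) (- (plate_jump k s * phi (s, k%:R * t)))%:E)%E)); last first.
  move=> x _; rewrite /fubini_F /=.
  rewrite (@integral_support _ _ _ _ (`[0, M%:R * t[%classic : set (measurableTypeR R))); last first.
    move=> y yM; rewrite (F_omega _).2 // => -[_ /andP[y0 yh]]; apply: yM.
    by rewrite /= in_itv /= (ltW y0) (lt_le_trans yh).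
  (* This removes the two extreme boundary terms: the lowest line is at height 0, the highest at
     [M t], which may exceed [h]. *)
  have phi0 y : ~ (0 < y < h) -> phi (x, y) = 0.
    by move=> yh; apply: (test_fun_omega0 _).1 => -[_].
  rewrite integral_layers sumEFin; congr (_%:E); move: M0 phi0 hM; case: M => // m _ phi0 hm.
  (* The index is shifted so that the value at [k.+1] is the upper boundary term of layer [k]; its
     value at 0 does not occur. *)
  have := @sum_by_parts R (fun k => (p k.-1 x + t * n k.-1 x) * phi (x, k%:R * t))
     (fun k => p k x * phi (x, k%:R * t)) m; rewrite /= => ->.
  rewrite mul0r !phi0 ?ltxx //; last by move=> /andP[_]; rewrite ltNge hm.
  rewrite !mulr0 subrr sub0r -sumrN; apply: eq_bigr => k _; congr (- _).
  by rewrite /plate_jump mulrBl.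
rewrite integral_sum //; last first.
  by move=> k; have := integrableN (integrable_plate_jump k).
rewrite -fin_num_sumeN; last by move=> k _; apply: integrable_fin_num => //; exact: integrable_plate_jump.
apply: eq_bigr => k _; have := integralZl measurableT (integrable_plate_jump k) (-1).
rewrite EFinN mulN1e => <-; apply: eq_integral => s _.
by rewrite EFinN mulN1e.
Qed.
End ScalarPlate.

(** * One-sided approximate limits and jump points *)

Section OneSidedLimit.
Context {R : realType}.
Implicit Types (u : R * R -> R * R) (x nu a : R * R).

Lemma enorm_ge0 (p : R * R) : 0 <= enorm p.
Proof. exact: sqrtr_ge0. Qed.

Lemma enorm_le_sum (p : R * R) : enorm p <= `|p.1| + `|p.2|.
Proof.
rewrite -(ler_sqr (x := enorm p)) ?nnegrE ?enorm_ge0 ?addr_ge0 //.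
rewrite /enorm sqr_sqrtr; last by rewrite /dotp -!expr2 addr_ge0 ?sqr_ge0.
rewrite sqrrD !real_normK ?num_real // /dotp -!expr2.
by have : 0 <= `|p.1| * `|p.2|; [exact: mulr_ge0|lra].
Qed.

Definition continuous_at_plane u x : Prop := forall e, 0 < e ->
  exists2 d : R, 0 < d & forall q, `|q.1 - x.1| < d -> `|q.2 - x.2| < d ->
    `|(u q).1 - (u x).1| < e /\ `|(u q).2 - (u x).2| < e.

Lemma one_sided_limitI u x nu a :
  (forall e, 0 < e -> exists2 d : R, 0 < d & forall q, half_ball x nu d q ->
     `|(u q).1 - a.1| < e /\ `|(u q).2 - a.2| < e) ->
  one_sided_limit u x nu a.
Proof.
move=> ua; rewrite /one_sided_limit.
have small e : 0 < e -> \forall r \near 0^'+,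
    (0 <= (r ^- 2)%:E * \int[leb2]_(y in half_ball x nu r) (enorm (u y - a))%:E <= e%:E)%E.
  (* Components within [e / 8] bound the integrand by [e / 4], and the half ball lies in a square of
     area [4 r ^ 2]; after division by [r ^ 2] this leaves [e]. *)
  move=> e0; have [d d0 Hd] := ua (e / 8) ltac:(lra).
  near=> r.
  have r0 : 0 < r by near: r; exact: nbhs_right_gt.
  have rd : r < d by near: r; exact: nbhs_right_lt.
  have i0 : (0 <= \int[leb2]_(y in half_ball x nu r) (enorm (u y - a))%:E)%E.
    by apply: integral_ge0 => y _; rewrite lee_fin enorm_ge0.
  apply/andP; split; first by apply: mule_ge0 => //; rewrite lee_fin invr_ge0 exprn_ge0 // ltW.
  pose Bx : set (mplane R) := `]x.1 - r, x.1 + r[%classic `*` `]x.2 - r, x.2 + r[%classic.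
  have mB : measurable Bx by apply: measurableX; exact: measurable_itv.
  have lB : leb2 Bx = (4 * r ^+ 2)%:E.
    by rewrite leb2_box; [congr (_%:E); ring|lra|lra].
  have : (\int[leb2]_(y in half_ball x nu r) (enorm (u y - a))%:E <= \int[leb2]_(y in Bx) (e / 4)%:E)%E.
    apply: ge0_le_integral_nonmeasurable => [y _|y _|y [yr ynu]]; rewrite ?lee_fin ?enorm_ge0 //; first lra.
    have [y1 y2] := le_norm_enorm (y - x).
    have := le_lt_trans y1 yr; have := le_lt_trans y2 yr; rewrite /= !ltr_norml => /andP[? ?] /andP[? ?].
    split; first by rewrite /Bx /= !in_itv /=; split; apply/andP; split; lra.
    have [? ?] := Hd y (conj (lt_trans yr rd) ynu).
    by apply: le_trans (enorm_le_sum _) _; rewrite /=; lra.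
  rewrite integral_cst // => H.
  apply: (@le_trans _ _ ((r ^- 2)%:E * ((e / 4)%:E * leb2 Bx))%E).
    by apply: lee_wpmul2l => //; rewrite lee_fin invr_ge0 exprn_ge0 // ltW.
  rewrite lB -!EFinM lee_fin [X in X <= _](_ : _ = e) //.
  by field; rewrite gt_eqF.
apply/fine_cvgP; split.
  near=> r; have : (0 <= (r ^- 2)%:E * \int[leb2]_(y in half_ball x nu r) (enorm (u y - a))%:E <= 1%:E)%E.
    by near: r; exact: small.
  by move=> /andP[f0 f1]; rewrite ge0_fin_numE // (le_lt_trans f1) // ltry.
apply/cvgr0Pnorm_le => e e0; near=> r.
have : (0 <= (r ^- 2)%:E * \int[leb2]_(y in half_ball x nu r) (enorm (u y - a))%:E <= e%:E)%E.
  by near: r; exact: small.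
move=> /andP[f0 fe] /=; rewrite ger0_norm ?fine_ge0 // -lee_fin fineK //.
by rewrite ge0_fin_numE // (le_lt_trans fe) // ltry.
Unshelve. all: by end_near. Qed.

(** Bounds the area of a half ball from below by that of a square, centred at distance [r / 2] in
    the direction [nu]. *)
Lemma half_ball_box x nu r (y : R * R) : enorm nu = 1 -> 0 < r ->
  `|y.1 - (x.1 + r / 2 * nu.1)| < r / 4 -> `|y.2 - (x.2 + r / 2 * nu.2)| < r / 4 ->
  half_ball x nu r y.
Proof.
move=> nu1 r0 y1 y2.
have nu2 : nu.1 ^+ 2 + nu.2 ^+ 2 = 1.
  have : enorm nu ^+ 2 = 1 by rewrite nu1 expr1n.
  by rewrite /enorm sqr_sqrtr /dotp -!expr2 // addr_ge0 ?sqr_ge0.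
set d1 := y.1 - _ in y1; set d2 := y.2 - _ in y2.
have e1 : y.1 - x.1 = r / 2 * nu.1 + d1 by rewrite /d1; ring.
have e2 : y.2 - x.2 = r / 2 * nu.2 + d2 by rewrite /d2; ring.
(* [3 / 2] is a rational bound for the square root of 2, the maximum over unit vectors. *)
have nu32 : `|nu.1| + `|nu.2| <= 3 / 2.
  have h32 : 0 <= 3 / 2 :> R by lra.
  rewrite -(@ler_sqr _ (`|nu.1| + `|nu.2|) (3 / 2)) ?nnegrE ?addr_ge0 //.
  have := sqr_ge0 (`|nu.1| - `|nu.2|); rewrite sqrrB sqrrD !real_normK ?num_real //; lra.
have dnu : `|d1 * nu.1 + d2 * nu.2| <= r / 4 * (3 / 2).
  apply: le_trans (ler_normD _ _) _; rewrite !normrM.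
  apply: (@le_trans _ _ (r / 4 * (`|nu.1| + `|nu.2|))); last by rewrite ler_wpM2l //; lra.
  by rewrite mulrDr lerD // ler_wpM2r // ltW.
have dd : d1 ^+ 2 + d2 ^+ 2 <= 2 * (r / 4) ^+ 2.
  have sq (d : R) : `|d| < r / 4 -> d ^+ 2 <= (r / 4) ^+ 2.
    by move=> dr; rewrite -(real_normK (num_real d)) ler_sqr ?nnegrE // ?(ltW dr) //; lra.
  by have := sq _ y1; have := sq _ y2; lra.
move: dnu; rewrite ler_norml => /andP[n1 n2].
split.
  rewrite -(ltr_sqr (x := enorm _)) ?nnegrE ?enorm_ge0 ?(ltW r0) //.
  rewrite /enorm sqr_sqrtr /dotp -!expr2; last by rewrite addr_ge0 ?sqr_ge0.
  rewrite /= e1 e2.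
  have -> : (r / 2 * nu.1 + d1) ^+ 2 + (r / 2 * nu.2 + d2) ^+ 2 =
    (r / 2) ^+ 2 * (nu.1 ^+ 2 + nu.2 ^+ 2) + r * (d1 * nu.1 + d2 * nu.2) + (d1 ^+ 2 + d2 ^+ 2) by field.
  rewrite nu2 mulr1.
  have : r * (d1 * nu.1 + d2 * nu.2) <= r * (r / 4 * (3 / 2)) by rewrite ler_wpM2l // ltW.
  have : 0 < r ^+ 2 by rewrite exprn_gt0.
  move: dd; rewrite !expr2; lra.
rewrite /dotp /= e1 e2.
have -> : (r / 2 * nu.1 + d1) * nu.1 + (r / 2 * nu.2 + d2) * nu.2 =
  r / 2 * (nu.1 ^+ 2 + nu.2 ^+ 2) + (d1 * nu.1 + d2 * nu.2) by ring.
by rewrite nu2; lra.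
Qed.

Lemma one_sided_limit_continuous u x nu a : enorm nu = 1 -> continuous_at_plane u x ->
  one_sided_limit u x nu a -> a = u x.
Proof.
move=> nu1 cu ua.
suff key (proj : R * R -> R) : (forall p, `|proj p| <= enorm p) -> (forall p q, proj (p - q) = proj p - proj q) ->
   (forall e, 0 < e -> exists2 d : R, 0 < d & forall q, `|q.1 - x.1| < d -> `|q.2 - x.2| < d -> `|proj (u q) - proj (u x)| < e) ->
   proj a = proj (u x).
  rewrite [a]surjective_pairing [u x]surjective_pairing; congr (_, _).
    apply: key => // [p|e e0]; first by case: (le_norm_enorm p).
    by have [d d0 H] := cu e e0; exists d => // q q1 q2; have [] := H q q1 q2.
  apply: key => // [p|e e0]; first by case: (le_norm_enorm p).
  by have [d d0 H] := cu e e0; exists d => // q q1 q2; have [] := H q q1 q2.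
move=> pn pB cp; apply/eqP; rewrite -subr_eq0 -normr_le0 leNgt; apply/negP.
set e := `|_ - _| => e0; have [d d0 Hd] := cp (e / 2) ltac:(lra).
(* Near [x] the integrand is at least [e / 2] on a square of area [r ^ 2 / 4]. The scaled integral
   is then at least [e / 8], against the bound [e / 16] obtained here. *)
move: ua => /fine_cvgP[ffin /cvgr0Pnorm_le /(_ (e / 16) ltac:(lra)) fe].
suff : \forall r \near (0 : R)^'+, False by move=> /filter_ex [].
near=> r.
have r0 : 0 < r by near: r; exact: nbhs_right_gt.
have rd : r < d by near: r; exact: nbhs_right_lt.
have : ((r ^- 2)%:E * \int[leb2]_(y in half_ball x nu r) (enorm (u y - a))%:E)%E \is a fin_num.
  by near: r.
have : `|fine ((r ^- 2)%:E * \int[leb2]_(y in half_ball x nu r) (enorm (u y - a))%:E)%E| <= e / 16.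
  by near: r.
set f := (_ * _)%E => fle ffin'.
pose c := (x.1 + r / 2 * nu.1, x.2 + r / 2 * nu.2).
pose Bx : set (mplane R) := `]c.1 - r / 4, c.1 + r / 4[%classic `*` `]c.2 - r / 4, c.2 + r / 4[%classic.
have mB : measurable Bx by apply: measurableX; exact: measurable_itv.
have lB : leb2 Bx = (r ^+ 2 / 4)%:E.
  by rewrite leb2_box; [congr (_%:E); field|lra|lra].
have : (\int[leb2]_(y in Bx) (e / 2)%:E <= \int[leb2]_(y in half_ball x nu r) (enorm (u y - a))%:E)%E.
  apply: ge0_le_integral_nonmeasurable => [y _|y _|y]; rewrite ?lee_fin ?enorm_ge0 //; first lra.
  rewrite /Bx /= !in_itv /= => -[/andP[a1 a2] /andP[b1 b2]].
  have hy : half_ball x nu r y.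
    by apply: half_ball_box => //; rewrite ltr_norml; apply/andP; split; move: a1 a2 b1 b2; rewrite /c /=; lra.
  split => //; have [yr _] := hy; have [y1 y2] := le_norm_enorm (y - x).
  have := Hd y (le_lt_trans y1 (lt_trans yr rd)) (le_lt_trans y2 (lt_trans yr rd)).
  have := pn (u y - a); rewrite pB.
  have := ler_normD (proj a - proj (u y)) (proj (u y) - proj (u x)).
  rewrite addrA subrK -/e [`|proj a - _|]distrC; lra.
rewrite integral_cst // => H.
have : ((r ^- 2)%:E * ((e / 2)%:E * leb2 Bx) <= f)%E.
  by apply: lee_wpmul2l => //; rewrite lee_fin invr_ge0 exprn_ge0 // ltW.
rewrite lB -!EFinM -(fineK ffin') lee_fin [X in X <= _](_ : _ = e / 8); last first.
  by field; rewrite gt_eqF.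
by have := ler_norm (fine f); lra.
Unshelve. all: by end_near. Qed.

Lemma continuous_no_jump u x : continuous_at_plane u x -> ~ exists a b nu, jump_at u x a b nu.
Proof.
move=> cu [a [b [nu [nu1 ab la lb]]]]; apply: ab.
rewrite (one_sided_limit_continuous nu1 cu la); apply/esym.
apply: one_sided_limit_continuous cu lb.
by rewrite -nu1 /enorm /dotp /= !mulrNN.
Qed.

End OneSidedLimit.

Lemma integral_subset_support d (T : measurableType d) (R : realType)
    (mu : {measure set T -> \bar R}) (D E : set T) (f : T -> \bar R) :
  E `<=` D -> (forall x, D x -> ~ E x -> f x = 0%E) ->
  (\int[mu]_(x in D) f x = \int[mu]_(x in E) f x)%E.
Proof.
move=> ED f0; rewrite integral_mkcond [RHS]integral_mkcond; apply: eq_integral => x _.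
rewrite !patchE; case: ifPn => [/set_mem Dx|/negP nD]; case: ifPn => //.
  by move=> /negP nE; apply: f0 => // Ex; apply: nE; rewrite inE.
by move=> /set_mem Ex; case: nD; rewrite inE; exact: ED.
Qed.

Lemma eq_integral_on d (T : measurableType d) (R : realType) (m : set T -> \bar R)
    (D : set T) (f g : T -> \bar R) :
  (forall x, D x -> f x = g x) -> (\int[m]_(x in D) f x = \int[m]_(x in D) g x)%E.
Proof.
move=> fg; rewrite /integral (_ : f \_ D = g \_ D) //; apply/funext => x.
by rewrite !patchE; case: ifPn => // /set_mem /fg.
Qed.

Lemma ord2P (i : 'I_2) : i = 0 \/ i = 1.
Proof. by case: i => -[|[|//]] il; [left|right]; exact: val_inj. Qed.

(** * Layered maps: distributional gradient, jump set and energy *)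

Section LayeredMap.
Context {R : realType}.
Variables (L h t S K : R) (gx gz th ka : nat -> R -> R).
Hypotheses (t0 : 0 < t) (L0 : 0 < L) (h0 : 0 < h) (S0 : 0 < S) (SL : S < L).
Hypothesis dgx : forall k, piecewise_deriv (gx k) (fun s => cos (th k s)).
Hypothesis dgz : forall k, piecewise_deriv (gz k) (fun s => sin (th k s)).
Hypothesis dth : forall k, piecewise_deriv (th k) (ka k).
Hypothesis kaK : forall k s, `|ka k s| <= K.
Hypothesis ka0 : forall k s, S <= `|s| -> ka k s = 0.

Definition midline (i : 'I_2) k s : R := if i == 0 then gx k s else gz k s.
Definition normal (i : 'I_2) k s : R := if i == 0 then - sin (th k s) else cos (th k s).
Definition tangent (i : 'I_2) k s : R := if i == 0 then cos (th k s) else sin (th k s).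
(** The derivative of the normal, by Frenet's formula. *)
Definition dnormal (i : 'I_2) k s : R := - (ka k s * tangent i k s).

Definition layered_map (x : R * R) : R * R :=
  (plate t (midline 0) (normal 0) x, plate t (midline 1) (normal 1) x).
Definition layered_grad (x : R * R) : 'M[R]_2 :=
  \matrix_(i, j) if j == 0 then plate1 t (tangent i) (dnormal i) x else plate2 t (normal i) x.

Definition layer_jump (i : 'I_2) := plate_jump t (midline i) (normal i).

Definition delaminated : set (R * R) :=
  [set x | `|x.1| < S /\ exists k : nat, [/\ (0 < k)%N, k%:R * t < h & x.2 = k%:R * t]].

Hypothesis glued : forall k s, (0 < k)%N -> k%:R * t < h -> S <= `|s| ->
  forall i, layer_jump i k s = 0.
Hypothesis split_open : forall k s, (0 < k)%N -> k%:R * t < h -> `|s| < S ->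
  exists i, layer_jump i k s <> 0.

(** If [h] is a multiple of [t], the line at height [h] is counted among the interfaces; it lies
    outside of the open plate, and test functions vanish on it. *)
Let M := (layer t h).+1.

Let hM : h <= M%:R * t.
Proof. by have /andP[_ /ltW] := layer_itv t0 (ltW h0). Qed.

Lemma crd_layered_map x i : crd (layered_map x) i = plate t (midline i) (normal i) x.
Proof. by case: (ord2P i) => ->. Qed.

Let dmid i k : piecewise_deriv (midline i k) (tangent i k).
Proof. by case: (ord2P i) => ->; [exact: dgx|exact: dgz]. Qed.

Let dnor i k : piecewise_deriv (normal i k) (dnormal i k).
Proof.
have csin : continuous (@sin R) by exact: continuous_sin.
have ccos : continuous (@cos R) by exact: continuous_cos.
have cNsin : continuous (fun z : R => - sin z) by move=> z; apply: cvgN; exact: csin.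
have cNcos : continuous (fun z : R => - cos z) by move=> z; apply: cvgN; exact: ccos.
case: (ord2P i) => ->.
  have := @piecewise_deriv_comp _ (fun z => - sin z) _ _ (fun z => - cos z)
    (fun z => is_deriveN (is_derive_sin z)) cNcos (dth k).
  move=> H; apply: (piecewise_deriv_eq (E := [::]) H) => s _.
  by rewrite /dnormal /tangent /= mulNr mulrC.
have := @piecewise_deriv_comp _ cos _ _ (fun z => - sin z)
    (fun z => is_derive_cos z) cNsin (dth k).
move=> H; apply: (piecewise_deriv_eq (E := [::]) H) => s _.
by rewrite /dnormal /tangent /= mulNr mulrC.
Qed.

Let K0 : 0 <= K. Proof. exact: le_trans (normr_ge0 _) (kaK 0 0). Qed.

Lemma norm_tangent i k s : `|tangent i k s| <= 1.
Proof.
by rewrite /tangent; case: ifP => _; rewrite ler_norml ?cos_geN1 ?cos_le1 ?sin_geN1 ?sin_le1.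
Qed.

Let tanB i k s : `|tangent i k s| <= 1 + K.
Proof. by have := norm_tangent i k s; have := K0; lra. Qed.

Let dnorB i k s : `|dnormal i k s| <= 1 + K.
Proof.
rewrite /dnormal normrN normrM; apply: (@le_trans _ _ (K * 1)); last by have := K0; lra.
by apply: ler_pM => //; exact: norm_tangent.
Qed.

Lemma layered_grad0 x i : layered_grad x i 0 = plate1 t (tangent i) (dnormal i) x.
Proof. by rewrite mxE. Qed.

Lemma layered_grad1 x i : layered_grad x i 1 = plate2 t (normal i) x.
Proof. by rewrite mxE. Qed.

Lemma measurable_layered_map i :
  measurable_fun [set: mplane R] ((fun x => crd (layered_map x) i) : mplane R -> R).
Proof.
under eq_fun do rewrite crd_layered_map.
exact: (measurable_plate t0 (dmid i) (dnor i)).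
Qed.

Lemma measurable_layered_grad i j :
  measurable_fun [set: mplane R] ((fun x => layered_grad x i j) : mplane R -> R).
Proof.
case: (ord2P j) => ->.
  under eq_fun do rewrite layered_grad0.
  exact: (measurable_plate1 t0 (dmid i) (dnor i)).
under eq_fun do rewrite layered_grad1.
exact: (measurable_plate2 t0 (dnor i)).
Qed.

Lemma layered_bounded : exists2 C, 0 <= C & forall x, omega L h x ->
  forall i j, `|crd (layered_map x) i| <= C /\ `|layered_grad x i j| <= C.
Proof.
have [C0 C00 H0] := bounded_plate L t0 hM (dmid 0) (dnor 0) (tanB 0) (dnorB 0).
have [C1 C10 H1] := bounded_plate L t0 hM (dmid 1) (dnor 1) (tanB 1) (dnorB 1).
exists (C0 + C1); first exact: addr_ge0.
move=> x Ox i j; rewrite crd_layered_map.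
have [? ? ?] := H0 x Ox; have [? ? ?] := H1 x Ox.
by case: (ord2P i) => ->; case: (ord2P j) => ->; rewrite ?layered_grad0 ?layered_grad1; split; lra.
Qed.

Definition jump_term (phi : R * R -> R) (i j : 'I_2) : \bar R :=
  (if (j == 0)%R then 0 else
   \sum_(k < M | (0 < k)%N) \int[lebesgue_measure]_s (layer_jump i k s * phi (s, k%:R * t))%:E)%E.

(** The integrals extend over the whole plane, so that one formula serves the plate and all its
    subsets. *)
Lemma layered_map_parts phi : test_fun (omega L h) phi -> forall i j,
  (\int[leb2]_x (crd (layered_map x) i * partial j phi x)%:E =
   - (\int[leb2]_x (layered_grad x i j * phi x)%:E + jump_term phi i j))%E.
Proof.
move=> tphi i j.
have [C1 C10 H1] := layered_bounded.
have [C2 C20 H2] := test_fun_bounded tphi.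
have z x : ~ omega L h x -> phi x = 0 /\ forall j, partial j phi x = 0.
  exact: (test_fun_omega0 tphi).
have mphi : measurable_fun [set: mplane R] (phi : mplane R -> R).
  by apply: measurable_continuous_plane; exact: test_fun_continuous tphi.
have mdphi : measurable_fun [set: mplane R] (partial j phi : mplane R -> R).
  by apply: measurable_continuous_plane; exact: (@test_fun_partial_continuous _ _ _ tphi j).
have i1 : leb2.-integrable [set: mplane R] (fun x => (crd (layered_map x) i * partial j phi x)%:E).
  apply: (@integrable_plane _ _ _ L0 h0 (fun x => crd (layered_map x) i * partial j phi x) (C1 * C2)).
  - by apply: measurable_funM => //; exact: measurable_layered_map.
  - move=> x; have [Ox|nO] := pselect (omega L h x).
      by rewrite normrM; have [? _] := H1 x Ox i j; have [_ ?] := H2 x; exact: ler_pM.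
    by rewrite (z x nO).2 mulr0 normr0 mulr_ge0.
  - by move=> x nO; rewrite (z x nO).2 mulr0.
have i2 : leb2.-integrable [set: mplane R] (fun x => (layered_grad x i j * phi x)%:E).
  apply: (@integrable_plane _ _ _ L0 h0 (fun x => layered_grad x i j * phi x) (C1 * C2)).
  - by apply: measurable_funM => //; exact: measurable_layered_grad.
  - move=> x; have [Ox|nO] := pselect (omega L h x).
      by rewrite normrM; have [_ ?] := H1 x Ox i j; have [? _] := H2 x; exact: ler_pM.
    by rewrite (z x nO).1 mulr0 normr0 mulr_ge0.
  - by move=> x nO; rewrite (z x nO).1 mulr0.
have f1 := integrable_fin_num measurableT i1; have f2 := integrable_fin_num measurableT i2.
have fJ : jump_term phi i j \is a fin_num.
  rewrite /jump_term; case: ifP => // _; apply/sum_fin_numP => k _ _.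
  have := integrable_plate_jump t (dmid i) (dnor i) tphi k.
  exact: integrable_fin_num.
suff : (\int[leb2]_x (crd (layered_map x) i * partial j phi x)%:E +
  \int[leb2]_x (layered_grad x i j * phi x)%:E = - jump_term phi i j)%E.
  move: f1 f2 fJ; rewrite /leb2; case: (\int[_]_x _)%E => [a| |] //; case: (\int[_]_x _)%E => [b| |] //.
  case: (jump_term phi i j) => [c| |] // _ _ _; rewrite -!EFinD -!EFinN => -[ab]; congr (_%:E); lra.
rewrite /leb2 -integralD //; rewrite /jump_term; case: (ord2P j) => jE; rewrite jE /=.
  rewrite oppr0 -[RHS](integral_plate_partial0 t0 L0 h0 hM (dmid i) (dnor i) (tanB i) (dnorB i) tphi).
  by apply: eq_integral => x _; rewrite -EFinD crd_layered_map layered_grad0.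
rewrite -(integral_plate_partial1 t0 L0 h0 hM (dmid i) (dnor i) (tanB i) (dnorB i) tphi).
by apply: eq_integral => x _; rewrite -EFinD crd_layered_map layered_grad1.
Qed.

(** Layer [k] continued beyond its strip to a continuous map of the plane. The layered map is
    [lmap k] on strip [k], and both traces on an interface are values of such continuations. *)
Let lmap k (q : R * R) : R * R :=
  (midline 0 k q.1 + (q.2 - k%:R * t) * normal 0 k q.1,
   midline 1 k q.1 + (q.2 - k%:R * t) * normal 1 k q.1).

Let lmap_continuous k x : continuous_at_plane (lmap k) x.
Proof.
have cm i : continuous (fun q : R * R => midline i k q.1 + (q.2 - k%:R * t) * normal i k q.1).
  have c1 (f : R -> R) : continuous f -> continuous (fun q : R * R => f q.1).
    by move=> cf q; apply: (@continuous_comp _ _ _ fst f); [exact: cvg_fst|exact: cf].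
  move=> q; apply: cvgD; first by apply: (c1 (midline i k)); exact: (dmid i k).1.
  apply: cvgM; last by apply: (c1 (normal i k)); exact: (dnor i k).1.
  by apply: cvgB; [exact: cvg_snd|exact: cvg_cst].
move=> e e0.
have c i : \forall q \near x, `|(midline i k q.1 + (q.2 - k%:R * t) * normal i k q.1) -
    (midline i k x.1 + (x.2 - k%:R * t) * normal i k x.1)| < e.
  by have /cvgrPdistC_lt := cm i x; exact.
have [d d0 H] := (nbhs_planeP x _).1 (filterI (c 0) (c 1)).
by exists d => // q q1 q2; exact: H.
Qed.

Let layered_mapE k q : k%:R * t <= q.2 < k.+1%:R * t -> layered_map q = lmap k q.
Proof. by move=> /(layer_eq t0) kq; rewrite /layered_map /plate kq. Qed.

Let lmap_jump k s : (0 < k)%N -> (forall i, layer_jump i k s = 0) ->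
  lmap k.-1 (s, k%:R * t) = lmap k (s, k%:R * t).
Proof.
case: k => // k _ J0; have := J0 0; have := J0 1; rewrite /layer_jump /plate_jump /=.
move=> /eqP; rewrite subr_eq0 => /eqP j1 /eqP; rewrite subr_eq0 => /eqP j0.
by rewrite /lmap /= j0 j1 subrr !mul0r !addr0 -natr1; congr (_ + _ * _, _ + _ * _); ring.
Qed.

(** In the interior of a layer a single [lmap k] describes the map near [x]. On an interface beyond
    the cut two of them do, and [glued] makes them agree at [x]. *)
Lemma layered_map_continuous x : omega L h x -> ~ delaminated x ->
  continuous_at_plane layered_map x.
Proof.
move=> [_ /andP[x0 xh]] nJ; have := layer_itv t0 (ltW x0).
set k := layer t x.2 => kx; have /andP[kx1 kx2] := kx.
have [kx3|xk3] := ltP (k%:R * t) x.2.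
  move=> e e0; have [d d0 H] := @lmap_continuous k x e e0.
  exists (Num.min d (Num.min (x.2 - k%:R * t) (k.+1%:R * t - x.2))).
    by rewrite !lt_min d0 !subr_gt0 kx3.
  move=> q; rewrite !lt_min => /andP[q1 _] /and3P[q2 q3 q4].
  rewrite (layered_mapE kx) (@layered_mapE k q); first exact: H.
  by move: q3 q4; rewrite !ltr_norml => /andP[? ?] /andP[? ?]; apply/andP; split; lra.
have xk : x.2 = k%:R * t by apply/eqP; rewrite eq_le xk3 kx1.
have k0 : (0 < k)%N.
  by rewrite lt0n; apply/negP => /eqP k0; move: x0; rewrite xk k0 mul0r ltxx.
have kh : k%:R * t < h by rewrite -xk.
have Sx : S <= `|x.1|.
  by rewrite leNgt; apply/negP => xS; apply: nJ; split => //; exists k.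
move=> e e0; have [d d0 H] := @lmap_continuous k x e e0.
have [d' d'0 H'] := @lmap_continuous k.-1 x e e0.
exists (Num.min d (Num.min d' t)); first by rewrite !lt_min d0 d'0.
move=> q; rewrite !lt_min => /and3P[q1 q1' _] /and3P[q2 q2' qt].
rewrite (layered_mapE kx); move: qt; rewrite xk ltr_norml => /andP[qt1 qt2].
have [kq|qk] := leP (k%:R * t) q.2.
  rewrite (@layered_mapE k q); first exact: H.
  by rewrite kq -natr1 mulrDl mul1r; lra.
rewrite (@layered_mapE k.-1 q); last first.
  rewrite prednK // qk andbT; have : k%:R = k.-1%:R + 1 :> R by rewrite natr1 prednK.
  by move=> kk; rewrite kk in qt1 *; lra.
have -> : lmap k x = lmap k.-1 x.
  rewrite [x]surjective_pairing xk; apply/esym; apply: lmap_jump => //; exact: glued.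
exact: H'.
Qed.

(** The upper trace is the value itself, since an interface belongs to the layer above it. *)
Lemma layered_map_jump x : delaminated x -> jump_at layered_map x (layered_map x)
  (lmap (layer t x.2).-1 x) (0, 1).
Proof.
move=> [xS [k [k0 kh xk]]].
have kx : k%:R * t <= x.2 < k.+1%:R * t.
  by rewrite xk lexx -natr1 mulrDl mul1r ltrDl.
rewrite (layer_eq t0 kx); split.
- by rewrite /enorm /dotp /= mulr0 add0r mulr1 sqrtr1.
- rewrite (layered_mapE kx) => E; have [i] := split_open k0 kh xS; apply.
  rewrite /layer_jump /plate_jump.
  have kk : k%:R = k.-1%:R + 1 :> R by rewrite natr1 prednK.
  move: E; rewrite /lmap xk subrr !mul0r !addr0 => -[E0 E1].
  have -> : t = k%:R * t - k.-1%:R * t by rewrite kk; ring.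
  by case: (ord2P i) => ->; [rewrite E0|rewrite E1]; rewrite subrr.
- apply: one_sided_limitI => e e0; have [d d0 H] := @lmap_continuous k x e e0.
  exists (Num.min d t); first by rewrite lt_min d0.
  move=> q [qx qnu].
  have q2 : x.2 < q.2 by move: qnu; rewrite /dotp /= mulr0 add0r mulr1 subr_gt0.
  have [y1 y2] := le_norm_enorm (q - x).
  move: qx; rewrite lt_min => /andP[qd qt].
  rewrite (layered_mapE kx) (@layered_mapE k q).
    by apply: H; [exact: le_lt_trans y1 qd|exact: le_lt_trans y2 qd].
  have := le_lt_trans y2 qt; rewrite /= ltr_norml xk => /andP[? ?].
  by move: q2; rewrite xk -natr1 mulrDl mul1r => ?; apply/andP; split; lra.
- apply: one_sided_limitI => e e0; have [d d0 H] := @lmap_continuous k.-1 x e e0.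
  exists (Num.min d t); first by rewrite lt_min d0.
  move=> q [qx qnu].
  have q2 : q.2 < x.2 by move: qnu; rewrite /dotp /= oppr0 mulr0 add0r mulrN1 oppr_gt0 subr_lt0.
  have [y1 y2] := le_norm_enorm (q - x).
  move: qx; rewrite lt_min => /andP[qd qt].
  rewrite (@layered_mapE k.-1 q).
    by apply: H; [exact: le_lt_trans y1 qd|exact: le_lt_trans y2 qd].
  have := le_lt_trans y2 qt; rewrite /= ltr_norml xk => /andP[y3 y4].
  have kk : k%:R = k.-1%:R + 1 :> R by rewrite natr1 prednK.
  by move: q2 y3 y4; rewrite xk prednK // kk => ? ? ?; apply/andP; split; lra.
Qed.

Lemma delaminated_omega : delaminated `<=` omega L h.
Proof.
move=> x [xS [k [k0 kh xk]]]; split; first by rewrite -ltr_norml (lt_trans xS).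
by rewrite xk kh mulr_gt0 // ltr0n.
Qed.

Lemma jump_set_layered : jump_set (omega L h) layered_map = delaminated.
Proof.
apply/seteqP; split => [x [Ox jx]|x Jx].
  by apply: contrapT => nJ; exact: (continuous_no_jump (layered_map_continuous Ox nJ)).
split; first exact: delaminated_omega.
by exists (layered_map x), (lmap (layer t x.2).-1 x), (0, 1); exact: layered_map_jump.
Qed.

Let slice_delaminated k : slice delaminated (k%:R * t) =
  if (0 < k)%N && (k%:R * t < h) then `]-S, S[%classic else set0.
Proof.
case: ifPn => [/andP[k0 kh]|/negP kN]; apply/seteqP; split => // s.
- by move=> [/= + _]; rewrite in_itv /= ltr_norml.
- by rewrite /= in_itv /= => sS; split; [rewrite ltr_norml|exists k].
- move=> [_ [l [l0 lh /= /eqP]]]; rewrite (inj_eq (mulIf (lt0r_neq0 t0))) eqr_nat => /eqP kl.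
  by apply: kN; rewrite kl l0.
Qed.

Lemma measurable_delaminated : measurable (delaminated : set (mplane R)).
Proof.
pose F k : set (mplane R) := if (0 < k)%N && (k%:R * t < h) then
  `]-S, S[%classic `*` [set k%:R * t] else set0.
rewrite (_ : delaminated = \bigcup_k F k).
  apply: bigcupT_measurable => k; rewrite /F; case: ifP => // _.
  by apply: measurableX; [exact: measurable_itv|exact: measurable_set1].
apply/seteqP; split => [x [xS [k [k0 kh xk]]]|x [k _]].
  by exists k => //; rewrite /F k0 kh; split => //=; rewrite in_itv /= -ltr_norml.
rewrite /F; case: ifP => // /andP[k0 kh] [/= + xk]; rewrite in_itv /= -ltr_norml => xS.
by split => //; exists k.
Qed.

Let delaminated_lines p : delaminated p ->
  - S - 1 < p.1 /\ exists2 k, (k < M)%N & p.2 = k%:R * t.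
Proof.
move=> [pS [k [k0 kh pk]]]; split; first by move: pS; rewrite ltr_norml => /andP[? _]; lra.
exists k => //; rewrite -(ltr_nat R) -(ltr_pM2r t0); exact: lt_le_trans kh hM.
Qed.

Let lebesgue_slice k : (lebesgue_measure (slice delaminated (k%:R * t)) <= (2 * S)%:E)%E.
Proof.
rewrite slice_delaminated; case: ifP => _; last by rewrite measure0 lee_fin; have := S0; lra.
have := lebesgue_measure_itv `]-S, S[; rewrite /= => ->.
by rewrite lte_fin; case: ifP => _; rewrite ?lee_fin; have := S0; lra.
Qed.

Lemma hausdorff1_delaminated n : h <= n.+1%:R * t ->
  (hausdorff1 delaminated <= (2 * S * n%:R)%:E)%E.
Proof.
move=> hn; have lines p : delaminated p -> - S - 1 < p.1 /\ exists2 k, (k < n.+1)%N & p.2 = k%:R * t.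
  move=> Dp; split; first by have [] := delaminated_lines Dp.
  case: Dp => _ [k [_ kh pk]]; exists k => //; rewrite -(ltr_nat R) -(ltr_pM2r t0).
  exact: lt_le_trans kh hn.
rewrite (hausdorff1_hlines t0 measurable_delaminated lines).
(* Height 0 carries no cut, so [n] of the [n.+1] lines remain. *)
rewrite big_ord_recl slice_delaminated /= measure0 add0e.
apply: (@le_trans _ _ (\sum_(k < n) (2 * S)%:E)%E).
  by apply: lee_sum => k _; exact: lebesgue_slice.
by rewrite sumEFin lee_fin sumr_const card_ord -[(2 * S) *+ _]mulr_natr.
Qed.

(** The lines are at distance [t] from each other, so the points of the cut within [t / 2] of [x]
    all lie on one line, which then contains [x]. *)
Lemma closure_delaminated x : closure delaminated x ->
  `|x.1| <= S /\ exists k : nat, [/\ (0 < k)%N, k%:R * t < h & x.2 = k%:R * t].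
Proof.
move=> cx.
have near e : 0 < e -> exists2 q, delaminated q & `|q.1 - x.1| < e /\ `|q.2 - x.2| < e.
  move=> e0; have [|q [Jq [q1 q2]]] := cx [set q | `|q.1 - x.1| < e /\ `|q.2 - x.2| < e].
    by apply/nbhs_planeP; exists e.
  by exists q.
split.
  rewrite leNgt; apply/negP => Sx; have [|q [qS _] [q1 _]] := near (`|x.1| - S); first lra.
  by have := ler_normD (x.1 - q.1) q.1; rewrite subrK distrC; lra.
have [|q [_ [k [k0 kh qk]]] [_ q2]] := near (t / 2); first by have := t0; lra.
exists k; split => //; apply: contrapT => /eqP; rewrite -subr_eq0 -normr_gt0 => xk.
have [|p [_ [l [l0 lh pl]]] [_ p2]] := near (Num.min (t / 2) `|x.2 - k%:R * t|).
  by rewrite lt_min xk andbT; have := t0; lra.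
move: p2; rewrite lt_min => /andP[p2 p3].
have [lk|lk] := eqVneq l k; first by move: p3; rewrite pl lk distrC ltxx.
have : t <= `|l%:R * t - k%:R * t|.
  rewrite -mulrBl normrM (gtr0_norm t0) -{1}[t]mul1r ler_wpM2r ?(ltW t0) //.
  exact: ler1_dist_nat.
have := ler_normD (p.2 - x.2) (x.2 - q.2); rewrite addrA subrK pl qk [`|x.2 - _|]distrC.
by move: p2 q2; rewrite pl qk; lra.
Qed.

(** Only the end points [(- S, k t)] and [(S, k t)] are added by the closure, a countable set. *)
Lemma hausdorff1_closure_delaminated : hausdorff1 (closure delaminated `\` delaminated) = 0%E.
Proof.
apply: hausdorff1_countable.
apply: (@sub_countable _ _ _ (\bigcup_k [set ((-S : R), k%:R * t); (S, k%:R * t)])).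
  apply: subset_card_le => x [/closure_delaminated [xS [k [k0 kh xk]]] nJ].
  exists k => //=.
  have : `|x.1| = S.
    apply/eqP; rewrite eq_le xS leNgt; apply/negP => xS'; apply: nJ; split => //; by exists k.
  have [x0|x0] := leP 0 x.1; [rewrite ger0_norm //|rewrite ltr0_norm //] => xE.
    by right; rewrite [x]surjective_pairing xk xE.
  by left; rewrite [x]surjective_pairing xk -xE opprK.
apply: bigcup_countable => // k _; apply: finite_set_countable; exact: finite_set2.
Qed.

Lemma test_fun_sub (O1 O2 : set (R * R)) phi : O1 `<=` O2 -> test_fun O1 phi -> test_fun O2 phi.
Proof.
by move=> O12 [Cphi [F [cF FO F0]]]; split => //; exists F; split => // x /FO /O12.
Qed.

(** Each jump term vanishes pointwise: outside of [O] because of [phi], inside of [O] because the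
    interface is glued there. *)
Lemma layered_distr_grad (O : set (R * R)) : O `<=` omega L h ->
  (forall x, O x -> ~ delaminated x) -> distr_grad_eq O layered_map layered_grad.
Proof.
move=> OO OJ phi tphi i j.
have [F [_ _ FO phi0 dphi0]] := test_fun_support tphi.
have zO x : ~ O x -> phi x = 0 /\ partial j phi x = 0.
  by move=> nO; split; [apply: phi0|apply: dphi0] => /FO.
pose O' : set (mplane R) := O.
rewrite /leb2 -(@integral_support _ _ _ _ O'); last first.
  by move=> x xO; rewrite (zO x xO).2 mulr0.
rewrite -(@integral_support _ _ _ _ O'); last by move=> x xO; rewrite (zO x xO).1 mulr0.
have := layered_map_parts (test_fun_sub OO tphi) i j; rewrite /leb2 => ->; congr (- _)%E.
rewrite [X in (_ + X)%E](_ : _ = 0%E) ?adde0 // /jump_term; case: ifP => // _.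
apply: big1 => k k0; apply: integral0_eq => s _.
have [Os|/zO [-> _]] := pselect (O (s, k%:R * t)); last by rewrite mulr0.
have [sS|/glued H] := ltP `|s| S.
  by case: (OJ _ Os); split => //; exists k; split => //; case: (OO _ Os) => _ /andP[].
by rewrite H ?mul0r //; case: (OO _ Os) => _ /andP[].
Qed.

Lemma layered_W1infty : W1infty (omega L h `\` closure delaminated) layered_map.
Proof.
have [C C0 HC] := layered_bounded.
have sub : omega L h `\` closure delaminated `<=` omega L h by move=> x [].
split; first by move=> i; apply: measurable_funTS; exact: measurable_layered_map.
split.
  exists (C + C); apply: aeW => x /sub Ox; apply: le_trans (enorm_le_sum _) _.
  have [? _] := HC x Ox 0 0; have [? _] := HC x Ox 1 0; exact: lerD.
exists layered_grad; split.
- by move=> i j; apply: measurable_funTS; exact: measurable_layered_grad.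
- exists (Num.sqrt (4 * C ^+ 2)); apply: aeW => x /sub Ox; rewrite /frob ler_wsqrtr //.
  rewrite !big_ord_recl !big_ord0 !addr0.
  have sq i j : layered_grad x i j ^+ 2 <= C ^+ 2.
    have [_ H] := HC x Ox i j.
    by rewrite -(real_normK (num_real (layered_grad x i j))) ler_sqr ?nnegrE.
  have := sq ord0 ord0; have := sq ord0 (lift ord0 ord0).
  have := sq (lift ord0 ord0) ord0; have := sq (lift ord0 ord0) (lift ord0 ord0); lra.
- apply: layered_distr_grad => // x [_ nx] Jx; apply: nx; exact: subset_closure.
Qed.

Lemma layered_SBV : SBV (omega L h) layered_map layered_grad.
Proof.
have [C C0 HC] := layered_bounded.
split.
- move=> i; apply: (@integrable_omega _ _ _ L0 h0 (fun x => crd (layered_map x) i) C).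
    exact: measurable_layered_map.
  by move=> x Ox; have [] := HC x Ox i 0.
- move=> i j; apply: (@integrable_omega _ _ _ L0 h0 (fun x => layered_grad x i j) C).
    exact: measurable_layered_grad.
  by move=> x Ox; have [] := HC x Ox i j.
- rewrite jump_set_layered; exists (fun n s => (s, n%:R * t)); split.
    by move=> n; exists 1 => s s'; rewrite enorm_hline mul1r.
  rewrite (_ : _ `\` _ = set0); first exact: hausdorff1_countable.
  apply/seteqP; split => // x [[_ [k [_ _ xk]]]]; apply; exists k => //.
  by exists x.1 => //; rewrite -xk -surjective_pairing.
pose low x := lmap (layer t x.2).-1 x.
(* A substitute for the jump density that is measurable on the whole plane; the two agree on the
   cut, where alone they are integrated. *)
pose g (phi : R * R -> R) i j (x : R * R) : R :=
  layer_jump i (layer t x.2) x.1 * crd (0, 1) j * phi x.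
have gE phi i j x : delaminated x ->
    crd (layered_map x - low x) i * crd (0, 1) j * phi x = g phi i j x.
  move=> [_ [k [k0 kh xk]]]; rewrite /g; congr (_ * _ * _).
  have kx : k%:R * t <= x.2 < k.+1%:R * t by rewrite xk lexx -natr1 mulrDl mul1r ltrDl.
  rewrite /low (layered_mapE kx) (layer_eq t0 kx) /layer_jump /plate_jump /lmap xk.
  have kk : k%:R = k.-1%:R + 1 :> R by rewrite natr1 prednK.
  by case: (ord2P i) => ->; rewrite /crd /= kk; ring.
have mjump i : measurable_fun [set: mplane R] (fun x : mplane R => layer_jump i (layer t x.2) x.1).
  apply: measurable_layer_fun => // k; apply: continuous_measurable_fun => s.
  rewrite /layer_jump /plate_jump; apply: cvgB; first exact: (dmid i k).1.
  apply: cvgD; first exact: (dmid i k.-1).1.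
  by apply: cvgM; [exact: cvg_cst|exact: (dnor i k.-1).1].
have mg phi i j : measurable_fun [set: mplane R] (phi : mplane R -> R) ->
    measurable_fun [set: mplane R] (g phi i j : mplane R -> R).
  move=> mphi; apply: measurable_funM => //; apply: measurable_funM; first exact: mjump.
  exact: measurable_cst.
have bjump i : exists2 C', 0 <= C' & forall x, omega L h x -> `|layer_jump i (layer t x.2) x.1| <= C'.
  apply: (@bounded_layer _ t L h M t0 hM (layer_jump i)) => k s.
  rewrite /layer_jump /plate_jump; apply: cvgB; first exact: (dmid i k).1.
  apply: cvgD; first exact: (dmid i k.-1).1.
  by apply: cvgM; [exact: cvg_cst|exact: (dnor i k.-1).1].
have crd01 j : `|crd ((0 : R), (1 : R)) j| <= 1.
  by case: (ord2P j) => ->; rewrite /crd /= ?normr0 ?normr1.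
have bg phi i j C' : 0 <= C' -> (forall x, `|phi x| <= C') ->
    exists C'', forall x, delaminated x -> `|g phi i j x| <= C''.
  move=> C'0 phiC; have [D D0 HD] := bjump i; exists (D * 1 * C') => x /delaminated_omega Ox.
  by rewrite /g !normrM; apply: ler_pM => //; apply: ler_pM => //; exact: HD.
have lsl k : (k < M)%N -> (lebesgue_measure (slice delaminated (k%:R * t)) < +oo)%E.
  by move=> _; apply: le_lt_trans (lebesgue_slice k) _; rewrite ltry.
exists layered_map, low, (fun=> (0, 1)); rewrite jump_set_layered; split.
- exact: layered_map_jump.
- move=> i j; have [D HD] := bg (fun=> 1) i j 1 ler01 (fun x => eq_ind_r (fun z => z <= 1) (lexx 1) (normr1 R)).
  have [H _] := integral_hausdorff1_hlines t0 measurable_delaminated delaminated_lines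
     (mg (fun=> 1) i j (measurable_cst _)) HD lsl.
  move: H => /integrableP[mf If]; apply/integrableP.
  have E x : delaminated x -> (g (fun=> 1) i j x)%:E = (crd (layered_map x - low x) i * crd (0, 1) j)%:E.
    by move=> Jx; rewrite -gE // mulr1.
  split; first by apply: eq_measurable_fun mf => x; rewrite inE => /E.
  apply: le_lt_trans If; rewrite le_eqVlt; apply/orP; left; apply/eqP.
  by apply: eq_integral_on => x Jx; rewrite -E.
move=> phi tphi i j.
have [C' C'0 HC'] := test_fun_bounded tphi.
have [D HD] := bg phi i j C' C'0 (fun x => (HC' x).1).
have mphi : measurable_fun [set: mplane R] (phi : mplane R -> R).
  by apply: measurable_continuous_plane; exact: test_fun_continuous tphi.
have [_ H] := integral_hausdorff1_hlines t0 measurable_delaminated delaminated_lines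
     (mg phi i j mphi) HD lsl.
rewrite (@eq_integral_on _ _ _ hausdorff1 _ _ (fun x : mplane R => (g phi i j x)%:E)); last first.
  by move=> x Jx; rewrite gE.
rewrite H.
have z x : ~ omega L h x -> phi x = 0 /\ forall j, partial j phi x = 0.
  exact: (test_fun_omega0 tphi).
rewrite integral_omegaT; last by move=> x /z[_ ->]; rewrite mulr0.
rewrite integral_omegaT; last by move=> x /z[-> _]; rewrite mulr0.
rewrite (layered_map_parts tphi); congr (- (_ + _))%E.
rewrite /jump_term; case: (ord2P j) => -> /=.
  rewrite big1 // => k _; apply: integral0_eq => s _.
  by rewrite /g /crd /= mulr0 mul0r.
rewrite big_mkcond; apply: eq_bigr => k _; case: ifPn => [k0|k0]; last first.
  by rewrite slice_delaminated (negbTE k0) integral_set0.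
have [kh|hk] := ltP (k%:R * t) h; last first.
  rewrite slice_delaminated ltNge hk andbF integral_set0; apply: integral0_eq => s _.
  by rewrite (z _ _).1 ?mulr0 // => -[_ /andP[_]]; rewrite ltNge hk.
rewrite (@integral_support _ _ _ _ (slice delaminated (k%:R * t) : set (measurableTypeR R))).
  apply: eq_integral => s; rewrite inE /g /crd /= => _.
  rewrite mulr1 (layer_eq t0 (_ : k%:R * t <= k%:R * t < k.+1%:R * t)) //.
  by rewrite lexx -natr1 mulrDl mul1r ltrDl.
move=> s; rewrite slice_delaminated k0 kh /= in_itv /= -ltr_norml => /negP; rewrite -leNgt => sS.
by rewrite glued ?mul0r.
Qed.

Lemma layered_SBV2 (N : nat) :
  (forall k, (0 < k)%N -> k%:R * t < h ->
     exists2 l : nat, (0 < l < N)%N & k%:R * t = l%:R * h / N%:R) ->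
  SBV2 L h N layered_map layered_grad.
Proof.
move=> lay; split; first exact: layered_SBV.
  have [C C0 HC] := layered_bounded.
  apply: (@le_lt_trans _ _ (\int[leb2]_(x in (omega L h : set (mplane R))) (4 * C ^+ 2)%:E)%E).
    apply: ge0_le_integral_nonmeasurable => [x _|x _|x Ox]; rewrite ?lee_fin ?sqr_ge0 //.
      by rewrite mulr_ge0 // sqr_ge0.
    split => //; rewrite /frob sqr_sqrtr; last first.
      by apply: sumr_ge0 => i _; apply: sumr_ge0 => j _; exact: sqr_ge0.
    rewrite !big_ord_recl !big_ord0 !addr0.
    have sq i j : layered_grad x i j ^+ 2 <= C ^+ 2.
      have [_ H] := HC x Ox i j.
      by rewrite -(real_normK (num_real (layered_grad x i j))) ler_sqr ?nnegrE.
    have := sq ord0 ord0; have := sq ord0 (lift ord0 ord0).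
    have := sq (lift ord0 ord0) ord0; have := sq (lift ord0 ord0) (lift ord0 ord0); lra.
  rewrite integral_cst; last exact: measurable_omega.
  change ((4 * C ^+ 2)%:E * leb2 (omega L h) < +oo)%E.
  by rewrite leb2_omega // -EFinM ltry.
rewrite jump_set_layered (_ : _ `\` _ = set0); first exact: hausdorff1_countable.
apply/seteqP; split => // x [Jx]; apply.
have [/= xL _] := delaminated_omega Jx; split => //.
have [_ [k [k0 kh xk]]] := Jx; have [l lN kl] := lay k k0 kh.
by exists l => //; rewrite xk.
Qed.

Lemma rotation_SO2 (a : R) : SO2 (rotation a).
Proof.
split; last first.
  rewrite (expand_det_row _ 0) !big_ord_recl big_ord0 addr0 /cofactor !det_mx11 !mxE /=.
  by have := cos2Dsin2 a; rewrite !expr2 /bump /= expr0 expr1; lra.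
apply/matrixP => i j; rewrite !mxE !big_ord_recl big_ord0 addr0 !mxE.
have := cos2Dsin2 a; rewrite !expr2 => cs.
by case: (ord2P i) => ->; case: (ord2P j) => -> /=; lra.
Qed.

Lemma dist_SO2_ge0 (A : 'M[R]_2) : 0 <= dist_SO2 A.
Proof.
apply: lb_le_inf; first by exists (frob (A - rotation 0)), (rotation 0) => //; exact: rotation_SO2.
by move=> _ [Q _ <-]; exact: sqrtr_ge0.
Qed.

(** The gradient differs from the rotation by [th] in its first column only, by the height inside
    the layer times the curvature times the tangent. *)
Lemma dist_SO2_layered x : omega L h x ->
  dist_SO2 (layered_grad x) <= t * `|ka (layer t x.2) x.1|.
Proof.
move=> Ox; have [_ /andP[r0 rt]] := layer_omega t0 hM Ox.
set k := layer t x.2; set r := x.2 - k%:R * t.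
apply: (@le_trans _ _ (frob (layered_grad x - rotation (th k x.1)))).
  apply: ge_inf; first by exists 0 => _ [Q _ <-]; exact: sqrtr_ge0.
  by exists (rotation (th k x.1)) => //; exact: rotation_SO2.
have -> : frob (layered_grad x - rotation (th k x.1)) = r * `|ka k x.1|.
  rewrite /frob !big_ord_recl !big_ord0 !addr0 !mxE /= /plate1 /plate2 -/k -/r.
  rewrite /tangent /dnormal /tangent /normal /=.
  rewrite [X in Num.sqrt X](_ : _ = (r * ka k x.1) ^+ 2 * (cos (th k x.1) ^+ 2 + sin (th k x.1) ^+ 2)).
    by rewrite cos2Dsin2 mulr1 sqrtr_sqr normrM ger0_norm.
  ring.
by rewrite ler_wpM2r.
Qed.

(** Where the curvature vanishes the gradient is a rotation and [W] vanishes, so only the box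
    [|x1| < S] contributes. *)
Lemma layered_energy (W : 'M[R]_2 -> R) (cW gamma : R) : 0 < gamma -> 0 <= cW ->
  (forall xi, 0 <= W xi <= cW * dist_SO2 xi ^+ 2) ->
  forall n, h <= n.+1%:R * t ->
  (energy W gamma L h layered_map layered_grad <=
   (cW * (t * K) ^+ 2 * (2 * S * h) + gamma * (2 * S * n%:R))%:E)%E.
Proof.
move=> g0 cW0 HW n hn; rewrite /energy jump_set_layered EFinD; apply: leeD; last first.
  by rewrite EFinM; apply: lee_wpmul2l; [rewrite lee_fin ltW|exact: hausdorff1_delaminated].
pose Bx : set (mplane R) := `]-S, S[%classic `*` `]0, h[%classic.
have BO : Bx `<=` omega L h.
  move=> x; rewrite /Bx /= !in_itv /= => -[/andP[x1 x2] ?]; split => //.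
  by apply/andP; split; have := SL; lra.
have mB : measurable Bx by apply: measurableX; exact: measurable_itv.
rewrite /leb2 (integral_subset_support _ BO); last first.
  move=> x Ox nB; congr (_%:E); apply/eqP; rewrite eq_le (andP (HW _)).1 andbT.
  apply: le_trans (andP (HW _)).2 _; rewrite (_ : dist_SO2 _ = 0) ?expr0n ?mulr0 //.
  apply/eqP; rewrite eq_le dist_SO2_ge0 andbT; apply: le_trans (dist_SO2_layered Ox) _.
  rewrite ka0 ?normr0 ?mulr0 // leNgt; apply/negP => xS; apply: nB.
  by case: Ox => _ ?; rewrite /Bx /= !in_itv /= -ltr_norml.
apply: (@le_trans _ _ (\int[leb2]_(x in Bx) (cW * (t * K) ^+ 2)%:E)%E).
  apply: ge0_le_integral_nonmeasurable => [x _|x _|x Bxx]; rewrite ?lee_fin.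
  - by case/andP: (HW (layered_grad x)).
  - by rewrite mulr_ge0 // sqr_ge0.
  split => //; apply: le_trans (andP (HW _)).2 _; rewrite ler_wpM2l //.
  rewrite ler_sqr ?nnegrE ?dist_SO2_ge0 ?mulr_ge0 ?(ltW t0) //.
  apply: le_trans (dist_SO2_layered (BO _ Bxx)) _; rewrite ler_wpM2l ?(ltW t0) //.
rewrite integral_cst //; change ((cW * (t * K) ^+ 2)%:E * leb2 Bx <= (cW * (t * K) ^+ 2 * (2 * S * h))%:E)%E.
rewrite leb2_box; [|have := S0; lra|exact: ltW].
by rewrite -EFinM lee_fin; rewrite (_ : (S - - S) * (h - 0) = 2 * S * h) //; ring.
Qed.

Lemma layered_grad_rotation (O : set (R * R)) (a : R) :
  O `<=` omega L h -> (forall x, O x -> S <= `|x.1|) ->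
  (forall k x, O x -> th k x.1 = a) ->
  distr_grad_eq O layered_map (fun=> rotation a).
Proof.
move=> OO OS Oa phi tphi i j.
have OJ x : O x -> ~ delaminated x.
  by move=> Ox [xS _]; have := OS _ Ox; rewrite leNgt xS.
rewrite (layered_distr_grad OO OJ tphi); congr (- _)%E; apply: eq_integral => x; rewrite inE => Ox.
congr ((_ * _)%:E); rewrite !mxE /plate1 /plate2 /dnormal /tangent /normal ka0 ?OS //.
rewrite (Oa _ _ Ox) mul0r oppr0 mulr0 addr0.
by case: (ord2P i) => ->; case: (ord2P j) => ->.
Qed.

End LayeredMap.

(** * Profile of a bent layer *)

Section Truncation.
Context {R : realType}.

Lemma piecewise_deriv_min (c : R) :
  piecewise_deriv (fun s => Num.min s c) (fun s => (s <= c)%R%:R).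
Proof.
split; first by move=> s; apply: continuous_min => //; exact: cvg_cst.
exists [:: c] => s; rewrite inE => sc; have [sltc|] := ltP s c; last rewrite le_eqVlt eq_sym (negbTE sc) /= => cs.
- have near_lt : \forall y \near s, y < c by apply: open_nbhs_nbhs; split => //; exact: open_lt.
  have E y : y < c -> (y <= c)%R%:R = 1 :> R by move=> /ltW ->.
  split.
    rewrite E //; apply: (near_eq_is_derive _ (is_derive_id s (1 : R))).
    by near=> y; rewrite min_l // ltW //; near: y.
  suff : (fun s => (s <= c)%R%:R : R) @ s --> ((s <= c)%R%:R : R) by [].
  apply: cvg_near_cst; near=> y; rewrite !E //; near: y; exact: near_lt.
- have near_gt : \forall y \near s, c < y by apply: open_nbhs_nbhs; split => //; exact: open_gt.
  have E y : c < y -> (y <= c)%R%:R = 0 :> R by rewrite leNgt => ->.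
  split.
    rewrite E //; apply: (near_eq_is_derive _ (is_derive_cst c s (1 : R))).
    by near=> y; rewrite min_r // ltW //; near: y.
  suff : (fun s => (s <= c)%R%:R : R) @ s --> ((s <= c)%R%:R : R) by [].
  apply: cvg_near_cst; near=> y; rewrite !E //; near: y; exact: near_gt.
Unshelve. all: by end_near. Qed.

End Truncation.

Section Profile.
Context {R : realType}.
(* [r0] radius of the first arc, [p] length of the ramp, [m] half of the width *)
Variables (al b S rho r0 p m : R).
Hypotheses (b0 : 0 < b) (alb0 : 0 < al + b) (rho0 : 0 < rho) (r00 : 0 < r0) (p0 : 0 <= p).

Definition arc1_end : R := r0 * (al + b).
Definition ramp_end : R := arc1_end + p.
Definition arc2_end : R := ramp_end + rho * b.

Hypothesis flat0 : arc2_end < S.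

(** For [u <= v], the length of the part of [[u, v]] to the left of [s]. Being a combination of
    truncations, it gets its derivative from that of [Num.min]. *)
Definition seg (u v s : R) : R := Num.min s v + -1 * Num.min s u.
Definition dseg (u v s : R) : R := (s <= v)%R%:R + -1 * (s <= u)%R%:R.

Lemma piecewise_deriv_seg u v : piecewise_deriv (seg u v) (dseg u v).
Proof.
exact: (piecewise_derivD (piecewise_deriv_min v) (piecewise_derivZ (-1) (piecewise_deriv_min u))).
Qed.

Lemma segE u v s : u <= v ->
  seg u v s = if s <= u then 0 else if s <= v then s - u else v - u.
Proof.
move=> uv; rewrite /seg; case: (leP s u) => su; first by rewrite min_l ?(le_trans su) //; ring.
by case: (leP s v) => sv; ring.
Qed.

Lemma dsegE u v s : u <= v -> dseg u v s = (u < s <= v)%R%:R.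
Proof.
move=> uv; rewrite /dseg; case: (leP s u) => su /=; first by rewrite (le_trans su) //=; ring.
by rewrite mulr0 addr0.
Qed.

(** The angle as turned by the first arc alone; [psi] is the angle on the second arc, starting from
    [- b]. With separate angles each summand of the curve varies in one zone only. *)
Definition theta1 s : R := al + - r0^-1 * seg 0 arc1_end s.
Definition psi s : R := - b + rho^-1 * seg ramp_end arc2_end s.
Definition theta s : R := theta1 s + rho^-1 * seg ramp_end arc2_end s.
Definition dtheta s : R := - r0^-1 * dseg 0 arc1_end s + rho^-1 * dseg ramp_end arc2_end s.
(** The centre of the first arc is [(- m, 0)]. All summands are constant beyond [S], where the curve
    comes to rest; this prepares the reflection at the axis. *)
Definition profX s : R :=
  - m + (- r0 * sin (theta1 s) + (cos al * Num.min s 0 + (cos b * seg arc1_end ramp_end s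
  + (rho * sin (psi s) + (rho * sin b + seg arc2_end S s))))).
Definition profZ s : R :=
  r0 * cos (theta1 s) + (sin al * Num.min s 0 + (- sin b * seg arc1_end ramp_end s
  + (rho * cos b + - rho * cos (psi s)))).

Lemma piecewise_deriv_theta : piecewise_deriv theta dtheta.
Proof.
have := piecewise_derivD (piecewise_derivD (piecewise_deriv_cst al)
  (piecewise_derivZ (- r0^-1) (piecewise_deriv_seg 0 arc1_end)))
  (piecewise_derivZ rho^-1 (piecewise_deriv_seg ramp_end arc2_end)).
by move=> H; apply: (piecewise_deriv_eq (E := [::]) H) => s _; rewrite add0r.
Qed.

Let pos1 : 0 < arc1_end. Proof. by rewrite mulr_gt0. Qed.
Let pos2 : arc1_end <= ramp_end. Proof. by rewrite lerDl. Qed.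
Let pos3 : ramp_end < arc2_end. Proof. by rewrite ltrDl mulr_gt0. Qed.

(* straight part, first arc, ramp, second arc, flat part, and beyond the axis *)
Variant zone_spec s : R -> R -> R -> R -> R -> R -> R -> R -> R -> R -> Type :=
| ZoneA of s <= 0 : zone_spec s s 0 0 0 0 1 0 0 0 0
| ZoneB of 0 < s & s <= arc1_end : zone_spec s 0 s 0 0 0 0 1 0 0 0
| ZoneR of arc1_end < s & s <= ramp_end : zone_spec s 0 arc1_end (s - arc1_end) 0 0 0 0 1 0 0
| ZoneD of ramp_end < s & s <= arc2_end : zone_spec s 0 arc1_end p (s - ramp_end) 0 0 0 0 1 0
| ZoneF of arc2_end < s & s <= S : zone_spec s 0 arc1_end p (rho * b) (s - arc2_end) 0 0 0 0 1
| ZoneE of S < s : zone_spec s 0 arc1_end p (rho * b) (S - arc2_end) 0 0 0 0 0.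

Lemma zoneP s : zone_spec s (Num.min s 0) (seg 0 arc1_end s) (seg arc1_end ramp_end s)
  (seg ramp_end arc2_end s) (seg arc2_end S s)
  (s <= 0)%R%:R (dseg 0 arc1_end s) (dseg arc1_end ramp_end s)
  (dseg ramp_end arc2_end s) (dseg arc2_end S s).
Proof.
have q1 := pos1; have q2 := pos2; have q3 := pos3.
have e1 : arc1_end = r0 * (al + b) by [].
have e2 : ramp_end = arc1_end + p by [].
have e3 : arc2_end = ramp_end + rho * b by [].
have fl := flat0.
have min0 : Num.min s 0 = if s <= 0 then s else 0 by case: leP.
rewrite min0 !segE ?dsegE ?(ltW q1) ?(ltW q3) ?(ltW fl) // !ltNge.
have [s0|s0] := leP s 0.
  have [h1 h2 h3 h4] : [/\ s <= arc1_end, s <= ramp_end, s <= arc2_end & s <= S] by split; lra.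
  by rewrite h1 h2 h3 h4 /=; constructor.
have [s1|s1] := leP s arc1_end.
  have [h2 h3 h4] : [/\ s <= ramp_end, s <= arc2_end & s <= S] by split; lra.
  by rewrite h2 h3 h4 /= subr0; constructor.
have [s2|s2] := leP s ramp_end.
  have [h3 h4] : [/\ s <= arc2_end & s <= S] by split; lra.
  by rewrite h3 h4 /= subr0; constructor.
have rp : ramp_end - arc1_end = p by rewrite e2; ring.
have ra : arc2_end - ramp_end = rho * b by rewrite e3; ring.
have [s3|s3] := leP s arc2_end.
  have h4 : s <= S by lra.
  by rewrite h4 /= subr0 rp; constructor.
by have [s4|s4] := leP s S; rewrite /= subr0 rp ra; constructor.
Qed.

Lemma piecewise_deriv_profX : piecewise_deriv profX (fun s => if s <= S then cos (theta s) else 0).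
Proof.
have cs : continuous (@cos R) by exact: continuous_cos.
have dsin (z : R) : is_derive z 1 (@sin R) (cos z) by exact: is_derive_sin.
have dpsi := piecewise_derivD (piecewise_deriv_cst (- b))
   (piecewise_derivZ rho^-1 (piecewise_deriv_seg ramp_end arc2_end)).
have dth1 := piecewise_derivD (piecewise_deriv_cst al)
  (piecewise_derivZ (- r0^-1) (piecewise_deriv_seg 0 arc1_end)).
have := piecewise_derivD (piecewise_deriv_cst (- m)) (piecewise_derivD
  (piecewise_derivZ (- r0) (piecewise_deriv_comp dsin cs dth1)) (piecewise_derivD
  (piecewise_derivZ (cos al) (piecewise_deriv_min 0)) (piecewise_derivD
  (piecewise_derivZ (cos b) (piecewise_deriv_seg arc1_end ramp_end)) (piecewise_derivD
  (piecewise_derivZ rho (piecewise_deriv_comp dsin cs dpsi)) (piecewise_derivD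
  (piecewise_deriv_cst (rho * sin b)) (piecewise_deriv_seg arc2_end S)))))).
move=> H; apply: (piecewise_deriv_eq (E := [::]) H) => s _; rewrite /theta /theta1.
have r0n : r0 != 0 by rewrite gt_eqF.
have rhon : rho != 0 by rewrite gt_eqF.
have th1 : al + - r0^-1 * arc1_end = - b by rewrite /arc1_end; field.
have ps0 : - b + rho^-1 * (rho * b) = 0 by field.
have q1 := pos1; have q2 := pos2; have q3 := pos3; have fl := flat0.
case: (zoneP s) => [s1|s1 s2|s1 s2|s1 s2|s1 s2|s1]; last first.
- by rewrite [s <= S]leNgt s1 /=; ring.
- by rewrite s2 th1 ps0 cos0; ring.
- by rewrite ifT ?th1; [field; rewrite ?rhon ?r0n|lra].
- by rewrite ifT ?th1 ?mulr0 ?addr0 ?cosN; [ring|lra].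
- by rewrite ifT ?mulr0 ?addr0; [field; rewrite ?rhon ?r0n|lra].
- by rewrite ifT ?mulr0 ?addr0; [ring|lra].
Qed.

Lemma piecewise_deriv_profZ : piecewise_deriv profZ (fun s => if s <= S then sin (theta s) else 0).
Proof.
have cs : continuous (fun z : R => - sin z) by move=> z; apply: cvgN; exact: continuous_sin.
have dcos (z : R) : is_derive z 1 (@cos R) (- sin z) by exact: is_derive_cos.
have dpsi := piecewise_derivD (piecewise_deriv_cst (- b))
   (piecewise_derivZ rho^-1 (piecewise_deriv_seg ramp_end arc2_end)).
have dth1 := piecewise_derivD (piecewise_deriv_cst al)
  (piecewise_derivZ (- r0^-1) (piecewise_deriv_seg 0 arc1_end)).
have := piecewise_derivD
  (piecewise_derivZ r0 (piecewise_deriv_comp dcos cs dth1)) (piecewise_derivD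
  (piecewise_derivZ (sin al) (piecewise_deriv_min 0)) (piecewise_derivD
  (piecewise_derivZ (- sin b) (piecewise_deriv_seg arc1_end ramp_end)) (piecewise_derivD
  (piecewise_deriv_cst (rho * cos b)) (piecewise_derivZ (- rho) (piecewise_deriv_comp dcos cs dpsi))))).
move=> H; apply: (piecewise_deriv_eq (E := [::]) H) => s _; rewrite /theta /theta1.
have r0n : r0 != 0 by rewrite gt_eqF.
have rhon : rho != 0 by rewrite gt_eqF.
have th1 : al + - r0^-1 * arc1_end = - b by rewrite /arc1_end; field.
have ps0 : - b + rho^-1 * (rho * b) = 0 by field.
have q1 := pos1; have q2 := pos2; have q3 := pos3; have fl := flat0.
case: (zoneP s) => [s1|s1 s2|s1 s2|s1 s2|s1 s2|s1]; last first.
- by rewrite [s <= S]leNgt s1 /=; ring.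
- by rewrite s2 th1 ps0 sin0; ring.
- by rewrite ifT ?th1; [field; rewrite ?rhon ?r0n|lra].
- by rewrite ifT ?th1 ?mulr0 ?addr0 ?sinN; [ring|lra].
- by rewrite ifT ?mulr0 ?addr0; [field; rewrite ?rhon ?r0n|lra].
- by rewrite ifT ?mulr0 ?addr0; [ring|lra].
Qed.

End Profile.

(** * Injectivity *)

Section Bend.
Context {R : realType}.
Variables (b rho : R).
Hypotheses (b0 : 0 < b) (b2 : b < pi / 2) (rho0 : 0 < rho).

(** In the frame of the ramp, [v] is the arclength counted from its lower end, [bend v] the angle
    turned since and [over v] the length run on the flat part. [(bendA, bendB)] is a unit-speed
    curve: the half-line of the ramp, an arc of radius [rho], a half-line at angle [b]. *)
Definition bend (v : R) : R := if v <= 0 then 0 else if v <= rho * b then v / rho else b.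
Definition over (v : R) : R := if v <= rho * b then 0 else v - rho * b.
Definition bendA (v : R) : R := Num.min v 0 + rho * sin (bend v) + cos b * over v.
Definition bendB (v : R) : R := rho * (1 - cos (bend v)) + sin b * over v.

Lemma rhob_gt0 : 0 < rho * b. Proof. exact: mulr_gt0. Qed.

Variant bend_spec v : R -> R -> R -> Type :=
| BendRamp of v <= 0 : bend_spec v 0 0 v
| BendArc of 0 < v & v <= rho * b & v = rho * (v / rho) & 0 < v / rho & v / rho <= b :
    bend_spec v (v / rho) 0 0
| BendFlat of rho * b < v & 0 < v : bend_spec v b (v - rho * b) 0.

Lemma bendP v : bend_spec v (bend v) (over v) (Num.min v 0).
Proof.
have rb := rhob_gt0; rewrite /bend /over; case: (leP v 0) => v0.
  by rewrite ifT ?(le_trans v0) ?ltW //; constructor.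
case: (leP v (rho * b)) => vb; constructor => //.
- by field; rewrite gt_eqF.
- by rewrite divr_gt0.
- by rewrite ler_pdivrMr // mulrC.
Qed.

Lemma bend_itv v : 0 <= bend v <= b.
Proof. by have := b0; case: (bendP v) => *; apply/andP; split; lra. Qed.

Lemma sin_bend_ge0 v : 0 <= sin (bend v).
Proof.
have /andP[v0 vb] := bend_itv v; apply: sin_ge0_pi; rewrite v0 /=.
by have := b2; have := pi_gt0 R; lra.
Qed.

Lemma sin_le (x y : R) : - (pi / 2) <= x -> x <= y -> y <= pi / 2 -> sin x <= sin y.
Proof.
move=> x1 xy y1; rewrite le_eqVlt in xy; case/predU1P: xy => [-> //|xy].
by apply/ltW; rewrite ltr_sin // in_itv /=; apply/andP; split; lra.
Qed.

Lemma sin_bend_le v : sin (bend v) <= sin b.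
Proof.
have /andP[v0 vb] := bend_itv v; have := b2; have := pi_gt0 R => ? ?.
by apply: sin_le => //; lra.
Qed.

Lemma cos_bend_gt0 v : 0 < cos (bend v).
Proof.
have /andP[v0 vb] := bend_itv v; have := b2; have := pi_gt0 R => ? ?.
by apply: cos_gt0_pihalf; apply/andP; split; lra.
Qed.

Lemma cosb_gt0 : 0 < cos b.
Proof. by have := b2; have := b0; have := pi_gt0 R => ? ? ?; apply: cos_gt0_pihalf; apply/andP; split; lra. Qed.

Lemma sinb_gt0 : 0 < sin b.
Proof. by have := b2; have := b0; have := pi_gt0 R => ? ? ?; apply: sin_gt0_pi; apply/andP; split; lra. Qed.

Lemma bendA_lt v v' : v < v' -> bendA v < bendA v'.
Proof.
have cb := cosb_gt0; have := b2; have := b0; have := pi_gt0 R => p0 b0' b2' vv'.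
have S1 := sin_bend_ge0 v'; have rb := rhob_gt0.
have mono x y : 0 <= x -> x < y -> y <= b -> rho * sin x < rho * sin y.
  by move=> x0 xy yb; rewrite ltr_pM2l // ltr_sin // in_itv /=; apply/andP; split; lra.
rewrite /bendA; case: (bendP v) => [h1|h1 h2 h3 h4 h5|h1 h2].
- rewrite sin0 mulr0 mulr0 !addr0; move: S1; case: (bendP v') => [k1|k1 k2 k3 k4 k5|k1 k2] S1.
  + by rewrite sin0; lra.
  + have := mono 0 (v' / rho) (lexx _) k4 k5; rewrite sin0; lra.
  + have := mono 0 b (lexx _) b0' (lexx _); rewrite sin0.
    have : 0 < cos b * (v' - rho * b) by rewrite mulr_gt0 // subr_gt0.
    lra.
- case: (bendP v') => [k1|k1 k2 k3 k4 k5|k1 k2]; first lra.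
    have : v / rho < v' / rho by rewrite ltr_pM2r // invr_gt0.
    by move=> /(fun H => mono _ _ (ltW h4) H k5); lra.
  have : 0 < cos b * (v' - rho * b) by rewrite mulr_gt0 // subr_gt0.
  have : rho * sin (v / rho) <= rho * sin b.
    by rewrite ler_pM2l //; apply: sin_le; lra.
  lra.
- case: (bendP v') => [k1|k1 k2 k3 k4 k5|k1 k2]; [lra|lra|].
  by rewrite ltrD2l ltr_pM2l // ltrD2r.
Qed.

Lemma bendA_le v v' : v <= v' -> bendA v <= bendA v'.
Proof. by rewrite le_eqVlt => /predU1P[-> //|/bendA_lt/ltW]. Qed.

(** The derivative [sin (bend v)] vanishes along the ramp, so strict growth requires [0 < v']. *)
Lemma bendB_lt v v' : 0 < v' -> v < v' -> bendB v < bendB v'.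
Proof.
have sb := sinb_gt0; have := b2; have := b0; have := pi_gt0 R => p0 b0' b2' v'0 vv'.
have rb := rhob_gt0.
have mono x y : 0 <= x -> x < y -> y <= b -> rho * (1 - cos x) < rho * (1 - cos y).
  by move=> x0 xy yb; rewrite ltr_pM2l // ltrD2l ltrN2 ltr_cos // in_itv /=; apply/andP; split; lra.
rewrite /bendB; case: (bendP v) => [h1|h1 h2 h3 h4 h5|h1 h2].
- rewrite cos0 subrr !mulr0 addr0; case: (bendP v') => [k1|k1 k2 k3 k4 k5|k1 k2]; first lra.
  + have := mono 0 (v' / rho) (lexx _) k4 k5; rewrite cos0; lra.
  + have := mono 0 b (lexx _) b0' (lexx _); rewrite cos0.
    have : 0 < sin b * (v' - rho * b) by rewrite mulr_gt0 // subr_gt0.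
    lra.
- case: (bendP v') => [k1|k1 k2 k3 k4 k5|k1 k2]; first lra.
    have : v / rho < v' / rho by rewrite ltr_pM2r // invr_gt0.
    by move=> /(fun H => mono _ _ (ltW h4) H k5); lra.
  have : 0 < sin b * (v' - rho * b) by rewrite mulr_gt0 // subr_gt0.
  have : rho * (1 - cos (v / rho)) <= rho * (1 - cos b).
    by move: h5; rewrite le_eqVlt => /predU1P[-> //|/(fun H => mono _ _ (ltW h4) H (lexx b)) /ltW].
  lra.
- case: (bendP v') => [k1|k1 k2 k3 k4 k5|k1 k2]; [lra|lra|].
  by rewrite ltrD2l ltr_pM2l // ltrD2r.
Qed.

Lemma bendB_le v v' : v <= v' -> bendB v <= bendB v'.
Proof.
rewrite le_eqVlt => /predU1P[-> //|vv']; have [v'0|v'0] := ltP 0 v'; first exact/ltW/bendB_lt.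
have E w : w <= 0 -> bendB w = 0.
  by move=> w0; rewrite /bendB; case: bendP => [_|*|*]; [rewrite cos0; ring|lra|have := rhob_gt0; lra].
by rewrite !E //; lra.
Qed.

(* Layers with the common shape [(bendA, bendB)], translated by [(p, y)], do
   not cross when the upper one, which starts at [y' >= y + t], is shorter by
   at least [t * sin b]. *)
Lemma bend_disjoint (t p p' y y' v v' r r' : R) :
  y + t <= y' -> t * sin b <= p - p' -> 0 <= r < t -> 0 <= r' ->
  p + bendA v - r * sin (bend v) = p' + bendA v' - r' * sin (bend v') ->
  y + bendB v + r * cos (bend v) = y' + bendB v' + r' * cos (bend v') -> False.
Proof.
move=> yy pp /andP[r0 rt] r'0 EA EB.
have c1 := cos_bend_gt0 v; have c2 := cos_bend_gt0 v'.
have s1 := sin_bend_ge0 v; have s2 := sin_bend_ge0 v'.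
have rc : r * cos (bend v) <= r by rewrite ler_piMr // cos_le1.
have rc' : 0 <= r' * cos (bend v') by rewrite mulr_ge0 // ltW.
have vv : v' < v.
  by rewrite ltNge; apply/negP => /bendB_le; lra.
have rs : r * sin (bend v) <= t * sin b.
  by apply: ler_pM => //; [exact: ltW|exact: sin_bend_le].
have rs' : 0 <= r' * sin (bend v') by rewrite mulr_ge0.
by have := bendA_lt vv; lra.
Qed.

(** Consecutive layers may slide along each other on the ramps, and contact is possible only there:
    comparing first coordinates gives [v < v'], and then the second coordinates force [v' <= 0]. The
    conclusion says that the contact point is equally far from the beginning of both ramps. *)
Lemma bend_touch (t p p' y v v' : R) : 0 <= t ->
  t * sin b < p - p' ->
  p + bendA v - t * sin (bend v) = p' + bendA v' ->
  y + bendB v + t * cos (bend v) = y + t + bendB v' -> p + v = p' + v'.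
Proof.
move=> t0 pp EA EB.
have rc : t * cos (bend v) <= t by rewrite ler_piMr // cos_le1.
have rs : t * sin (bend v) <= t * sin b by rewrite ler_wpM2l // sin_bend_le.
have vv : v < v'.
  by rewrite ltNge; apply/negP => /bendA_le; lra.
have v'0 : v' <= 0.
  by rewrite leNgt; apply/negP => v'0; have := bendB_lt v'0 vv; lra.
have E w : w <= 0 -> bendA w = w /\ bend w = 0.
  move=> w0; rewrite /bendA; case: bendP => [_|*|*]; last 2 first.
  - lra.
  - by have := rhob_gt0; lra.
  by rewrite sin0; split => //; ring.
have [Ev' _] := E v' v'0; have [Ev b3] := E v ltac:(lra).
by move: EA; rewrite Ev Ev' b3 sin0; lra.
Qed.

(** [(q1, q2)] are coordinates about the centre of the second arc. Ramp, arc and flat part are told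
    apart by the signs of [q1] and of [q1 cos b + q2 sin b]. On the arc polar coordinates recover
    [v] and [r], as heights below [rho] do not reach the centre. *)
Lemma bend_layer_inj (v v' r r' : R) : 0 <= r < rho -> 0 <= r' < rho ->
  bendA v - r * sin (bend v) = bendA v' - r' * sin (bend v') ->
  bendB v + r * cos (bend v) = bendB v' + r' * cos (bend v') -> v = v' /\ r = r'.
Proof.
move=> /andP[r0 rr] /andP[r'0 rr'] EA EB.
have cs := cos2Dsin2 b; have cb := cosb_gt0; have sb := sinb_gt0.
have b2' := b2; have b0' := b0; have rb := rhob_gt0; have pi0 := pi_gt0 R.
pose q1 u z := bendA u - z * sin (bend u).
pose q2 u z := bendB u + z * cos (bend u) - rho.
have E1 : q1 v r = q1 v' r' by [].
have E2 : q2 v r = q2 v' r' by rewrite /q2 EB.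
have ramp u z : u <= 0 -> 0 <= z < rho ->
    [/\ q1 u z = u, q2 u z = z - rho & q1 u z * cos b + q2 u z * sin b < 0].
  move=> u0 /andP[_ zr]; have [-> ->] : q1 u z = u /\ q2 u z = z - rho.
    rewrite /q1 /q2 /bendA /bendB; case: bendP => [_|*|*]; [|lra|lra].
    by rewrite sin0 cos0; split; ring.
  split => //; have : u * cos b <= 0 by rewrite mulr_le0_ge0 // ltW.
  have : (z - rho) * sin b < 0 by rewrite nmulr_rlt0 // subr_lt0.
  lra.
have arc u z : 0 < u -> u <= rho * b -> 0 <= z < rho ->
    [/\ q1 u z = (rho - z) * sin (u / rho), q2 u z = - ((rho - z) * cos (u / rho)),
        q1 u z * cos b + q2 u z * sin b <= 0, 0 < q1 u z & 0 < u / rho <= b].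
  move=> u0 ub /andP[_ zr].
  have [-> -> ub'] : [/\ q1 u z = (rho - z) * sin (u / rho), q2 u z = - ((rho - z) * cos (u / rho)) & 0 < u / rho <= b].
    rewrite /q1 /q2 /bendA /bendB; case: bendP => [|? ? ? -> ->|?]; [lra| |lra].
    by split => //; ring.
  have /andP[? ?] := ub'.
  have zr' : 0 < rho - z by lra.
  split => //; last by rewrite mulr_gt0 // sin_gt0_pi //; apply/andP; split; lra.
  rewrite (_ : _ + _ = - ((rho - z) * sin (b - u / rho))); last by rewrite sinB; ring.
  by rewrite oppr_le0 mulr_ge0 ?(ltW zr') // sin_ge0_pi //; apply/andP; split; lra.
have flat u z : rho * b < u -> 0 <= z < rho ->
    [/\ q1 u z = (rho - z) * sin b + (u - rho * b) * cos b,
        q2 u z = - ((rho - z) * cos b) + (u - rho * b) * sin b &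
        q1 u z * cos b + q2 u z * sin b = u - rho * b].
  move=> ub /andP[_ zr].
  have [-> ->] : q1 u z = (rho - z) * sin b + (u - rho * b) * cos b /\
      q2 u z = - ((rho - z) * cos b) + (u - rho * b) * sin b.
    rewrite /q1 /q2 /bendA /bendB; case: bendP => [?|? ? *|?]; [lra|lra|].
    by split; ring.
  split => //; transitivity ((u - rho * b) * (cos b ^+ 2 + sin b ^+ 2)); [ring|by rewrite cs mulr1].
have r'r : 0 <= r' < rho by rewrite r'0. have rrr : 0 <= r < rho by rewrite r0.
have [v0|v0] := leP v 0; [|have [vb|vb] := leP v (rho * b)].
- have [e1 e2 e3] := ramp v r v0 rrr.
  have [w0|w0] := leP v' 0; [|have [wb|wb] := leP v' (rho * b)].
  + by have [f1 f2 f3] := ramp v' r' w0 r'r; split; lra.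
  + by have [f1 f2 f3 f4 f5] := arc v' r' w0 wb r'r; lra.
  + by have [f1 f2 f3] := flat v' r' wb r'r; rewrite -E1 -E2 in f3; lra.
- have [e1 e2 e3 e4 /andP[e5 e6]] := arc v r v0 vb rrr.
  have [w0|w0] := leP v' 0; [|have [wb|wb] := leP v' (rho * b)].
  + by have [f1 f2 f3] := ramp v' r' w0 r'r; lra.
  + have [f1 f2 f3 f4 /andP[f5 f6]] := arc v' r' w0 wb r'r.
    have sq : (rho - r) ^+ 2 = (rho - r') ^+ 2.
      have c1 := cos2Dsin2 (v / rho); have c2 := cos2Dsin2 (v' / rho).
      transitivity (q1 v r ^+ 2 + q2 v r ^+ 2).
        by rewrite e1 e2 -[LHS]mulr1 -c1; ring.
      by rewrite E1 E2 f1 f2 -[RHS]mulr1 -c2; ring.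
    have rE : r = r'.
      by move/eqP: sq; rewrite eqrXn2 ?subr_ge0 ?ltW // => /eqP; lra.
    split => //; have rn : rho - r' != 0 by rewrite gt_eqF // subr_gt0.
    have : sin (v / rho) = sin (v' / rho) by apply: (mulfI rn); rewrite -f1 -E1 e1 rE.
    move/sin_inj => H; have : v / rho = v' / rho by apply: H; rewrite in_itv /=; apply/andP; split; lra.
    by move/(mulIf _); apply; rewrite invr_eq0 gt_eqF.
  + by have [f1 f2 f3] := flat v' r' wb r'r; rewrite -E1 -E2 in f3; lra.
- have [e1 e2 e3] := flat v r vb rrr.
  have [w0|w0] := leP v' 0; [|have [wb|wb] := leP v' (rho * b)].
  + by have [f1 f2 f3] := ramp v' r' w0 r'r; rewrite -E1 -E2 in f3; lra.
  + by have [f1 f2 f3 f4 f5] := arc v' r' w0 wb r'r; rewrite -E1 -E2 in f3; lra.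
  + have [f1 f2 f3] := flat v' r' wb r'r.
    rewrite E1 E2 f3 in e3; split; first lra.
    have g u z : q1 u z = (rho - z) * sin b + (u - rho * b) * cos b ->
        q2 u z = - ((rho - z) * cos b) + (u - rho * b) * sin b ->
        q1 u z * sin b - q2 u z * cos b = rho - z.
      by move=> -> ->; rewrite -[RHS]mulr1 -cs; ring.
    have := g _ _ e1 e2; have := g _ _ f1 f2; rewrite E1 E2; lra.
Qed.

End Bend.

(** * A bent layer seen from the centre of its first arc *)

Section ProfileFrame.
Context {R : realType}.
Variables (al b S rho r0 p m : R).
Hypotheses (al0 : 0 < al) (al2 : al <= pi / 2) (b0 : 0 < b) (b2 : b < pi / 2) (albpi : al + b < pi).
Hypotheses (rho0 : 0 < rho) (r00 : 0 < r0) (p0 : 0 <= p).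

Local Notation arc1_end := (arc1_end al b r0).
Local Notation ramp_end := (ramp_end al b r0 p).
Local Notation arc2_end := (arc2_end al b rho r0 p).

Hypothesis flat0 : arc2_end < S.
(** The value of [m] for which the curve ends on the axis. *)
Hypothesis closed_up : m = r0 * sin b + p * cos b + rho * sin b + (S - arc2_end).

(* image of the point at height [r] of the cross-section at arclength [s] *)
Definition fibreX s r : R := profX al b S rho r0 p m s - r * sin (theta al b rho r0 p s).
Definition fibreZ s r : R := profZ al b rho r0 p s + r * cos (theta al b rho r0 p s).

Let alb0 : 0 < al + b. Proof. exact: addr_gt0. Qed.
Let zP := @zoneP _ al b S rho r0 p b0 alb0 rho0 r00 p0 flat0.

Let r0n : r0 != 0. Proof. by rewrite gt_eqF. Qed.
Let rhon : rho != 0. Proof. by rewrite gt_eqF. Qed.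

Let th1 : al + - r0^-1 * arc1_end = - b.
Proof. by have -> : arc1_end = r0 * (al + b) by []; have := r0n => ?; field. Qed.

Let ps0 : - b + rho^-1 * (rho * b) = 0.
Proof. by have := rhon => ?; field. Qed.

Let pos1 : 0 < arc1_end. Proof. by rewrite mulr_gt0. Qed.
Let pos2 : arc1_end <= ramp_end. Proof. by rewrite lerDl. Qed.
Let pos3 : ramp_end < arc2_end. Proof. by rewrite ltrDl mulr_gt0. Qed.

Lemma fibre_straight s r : s <= 0 ->
  fibreX s r = - m + (s * cos al - (r0 + r) * sin al) /\
  fibreZ s r = (r0 + r) * cos al + s * sin al.
Proof.
have q1 := pos1; have q2 := pos2; have q3 := pos3; have fl := flat0.
rewrite /fibreX /fibreZ /profX /profZ /theta /theta1 /psi.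
case: (zP s) => [s1|s1 s2|s1 s2|s1 s2|s1 s2|s1] s0; try lra.
by rewrite !mulr0 !addr0 sinN cosN; split; ring.
Qed.

Lemma fibre_arc s r : 0 < s -> s <= arc1_end ->
  fibreX s r = - m - (r0 + r) * sin (al - s / r0) /\
  fibreZ s r = (r0 + r) * cos (al - s / r0).
Proof.
have q1 := pos1; have q2 := pos2; have q3 := pos3; have fl := flat0.
rewrite /fibreX /fibreZ /profX /profZ /theta /theta1 /psi.
case: (zP s) => [s1|s1 s2|s1 s2|s1 s2|s1 s2|s1] s0 s3; try lra.
rewrite (_ : al + - r0^-1 * s = al - s / r0); last by ring.
by rewrite !mulr0 !addr0 sinN cosN; split; ring.
Qed.

(** Rotation by [b] about the centre of the first arc makes the ramp horizontal. In this frame [p]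
    and [r0] enter only as a translation, which is what allows different layers to be compared. *)
Lemma fibre_bend s r (v := s - ramp_end) : arc1_end < s -> s <= S ->
  (fibreX s r + m) * cos b - fibreZ s r * sin b =
    p + bendA b rho v - r * sin (bend b rho v) /\
  (fibreX s r + m) * sin b + fibreZ s r * cos b =
    r0 + bendB b rho v + r * cos (bend b rho v).
Proof.
have q1 := pos1; have q2 := pos2; have q3 := pos3; have fl := flat0.
have cs := cos2Dsin2 b.
have e2 : ramp_end = arc1_end + p by [].
have e3 : arc2_end = ramp_end + rho * b by [].
have rb : 0 < rho * b by rewrite mulr_gt0.
(* The rotation is computed once, with the length run on the ramp, the angle turned on the second
   arc and the length run on the flat part as free parameters; the three zones are instances. *)
have rot (P ps F : R) :
  (- m + (r0 * sin b + (cos b * P + (rho * sin (- b + ps) + (rho * sin b + F)))) - r * sin (- b + ps) + m) * cos b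
   - (r0 * cos b + (- sin b * P + (rho * cos b + - rho * cos (- b + ps))) + r * cos (- b + ps)) * sin b
   = P + rho * sin ps + cos b * F - r * sin ps /\
  (- m + (r0 * sin b + (cos b * P + (rho * sin (- b + ps) + (rho * sin b + F)))) - r * sin (- b + ps) + m) * sin b
   + (r0 * cos b + (- sin b * P + (rho * cos b + - rho * cos (- b + ps))) + r * cos (- b + ps)) * cos b
   = r0 + (rho * (1 - cos ps) + sin b * F) + r * cos ps.
  rewrite sinD cosD sinN cosN; split.
    transitivity ((P + rho * sin ps - r * sin ps) * (cos b ^+ 2 + sin b ^+ 2) + cos b * F); first ring.
    by rewrite cs; ring.
  transitivity ((r0 + rho * (1 - cos ps) + r * cos ps) * (cos b ^+ 2 + sin b ^+ 2) + sin b * F); first ring.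
  by rewrite cs; ring.
rewrite /fibreX /fibreZ /profX /profZ /theta /theta1 /psi /bendA /bendB.
case: (zP s) => [s1|s1 s2|s1 s2|s1 s2|s1 s2|s1] s0 sS; try lra.
- case: (bendP b0 rho0 v) => [v0|v0 v1 *|v0 *]; [|by rewrite /v in v0; lra|by rewrite /v in v0; lra].
  have [h1 h2] := rot (s - arc1_end) (rho^-1 * 0) 0.
  rewrite th1 [sin (- b)]sinN [cos (- b)]cosN.
  split; [apply: etrans (etrans _ h1) _|apply: etrans (etrans _ h2) _]; try ring.
    by rewrite !mulr0 sin0 !mulr0 /v e2; ring.
  by rewrite !mulr0 cos0; ring.
- have vE : v / rho = rho^-1 * (s - ramp_end) by rewrite mulrC.
  case: (bendP b0 rho0 v) => [v0|v0 v1 *|v0 *]; [by rewrite /v in v0; lra| |by rewrite /v in v0; lra].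
  have [h1 h2] := rot p (rho^-1 * (s - ramp_end)) 0.
  rewrite th1 [sin (- b)]sinN [cos (- b)]cosN vE.
  by split; [apply: etrans (etrans _ h1) _|apply: etrans (etrans _ h2) _]; ring.
- case: (bendP b0 rho0 v) => [v0|v0 v1 *|v0 *]; [by rewrite /v in v0; lra|by rewrite /v in v1; lra|].
  have bE : b = rho^-1 * (rho * b) by have := rhon => ?; field.
  have [h1 h2] := rot p (rho^-1 * (rho * b)) (s - arc2_end).
  rewrite th1 [sin (- b)]sinN [cos (- b)]cosN.
  split; [apply: etrans (etrans _ h1) _|apply: etrans (etrans _ h2) _]; try ring.
    by rewrite -bE /v e3; ring.
  by rewrite -bE /v e3; ring.
Qed.

Lemma width_gt0 : 0 < m.
Proof.
have cb := cosb_gt0 b0 b2; have sb := sinb_gt0 b0 b2; have fl := flat0.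
rewrite closed_up; have : 0 < r0 * sin b by rewrite mulr_gt0.
have : 0 <= p * cos b by rewrite mulr_ge0 // ltW.
have : 0 < rho * sin b by rewrite mulr_gt0.
lra.
Qed.

Let arc_angle s : 0 < s -> s <= arc1_end -> 0 < s / r0 <= al + b.
Proof. by move=> s0 s1; rewrite divr_gt0 //= ler_pdivrMr // mulrC. Qed.

(** Keeps the left half of the plate off its mirror image. This uses that heights stay below the
    radius [rho] of the second arc. *)
Lemma fibre_neg s r : 0 <= r < rho -> s < S -> fibreX s r < 0.
Proof.
move=> /andP[rge rlt] sS; have m0 := width_gt0; have fl := flat0.
have cb := cosb_gt0 b0 b2; have sb := sinb_gt0 b0 b2; have pi0 := pi_gt0 R.
have b0' := b0; have b2' := b2; have al0' := al0; have al2' := al2.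
have ca : 0 <= cos al by apply: cos_ge0_pihalf; apply/andP; split; lra.
have sa : 0 <= sin al by apply: sin_ge0_pi; apply/andP; split; lra.
have [s0|s0] := leP s 0.
  rewrite (fibre_straight r s0).1.
  have : s * cos al <= 0 by rewrite mulr_le0_ge0.
  have : 0 <= (r0 + r) * sin al by rewrite mulr_ge0 // addr_ge0 // ltW.
  lra.
have [s1|s1] := leP s arc1_end.
  rewrite (fibre_arc r s0 s1).1 closed_up; have /andP[a1 a2] := arc_angle s0 s1.
  have sl : sin (s / r0 - al) <= sin b by apply: sin_le; lra.
  have -> : sin (al - s / r0) = - sin (s / r0 - al) by rewrite -sinN opprB.
  have : (r0 + r) * sin (s / r0 - al) <= (r0 + r) * sin b.
    by rewrite ler_wpM2l // addr_ge0 // ltW.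
  have : r * sin b < rho * sin b by rewrite ltr_pM2r.
  have : 0 <= p * cos b by rewrite mulr_ge0 // ltW.
  lra.
have q1 := pos1; have q2 := pos2; have q3 := pos3.
have e2 : ramp_end = arc1_end + p by [].
have e3 : arc2_end = ramp_end + rho * b by [].
rewrite /fibreX /profX /theta /theta1 /psi closed_up.
have small ps : 0 <= ps <= b -> rho * sin (- b + ps) - r * sin (- b + ps) <= 0.
  move=> /andP[? ?]; rewrite -mulrBl (_ : - b + ps = - (b - ps)); last by ring.
  rewrite sinN mulrN oppr_le0 mulr_ge0 // ?subr_ge0 ?(ltW rlt) //.
  by apply: sin_ge0_pi; apply/andP; split; lra.
case: (zP s) s0 s1 sS => [*|*|s1 s2|s1 s2|s1 s2|*] *; try lra.
- have := small (rho^-1 * 0); rewrite mulr0 lexx (ltW b0) => /(_ isT).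
  have : cos b * (s - arc1_end) <= cos b * p by rewrite ler_pM2l //; lra.
  by rewrite th1 mulr0 !addr0 !sinN; lra.
- have := small (rho^-1 * (s - ramp_end)); rewrite th1 => H; have : 0 <= rho^-1 * (s - ramp_end) <= b.
    rewrite mulrC divr_ge0 ?subr_ge0 ?(ltW s1) ?(ltW rho0) //= ler_pdivrMr //.
    by rewrite mulrC; lra.
  by move=> /H; rewrite sinN; lra.
- by rewrite th1 ps0 sin0 sinN; lra.
Qed.

Lemma fibre_axis r : fibreX S r = 0.
Proof.
have q1 := pos1; have q2 := pos2; have q3 := pos3; have fl := flat0.
rewrite /fibreX /profX /theta /theta1 /psi closed_up.
case: (zP S) => *; try lra.
by rewrite th1 ps0 sin0 sinN; ring.
Qed.

(** The expressions are the components along the initial direction and along the ramp. Seen from the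
    centre, the first arc fills the sector of angle [al + b] between the normals to these
    directions; the straight part lies behind it, the ramp and all that follows beyond it. *)
Lemma fibre_zoneB s r : 0 <= r -> 0 < s -> s <= arc1_end ->
  0 < (fibreX s r + m) * cos al + fibreZ s r * sin al /\
  (fibreX s r + m) * cos b - fibreZ s r * sin b <= 0.
Proof.
move=> rge s0 s1; have [-> ->] := fibre_arc r s0 s1; have /andP[a1 a2] := arc_angle s0 s1.
have R0 : 0 < r0 + r by rewrite ltr_wpDr.
have albpi' := albpi; have pi0 := pi_gt0 R.
split.
  have : 0 < (r0 + r) * sin (al - (al - s / r0)).
    by rewrite mulr_gt0 // sin_gt0_pi //; apply/andP; split; lra.
  by rewrite sinB; lra.
have : 0 <= (r0 + r) * sin ((al - s / r0) + b).
  by rewrite mulr_ge0 ?(ltW R0) // sin_ge0_pi //; apply/andP; split; lra.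
by rewrite sinD; lra.
Qed.

Lemma fibre_zoneC s r : 0 <= r < rho -> arc1_end < s -> s <= S ->
  0 < (fibreX s r + m) * cos b - fibreZ s r * sin b /\
  0 < (fibreX s r + m) * sin b + fibreZ s r * cos b.
Proof.
move=> /andP[rge rlt] s1 sS; have [-> ->] := fibre_bend r s1 sS; set v := s - ramp_end.
have cb := cosb_gt0 b0 b2; have sb := sinb_gt0 b0 b2.
have e2 : ramp_end = arc1_end + p by [].
have pv : 0 < p + v by rewrite /v; lra.
have c0 := cos_bend_gt0 b0 b2 rho0 v.
have B0 : 0 <= bendB b rho v.
  rewrite /bendB addr_ge0 // mulr_ge0 ?(ltW rho0) ?(ltW sb) // ?subr_ge0 ?cos_le1 //.
  by rewrite /over; case: ifPn => //; rewrite -ltNge => /ltW; rewrite subr_ge0.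
split; last first.
  have : 0 <= r * cos (bend b rho v) by rewrite mulr_ge0 // ltW.
  have := r00; lra.
rewrite /bendA; case: (bendP b0 rho0 v) => [v0|v0 v1 _ v2 v3|v0 v1].
- by rewrite sin0; lra.
- have : 0 < (rho - r) * sin (v / rho).
    rewrite mulr_gt0 ?subr_gt0 // sin_gt0_pi //; have := b2; have := pi_gt0 R => ? ?.
    by apply/andP; split; lra.
  have := p0; lra.
- have : 0 < (rho - r) * sin b by rewrite mulr_gt0 // subr_gt0.
  have : 0 < cos b * (v - rho * b) by rewrite mulr_gt0 // subr_gt0.
  have := p0; lra.
Qed.

End ProfileFrame.

(** Two quadrants with common vertex, separated by the angle [al + b] on one side and by
    [pi - (al + b)] on the other. *)
Lemma zonesAC_disjoint (R : realType) (al b x z : R) : 0 < al + b < pi ->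
  x * cos al + z * sin al <= 0 -> 0 < - x * sin al + z * cos al ->
  0 < x * cos b - z * sin b -> 0 < x * sin b + z * cos b -> False.
Proof.
move=> albpi; set ta := x * cos b - z * sin b; set nn := x * sin b + z * cos b.
have cs := cos2Dsin2 b.
have -> : x * cos al + z * sin al = ta * cos (al + b) + nn * sin (al + b).
  rewrite cosD sinD /ta /nn; transitivity ((x * cos al + z * sin al) * (cos b ^+ 2 + sin b ^+ 2)).
    by rewrite cs mulr1.
  ring.
have -> : - x * sin al + z * cos al = - ta * sin (al + b) + nn * cos (al + b).
  rewrite cosD sinD /ta /nn; transitivity ((- x * sin al + z * cos al) * (cos b ^+ 2 + sin b ^+ 2)).
    by rewrite cs mulr1.
  ring.
have sp : 0 < sin (al + b) by exact: sin_gt0_pi.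
move=> h1 h2 t0 n0.
have ns : 0 < nn * sin (al + b) by rewrite mulr_gt0.
have ts : 0 < ta * sin (al + b) by rewrite mulr_gt0.
have [c0|c0] := leP 0 (cos (al + b)).
  by have : 0 <= ta * cos (al + b); [rewrite mulr_ge0 // ltW|lra].
have : nn * cos (al + b) < 0 by rewrite pmulr_rlt0.
lra.
Qed.

Lemma layer_offset_inj (R : realType) (t r r' : R) (k k' : nat) :
  0 <= r < t -> 0 <= r' < t -> k%:R * t + r = k'%:R * t + r' -> k = k' /\ r = r'.
Proof.
move=> /andP[r0 rt] /andP[r'0 r't] E.
have t0 : 0 < t by lra.
have lt_false (i j : nat) (x y : R) : 0 <= x -> x < t -> 0 <= y -> (i < j)%N ->
    i%:R * t + x = j%:R * t + y -> False.
  move=> x0 xt y0 ij; have : i%:R * t + t <= j%:R * t.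
    by rewrite -{2}[t]mul1r -mulrDl ler_pM2r // natr1 ler_nat.
  lra.
have kk : k = k'.
  case: (ltngtP k k') => // kk; first by case: (lt_false k k' r r').
  by case: (lt_false k' k r' r).
by split=> //; move: E; rewrite kk => /addrI.
Qed.

Lemma sincos_inj (R : realType) (x y : R) : - pi < x - y < pi ->
  sin x = sin y -> cos x = cos y -> x = y.
Proof.
move=> /andP[h1 h2] Es Ec.
have s0 : sin (x - y) = 0 by rewrite sinB Es Ec; ring.
have [d|d|] := ltgtP x y; last by [].
  have : 0 < sin (- (x - y)) by apply: sin_gt0_pi; apply/andP; split; lra.
  by rewrite sinN s0; lra.
have : 0 < sin (x - y) by apply: sin_gt0_pi; apply/andP; split; lra.
by rewrite s0; lra.
Qed.

(** * The stack of layers *)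

Section Layers.
Context {R : realType}.
Variables (al b S rho R0 Y t : R).
Hypotheses (al0 : 0 < al) (b0 : 0 < b) (b2 : b < pi / 2) (albpi : al + b < pi).
Hypotheses (rho0 : 0 < rho) (R00 : 0 < R0) (Y0 : 0 <= Y) (t0 : 0 < t) (trho : t < rho).

(* The ramps shorten at this rate from one layer to the next: then all layers have the same width. *)
Definition ramp_rate : R := (al + b - sin b) / (1 - cos b).

Hypotheses (steep : sin b < ramp_rate)
  (fits : (R0 + Y) * (al + b) + Y * ramp_rate + rho * b < S).

(** Capped at [Y], so that the ramp length is nonnegative for every index, also for layers above the
    plate. *)
Definition height (k : nat) : R := Num.min (k%:R * t) Y.
Definition radius k : R := R0 + height k.
Definition ramp k : R := (Y - height k) * ramp_rate.
Definition width : R := S - (R0 + Y) * (al + b - sin b) - rho * (b - sin b).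

Let height_ge0 k : 0 <= height k.
Proof. by rewrite /height le_min Y0 andbT mulr_ge0 // ltW. Qed.

Let height_le k : height k <= Y.
Proof. by rewrite /height ge_min lexx orbT. Qed.

Lemma radius_gt0 k : 0 < radius k.
Proof. by rewrite ltr_wpDr. Qed.

Let sb : 0 < sin b. Proof. exact: sinb_gt0. Qed.

Lemma ramp_rate_gt0 : 0 < ramp_rate.
Proof. exact: lt_trans steep. Qed.

Lemma ramp_ge0 k : 0 <= ramp k.
Proof. by rewrite mulr_ge0 ?(ltW ramp_rate_gt0) // subr_ge0. Qed.

Lemma layer_flat k : arc2_end al b rho (radius k) (ramp k) < S.
Proof.
apply: le_lt_trans fits; rewrite /arc2_end /ramp_end /arc1_end lerD2r.
have := height_ge0 k; have := height_le k => h1 h2.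
apply: lerD; last by rewrite ler_pM2r ?ramp_rate_gt0 //; lra.
by rewrite ler_pM2r ?addr_gt0 // lerD2l.
Qed.

(** The distance from the centre to the axis is [S] minus the loss of each piece:
    [radius * (al + b - sin b)] on the first arc, [ramp * (1 - cos b)] on the ramp,
    [rho * (b - sin b)] on the second arc. With [ramp_rate] the first two losses have a sum that
    does not depend on [k]. *)
Lemma layer_width k : width = radius k * sin b + ramp k * cos b + rho * sin b
  + (S - arc2_end al b rho (radius k) (ramp k)).
Proof.
have cb : 1 - cos b != 0.
  rewrite subr_eq0 eq_sym lt_eqF // -(cos0 R) ltr_cos // in_itv /=; have := b0; have := b2; have := pi_gt0 R => *;
  by apply/andP; split; lra.
have rE : ramp k * (1 - cos b) = (Y - height k) * (al + b - sin b).
  by rewrite /ramp /ramp_rate -!mulrA mulVf // mulr1.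
transitivity (S - radius k * (al + b - sin b) - ramp k * (1 - cos b) - rho * (b - sin b)).
  by rewrite rE /width /radius; ring.
by rewrite /arc2_end /ramp_end /arc1_end; ring.
Qed.

Definition fibX k s r := fibreX al b S rho (radius k) (ramp k) width s r.
Definition fibZ k s r := fibreZ al b rho (radius k) (ramp k) s r.

Let straight k := @fibre_straight R al b S rho _ _ width al0 b0 rho0 (radius_gt0 k) (ramp_ge0 k) (layer_flat k).
Let arc k := @fibre_arc R al b S rho _ _ width al0 b0 rho0 (radius_gt0 k) (ramp_ge0 k) (layer_flat k).
Let bendE k := @fibre_bend R al b S rho _ _ width al0 b0 rho0 (radius_gt0 k) (ramp_ge0 k) (layer_flat k).
Let zoneB k := @fibre_zoneB R al b S rho _ _ width al0 b0 albpi rho0 (radius_gt0 k) (ramp_ge0 k) (layer_flat k).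
Let zoneC k := @fibre_zoneC R al b S rho _ _ width al0 b0 b2 rho0 (radius_gt0 k) (ramp_ge0 k) (layer_flat k).

Lemma radiusE k : k%:R * t <= Y -> radius k = R0 + k%:R * t.
Proof. by move=> kY; rewrite /radius /height min_l. Qed.

Let radius_le k k' : (k < k')%N -> k'%:R * t <= Y -> radius k + t <= radius k'.
Proof.
move=> kk k'Y; have H : k%:R * t + t <= k'%:R * t.
  by rewrite -{2}[t]mul1r -mulrDl ler_pM2r // natr1 ler_nat.
have tp := t0; have kY : k%:R * t <= Y by lra.
by rewrite !radiusE //; lra.
Qed.

(** Here [steep] enters: an upper layer stays behind by more than the at most [t sin b] by which
    tilted cross-sections of the lower one lean back. *)
Let ramp_lt k k' : radius k + t <= radius k' -> t * sin b < ramp k - ramp k'.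
Proof.
move=> rr; rewrite /ramp -mulrBl; have -> : Y - height k - (Y - height k') = radius k' - radius k.
  by rewrite /radius; ring.
apply: (@lt_le_trans _ _ (t * ramp_rate)); first by rewrite ltr_pM2l.
by rewrite ler_pM2r ?ramp_rate_gt0 //; lra.
Qed.

(** Polar coordinates about the common centre; the angles range over less than [pi], so sine and
    cosine determine them. *)
Let arc_inj k k' s s' r r' : 0 <= r -> 0 <= r' ->
  0 < s -> s <= arc1_end al b (radius k) -> 0 < s' -> s' <= arc1_end al b (radius k') ->
  fibX k s r = fibX k' s' r' -> fibZ k s r = fibZ k' s' r' ->
  radius k + r = radius k' + r' /\ s / radius k = s' / radius k'.
Proof.
move=> r0 r'0 s0 s1 s'0 s'1; have rk := radius_gt0 k; have rk' := radius_gt0 k'.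
rewrite /fibX /fibZ (arc r s0 s1).1 (arc r s0 s1).2 (arc r' s'0 s'1).1 (arc r' s'0 s'1).2.
set f := al - s / radius k; set f' := al - s' / radius k' => EX EZ.
have q : 0 < s / radius k <= al + b by rewrite divr_gt0 //= ler_pdivrMr // mulrC.
have q' : 0 < s' / radius k' <= al + b by rewrite divr_gt0 //= ler_pdivrMr // mulrC.
have Es : (radius k + r) * sin f = (radius k' + r') * sin f' by lra.
have rad : radius k + r = radius k' + r'.
  apply/eqP; rewrite -(@eqrXn2 _ 2) // ?addr_ge0 // ?ltW //; apply/eqP.
  transitivity (((radius k + r) * cos f) ^+ 2 + ((radius k + r) * sin f) ^+ 2).
    by rewrite -[LHS]mulr1 -(cos2Dsin2 f); ring.
  by rewrite EZ Es -[RHS]mulr1 -(cos2Dsin2 f'); ring.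
have radn : radius k' + r' != 0 by rewrite gt_eqF // ltr_wpDr.
split=> //; rewrite rad in Es EZ; have ap := albpi.
have : f = f'.
  apply: sincos_inj; [|exact: (mulfI radn)|exact: (mulfI radn)].
  by move: q q' => /andP[? ?] /andP[? ?]; apply/andP; rewrite /f /f'; split; lra.
by rewrite /f /f'; lra.
Qed.

Let AB_disjoint k k' s s' r r' : 0 <= r' -> s <= 0 -> 0 < s' -> s' <= arc1_end al b (radius k') ->
  fibX k s r = fibX k' s' r' -> fibZ k s r = fibZ k' s' r' -> False.
Proof.
move=> r'0 s0 s'0 s'1 EX EZ; have [q _] := zoneB r'0 s'0 s'1.
move: q; rewrite -/(fibX _ _ _) -/(fibZ _ _ _) -EX -EZ /fibX /fibZ (straight k r s0).1 (straight k r s0).2.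
set Rr := radius k + r.
have -> : (- width + (s * cos al - Rr * sin al) + width) * cos al + (Rr * cos al + s * sin al) * sin al
  = s * (cos al ^+ 2 + sin al ^+ 2) by ring.
by rewrite cos2Dsin2; lra.
Qed.

Let AC_disjoint k k' s s' r r' : 0 <= r -> 0 <= r' < t -> s <= 0 ->
  arc1_end al b (radius k') < s' -> s' <= S ->
  fibX k s r = fibX k' s' r' -> fibZ k s r = fibZ k' s' r' -> False.
Proof.
move=> r0 /andP[r'0 r't] s0 s'1 s'S EX EZ.
have r'rho : 0 <= r' < rho by rewrite r'0 (lt_trans r't).
have [q1 q2] := zoneC r'rho s'1 s'S.
rewrite -/(fibX _ _ _) -/(fibZ _ _ _) -EX -EZ in q1 q2.
apply: (@zonesAC_disjoint _ al b _ _ _ _ _ q1 q2).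
- by rewrite albpi addr_gt0.
- rewrite /fibX /fibZ (straight k r s0).1 (straight k r s0).2; set Rr := radius k + r.
  have -> : (- width + (s * cos al - Rr * sin al) + width) * cos al + (Rr * cos al + s * sin al) * sin al
    = s * (cos al ^+ 2 + sin al ^+ 2) by ring.
  by rewrite cos2Dsin2 mulr1.
- rewrite /fibX /fibZ (straight k r s0).1 (straight k r s0).2; set Rr := radius k + r.
  have -> : - (- width + (s * cos al - Rr * sin al) + width) * sin al + (Rr * cos al + s * sin al) * cos al
    = Rr * (cos al ^+ 2 + sin al ^+ 2) by ring.
  by rewrite cos2Dsin2 mulr1 ltr_wpDr // radius_gt0.
Qed.

Let BC_disjoint k k' s s' r r' : 0 <= r -> 0 <= r' < rho -> 0 < s -> s <= arc1_end al b (radius k) ->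
  arc1_end al b (radius k') < s' -> s' <= S ->
  fibX k s r = fibX k' s' r' -> fibZ k s r = fibZ k' s' r' -> False.
Proof.
move=> r0 r'rho s0 s1 s'1 s'S EX EZ.
have [q1 _] := zoneC r'rho s'1 s'S; have [_ q2] := zoneB r0 s0 s1.
by rewrite -/(fibX _ _ _) -/(fibZ _ _ _) EX EZ in q2; rewrite -/(fibX _ _ _) -/(fibZ _ _ _) in q1; lra.
Qed.

Let CC_disjoint k k' s s' r r' : (k < k')%N -> k'%:R * t <= Y -> 0 <= r < t -> 0 <= r' < t ->
  arc1_end al b (radius k) < s -> s <= S -> arc1_end al b (radius k') < s' -> s' <= S ->
  fibX k s r = fibX k' s' r' -> fibZ k s r = fibZ k' s' r' -> False.
Proof.
move=> kk k'Y rt /andP[r'0 _] s1 sS s'1 s'S EX EZ.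
have [t1 n1] := bendE r s1 sS; have [t2 n2] := bendE r' s'1 s'S.
rewrite -/(fibX _ _ _) -/(fibZ _ _ _) EX EZ in t1 n1.
have rr := radius_le kk k'Y.
apply: (bend_disjoint b0 b2 rho0 rr (ltW (ramp_lt rr)) rt r'0); first exact: etrans (esym t1) t2.
exact: etrans (esym n1) n2.
Qed.

(** The zones occupy regions around the common centre that are the same for all layers, so points of
    different zones are distinct even across layers. Within a zone, the distance from the centre or
    the comparison of translates decides. *)
Lemma fibres_inj k k' s s' r r' : k%:R * t <= Y -> k'%:R * t <= Y ->
  s <= S -> s' <= S -> 0 <= r < t -> 0 <= r' < t ->
  fibX k s r = fibX k' s' r' -> fibZ k s r = fibZ k' s' r' -> [/\ k = k', s = s' & r = r'].
Proof.
move=> kY k'Y sS s'S rt r't EX EZ.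
have [/andP[r0 _] /andP[r'0 _]] := (rt, r't).
have rrho : 0 <= r < rho by move: rt => /andP[-> ?] /=; exact: lt_trans trho.
have r'rho : 0 <= r' < rho by move: r't => /andP[-> ?] /=; exact: lt_trans trho.
(* [radius k + r] is [R0] plus the height in the plate, from which division with remainder by [t]
   recovers [k] and [r]. *)
have offs : radius k + r = radius k' + r' -> k = k' /\ r = r'.
  by rewrite !radiusE // -!addrA => /addrI; exact: layer_offset_inj.
have [s0|s0] := leP s 0; have [s'0|s'0] := leP s' 0.
- move: EX EZ; rewrite /fibX /fibZ (straight k r s0).1 (straight k r s0).2 (straight k' r' s'0).1 (straight k' r' s'0).2.
  set P := radius k + r; set P' := radius k' + r' => /addrI EX EZ.
  have cs := cos2Dsin2 al.
  have Es : s = s'.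
    transitivity ((s * cos al - P * sin al) * cos al + (P * cos al + s * sin al) * sin al).
      by rewrite -[LHS]mulr1 -cs; ring.
    by rewrite EZ EX -[RHS]mulr1 -cs; ring.
  have EP : P = P'.
    transitivity (- (s * cos al - P * sin al) * sin al + (P * cos al + s * sin al) * cos al).
      by rewrite -[LHS]mulr1 -cs; ring.
    by rewrite EZ EX -[RHS]mulr1 -cs; ring.
  by have [? ?] := offs EP.
- by exfalso; have [s'1|s'1] := leP s' (arc1_end al b (radius k'));
    [exact: (AB_disjoint r'0 s0 s'0 s'1 EX EZ)|exact: (AC_disjoint r0 r't s0 s'1 s'S EX EZ)].
- by exfalso; have [s1|s1] := leP s (arc1_end al b (radius k));
    [exact: (AB_disjoint r0 s'0 s0 s1 (esym EX) (esym EZ))|exact: (AC_disjoint r'0 rt s'0 s1 sS (esym EX) (esym EZ))].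
have [s1|s1] := leP s (arc1_end al b (radius k)); have [s'1|s'1] := leP s' (arc1_end al b (radius k')).
- have [rad ang] := arc_inj r0 r'0 s0 s1 s'0 s'1 EX EZ.
  have [kk rr] := offs rad; split=> //; move: ang; rewrite kk => /mulIf; apply.
  by rewrite invr_eq0 gt_eqF // radius_gt0.
- by case: (BC_disjoint r0 r'rho s0 s1 s'1 s'S EX EZ).
- by case: (BC_disjoint r'0 rrho s'0 s'1 s1 sS (esym EX) (esym EZ)).
case: (ltngtP k k') => kk.
- by case: (CC_disjoint kk k'Y rt r't s1 sS s'1 s'S EX EZ).
- by case: (CC_disjoint kk kY r't rt s'1 s'S s1 sS (esym EX) (esym EZ)).
have [t1 n1] := bendE r s1 sS; have [t2 n2] := bendE r' s'1 s'S.
rewrite -/(fibX _ _ _) -/(fibZ _ _ _) EX EZ in t1 n1.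
rewrite -kk -/(fibX _ _ _) -/(fibZ _ _ _) in t2 n2; rewrite -kk in t1 n1.
move: t1 n1 t2 n2; set v := s - _; set v' := s' - _ => t1 n1 t2 n2.
have EA : bendA b rho v - r * sin (bend b rho v) = bendA b rho v' - r' * sin (bend b rho v').
  by have := etrans (esym t1) t2; lra.
have EB : bendB b rho v + r * cos (bend b rho v) = bendB b rho v' + r' * cos (bend b rho v').
  by have := etrans (esym n1) n2; lra.
have [vv ->] := bend_layer_inj b0 b2 rho0 rrho r'rho EA EB.
by split=> //; move: vv => /addIr.
Qed.

(** At equal arclength two neighbours part as soon as [0 < s]: on the first arcs they have turned by
    different angles [s / radius], on the ramps they have advanced differently because the upper arc
    is longer. Hence the jump is nonzero on the whole cut. *)
Lemma fibres_touch k s : k.+1%:R * t <= Y -> 0 < s -> s <= S ->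
  fibX k s t = fibX k.+1 s 0 -> fibZ k s t = fibZ k.+1 s 0 -> False.
Proof.
move=> kY s0 sS EX EZ.
have kY0 : k%:R * t <= Y by apply: le_trans kY; rewrite ler_pM2r // ler_nat.
have rE : radius k + t = radius k.+1 by rewrite !radiusE // -natr1; ring.
have rlt : radius k < radius k.+1 by rewrite -rE ltrDl.
have alb : 0 < al + b by rewrite addr_gt0.
have alt : arc1_end al b (radius k) < arc1_end al b (radius k.+1) by rewrite ltr_pM2r.
have trho' : 0 <= t < rho by rewrite trho ltW.
have [s1|s1] := leP s (arc1_end al b (radius k)).
  have s2 := ltW (le_lt_trans s1 alt).
  have [_ ang] := arc_inj (ltW t0) (lexx 0) s0 s1 s0 s2 EX EZ.
  have := congr1 GRing.inv (mulfI (lt0r_neq0 s0) ang).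
  by rewrite !invrK => q; lra.
have [s2|s2] := leP s (arc1_end al b (radius k.+1)).
  exact: (BC_disjoint (lexx 0) trho' s0 s2 s1 sS (esym EX) (esym EZ)).
have [t1 n1] := bendE t s1 sS; have [t2 n2] := bendE 0 s2 sS.
rewrite -/(fibX _ _ _) -/(fibZ _ _ _) EX EZ in t1 n1.
have H : radius k + t <= radius k.+1 by rewrite rE.
have := @bend_touch _ _ _ b0 b2 rho0 t (ramp k) (ramp k.+1) (radius k) _ _ (ltW t0) (ramp_lt H).
move=> /(_ (s - ramp_end al b (radius k) (ramp k)) (s - ramp_end al b (radius k.+1) (ramp k.+1))).
have -> : ramp k + (s - ramp_end al b (radius k) (ramp k)) = s - arc1_end al b (radius k).
  by rewrite /ramp_end; ring.
have -> : ramp k.+1 + (s - ramp_end al b (radius k.+1) (ramp k.+1)) = s - arc1_end al b (radius k.+1).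
  by rewrite /ramp_end; ring.
move=> B; suff : s - arc1_end al b (radius k) = s - arc1_end al b (radius k.+1) by lra.
apply: B; first by have := etrans (esym t1) t2; rewrite mul0r subr0.
by have := etrans (esym n1) n2; rewrite mul0r addr0 rE.
Qed.

End Layers.

(** * Reflection at the axis *)

Section Saturation.
Context {R : realType}.
Variables (al b S rho r0 p m : R).
Hypotheses (b0 : 0 < b) (alb0 : 0 < al + b) (rho0 : 0 < rho) (r00 : 0 < r0) (p0 : 0 <= p).
Hypothesis flat0 : arc2_end al b rho r0 p < S.
Let zP := @zoneP _ al b S rho r0 p b0 alb0 rho0 r00 p0 flat0.

Let pos2 : arc1_end al b r0 <= ramp_end al b r0 p. Proof. by rewrite lerDl. Qed.
Let pos1 : 0 < arc1_end al b r0. Proof. by rewrite mulr_gt0. Qed.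
Let pos3 : ramp_end al b r0 p < arc2_end al b rho r0 p. Proof. by rewrite ltrDl mulr_gt0. Qed.

Lemma profile_saturated s : S <= s ->
  [/\ profX al b S rho r0 p m s = profX al b S rho r0 p m S,
      profZ al b rho r0 p s = profZ al b rho r0 p S,
      theta al b rho r0 p s = 0 & dtheta al b rho r0 p s = 0].
Proof.
have q1 := pos1; have q2 := pos2; have q3 := pos3; have fl := flat0 => Ss.
have th1 : al + - r0^-1 * arc1_end al b r0 = - b.
  by rewrite /arc1_end; have := lt0r_neq0 r00 => ?; field.
have ps0 : - b + rho^-1 * (rho * b) = 0 by have := lt0r_neq0 rho0 => ?; field.
rewrite /profX /profZ /theta /dtheta /theta1 /psi.
move: Ss; rewrite le_eqVlt => /predU1P[<-|Ss].
  case: (zP S) => [?|? ?|? ?|? ?|? ?|?]; try lra.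
  by rewrite th1 ps0 !mulr0 addr0.
case: (zP s) => [?|? ?|? ?|? ?|? ?|?]; try lra.
case: (zP S) => [?|? ?|? ?|? ?|? ?|?]; try lra.
by rewrite th1 ps0 !mulr0 addr0.
Qed.

Lemma theta_left s : s <= 0 -> theta al b rho r0 p s = al /\ dtheta al b rho r0 p s = 0.
Proof.
have q1 := pos1; have q2 := pos2; have q3 := pos3; have fl := flat0 => s0.
rewrite /theta /dtheta /theta1; case: (zP s) => [?|? ?|? ?|? ?|? ?|?]; lra.
Qed.

Lemma norm_dtheta s : `|dtheta al b rho r0 p s| <= r0^-1 + rho^-1.
Proof.
have i0 : 0 < r0^-1 by rewrite invr_gt0.
have i1 : 0 < rho^-1 by rewrite invr_gt0.
by rewrite /dtheta; case: (zP s) => *; rewrite ler_norml; apply/andP; split; lra.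
Qed.

End Saturation.

Section Curves.
Context {R : realType}.
Variables (al b S rho R0 Y t : R).
Hypotheses (al0 : 0 < al) (al2 : al <= pi / 2) (b0 : 0 < b) (b2 : b < pi / 2) (albpi : al + b < pi).
Hypotheses (rho0 : 0 < rho) (R00 : 0 < R0) (Y0 : 0 <= Y) (t0 : 0 < t) (trho : t < rho).
Hypotheses (steep : sin b < ramp_rate al b)
  (fits : (R0 + Y) * (al + b) + Y * ramp_rate al b + rho * b < S).

Local Notation rad k := (radius R0 Y t k).
Local Notation rmp k := (ramp al b Y t k).
Local Notation PX k := (profX al b S rho (rad k) (rmp k) (width al b S rho R0 Y)).
Local Notation PZ k := (profZ al b rho (rad k) (rmp k)).
Local Notation PT k := (theta al b rho (rad k) (rmp k)).
Local Notation DT k := (dtheta al b rho (rad k) (rmp k)).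
Local Notation fX := (fibX al b S rho R0 Y t).
Local Notation fZ := (fibZ al b rho R0 Y t).

(** Since the profile is at rest beyond [S], on each side of the axis one of the two profile terms
    is constant. A single formula thus gives both halves, and regularity across the axis comes from
    the calculus of piecewise derivatives. *)
Definition curveX (k : nat) x : R := PX k (S + x) - PX k (S - x).
Definition curveZ (k : nat) x : R := PZ k (S + x) + PZ k (S - x) - PZ k S.
Definition angle (k : nat) x : R := PT k (S + x) - PT k (S - x).
Definition curvature (k : nat) x : R := DT k (S + x) + DT k (S - x).

Let alb0 : 0 < al + b. Proof. exact: addr_gt0. Qed.
Let rad0 k : 0 < rad k. Proof. exact: radius_gt0. Qed.
Let rmp0 k : 0 <= rmp k. Proof. exact: ramp_ge0. Qed.
Let flat k : arc2_end al b rho (rad k) (rmp k) < S. Proof. exact: layer_flat. Qed.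
Let sat k s := @profile_saturated _ al b S rho _ _ (width al b S rho R0 Y) b0 alb0 rho0 (rad0 k) (rmp0 k) (flat k) s.
Let PXS k : PX k S = 0.
Proof.
have := fibre_axis al0 b0 rho0 (rad0 k) (rmp0 k) (flat k) (layer_width al S rho R0 Y t b0 b2 k) 0.
by rewrite /fibreX mul0r subr0.
Qed.

Lemma curve_left k x : x <= 0 ->
  [/\ curveX k x = PX k (S + x), curveZ k x = PZ k (S + x) & angle k x = PT k (S + x)].
Proof.
move=> x0; have [|X Z T _] := sat k (s := S - x); first lra.
by rewrite /curveX /curveZ /angle X Z T PXS; split; ring.
Qed.

Lemma curve_right k x : 0 <= x ->
  [/\ curveX k x = - PX k (S - x), curveZ k x = PZ k (S - x) & angle k x = - PT k (S - x)].
Proof.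
move=> x0; have [|X Z T _] := sat k (s := S + x); first lra.
by rewrite /curveX /curveZ /angle X Z T PXS; split; ring.
Qed.

Let comp (f g : R -> R) a : a != 0 -> piecewise_deriv f g ->
  piecewise_deriv (fun x => f (a * x + S)) (fun x => a * g (a * x + S)).
Proof. exact: piecewise_deriv_comp_affine. Qed.

Let reflect_deriv (c : R) (f g : R -> R) : piecewise_deriv f g ->
  piecewise_deriv (fun x => f (S + x) + c * f (S - x)) (fun x => g (S + x) - c * g (S - x)).
Proof.
move=> fg; have H1 := comp (oner_neq0 R) fg.
have m1 : (-1 : R) != 0 by rewrite oppr_eq0 oner_neq0.
have H2 := piecewise_derivZ c (comp m1 fg).
have e1 x : 1 * x + S = S + x by ring.
have e2 x : -1 * x + S = S - x by ring.
rewrite (_ : (fun x => _) = fun x => f (1 * x + S) + c * f (-1 * x + S)); last first.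
  by apply/funext => x; rewrite e1 e2.
apply: (piecewise_deriv_eq (E := [::]) (piecewise_derivD H1 H2)) => x _.
by rewrite e1 e2; ring.
Qed.

Let dPX k := piecewise_deriv_profX (width al b S rho R0 Y) b0 alb0 rho0 (rad0 k) (rmp0 k) (flat k).
Let dPZ k := piecewise_deriv_profZ b0 alb0 rho0 (rad0 k) (rmp0 k) (flat k).

Lemma piecewise_deriv_curveX k : piecewise_deriv (curveX k) (fun x => cos (angle k x)).
Proof.
have H := reflect_deriv (-1) (dPX k).
rewrite (_ : curveX k = fun x => PX k (S + x) + -1 * PX k (S - x)); last first.
  by apply/funext => x; rewrite /curveX; ring.
apply: (piecewise_deriv_eq (E := [:: 0]) H) => x; rewrite inE => x0.
have [xneg|xpos|xE] := ltgtP x 0; last by rewrite xE eqxx in x0.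
  have [_ _ ->] := curve_left k (ltW xneg); rewrite ifT; last lra.
  by rewrite ifF ?mulr0 ?subr0 //; apply/negbTE; rewrite -ltNge; lra.
have [_ _ ->] := curve_right k (ltW xpos); rewrite ifF; last by apply/negbTE; rewrite -ltNge; lra.
by rewrite ifT ?cosN; [ring|lra].
Qed.

Lemma piecewise_deriv_curveZ k : piecewise_deriv (curveZ k) (fun x => sin (angle k x)).
Proof.
have H := piecewise_derivD (reflect_deriv 1 (dPZ k)) (piecewise_deriv_cst (- PZ k S)).
rewrite (_ : curveZ k = fun x => PZ k (S + x) + 1 * PZ k (S - x) + - PZ k S); last first.
  by apply/funext => x; rewrite /curveZ; ring.
apply: (piecewise_deriv_eq (E := [:: 0]) H) => x; rewrite inE => x0.
have [xneg|xpos|xE] := ltgtP x 0; last by rewrite xE eqxx in x0.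
  have [_ _ ->] := curve_left k (ltW xneg); rewrite ifT; last lra.
  by rewrite ifF ?mulr0 ?subr0 ?addr0 //; apply/negbTE; rewrite -ltNge; lra.
have [_ _ ->] := curve_right k (ltW xpos); rewrite ifF; last by apply/negbTE; rewrite -ltNge; lra.
by rewrite ifT ?sinN; [ring|lra].
Qed.

Lemma piecewise_deriv_angle k : piecewise_deriv (angle k) (curvature k).
Proof.
have H := reflect_deriv (-1) (piecewise_deriv_theta al b rho (rad k) (rmp k)).
rewrite (_ : angle k = fun x => PT k (S + x) + -1 * PT k (S - x)); last first.
  by apply/funext => x; rewrite /angle; ring.
by apply: (piecewise_deriv_eq (E := [::]) H) => x _; rewrite /curvature; ring.
Qed.

Lemma norm_curvature k x : `|curvature k x| <= 2 * (R0^-1 + rho^-1).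
Proof.
have H s : `|DT k s| <= R0^-1 + rho^-1.
  apply: le_trans (norm_dtheta b0 alb0 rho0 (rad0 k) (rmp0 k) (flat k) s) _.
  by rewrite lerD2r lef_pV2 ?posrE // /radius lerDl /height le_min Y0 mulr_ge0 // ltW.
by apply: le_trans (ler_normD _ _) _; have := H (S + x); have := H (S - x); lra.
Qed.

Let far (s : R) : S <= `|s| -> s <= - S \/ S <= s.
Proof. by rewrite ler_normr => /orP[]; [right|left; lra]. Qed.

Let S0 : 0 < S.
Proof.
apply: lt_trans (flat 0); rewrite /arc2_end /ramp_end /arc1_end.
by rewrite ltr_pwDr ?mulr_gt0 // addr_ge0 // ltW // mulr_gt0.
Qed.

Lemma curvature_far k x : S <= `|x| -> curvature k x = 0.
Proof.
have L s s0 := (theta_left b0 alb0 rho0 (rad0 k) (rmp0 k) (flat k) (s := s) s0).2.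
have S0' := S0; move=> /far[xS|xS]; rewrite /curvature.
  by have [|_ _ _ ->] := sat k (s := S - x); [lra|rewrite L ?addr0 //; lra].
by have [|_ _ _ ->] := sat k (s := S + x); [lra|rewrite L ?add0r //; lra].
Qed.

Lemma angle_left k x : x <= - S -> angle k x = al.
Proof.
have S0' := S0 => xS; have [|_ _ ->] := @curve_left k x; first lra.
by apply: (theta_left b0 alb0 rho0 (rad0 k) (rmp0 k) (flat k) _).1; lra.
Qed.

Lemma angle_right k x : S <= x -> angle k x = - al.
Proof.
have S0' := S0 => xS; have [|_ _ ->] := @curve_right k x; first lra.
by rewrite (theta_left b0 alb0 rho0 (rad0 k) (rmp0 k) (flat k) _).1 //; lra.
Qed.

Local Notation u := (layered_map t curveX curveZ angle).
Local Notation jump := (layer_jump t curveX curveZ angle).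
Local Notation lay := (layer t).

Lemma layered_map_left x : x.1 <= 0 ->
  u x = (fX (lay x.2) (S + x.1) (x.2 - (lay x.2)%:R * t), fZ (lay x.2) (S + x.1) (x.2 - (lay x.2)%:R * t)).
Proof.
move=> x0; rewrite /layered_map /plate /midline /normal /=.
have [-> -> ->] := curve_left (lay x.2) x0.
by rewrite /fibX /fibreX /fibZ /fibreZ mulrN.
Qed.

Lemma layered_map_right x : 0 <= x.1 ->
  u x = (- fX (lay x.2) (S - x.1) (x.2 - (lay x.2)%:R * t), fZ (lay x.2) (S - x.1) (x.2 - (lay x.2)%:R * t)).
Proof.
move=> x0; rewrite /layered_map /plate /midline /normal /=.
have [-> -> ->] := curve_right (lay x.2) x0.
by rewrite /fibX /fibreX /fibZ /fibreZ sinN cosN opprK opprB addrC.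
Qed.

Lemma layer_jump_left k s : s <= 0 ->
  jump 0 k s = fX k (S + s) 0 - fX k.-1 (S + s) t /\ jump 1 k s = fZ k (S + s) 0 - fZ k.-1 (S + s) t.
Proof.
move=> s0; rewrite /layer_jump /plate_jump /midline /normal /=.
have [-> -> _] := curve_left k s0; have [-> -> ->] := curve_left k.-1 s0.
by rewrite /fibX /fibreX /fibZ /fibreZ; split; ring.
Qed.

Lemma layer_jump_right k s : 0 <= s ->
  jump 0 k s = fX k.-1 (S - s) t - fX k (S - s) 0 /\ jump 1 k s = fZ k (S - s) 0 - fZ k.-1 (S - s) t.
Proof.
move=> s0; rewrite /layer_jump /plate_jump /midline /normal /=.
have [-> -> _] := curve_right k s0; have [-> -> ->] := curve_right k.-1 s0.
by rewrite /fibX /fibreX /fibZ /fibreZ sinN cosN; split; ring.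
Qed.

Variable h : R.
Hypothesis stack : forall k, k%:R * t < h -> k%:R * t <= Y.

Let straight k := @fibre_straight R al b S rho _ _ (width al b S rho R0 Y) al0 b0 rho0 (rad0 k) (rmp0 k) (flat k).

Let glued_fibre k s : (0 < k)%N -> k%:R * t < h -> s <= 0 ->
  fX k.-1 s t = fX k s 0 /\ fZ k.-1 s t = fZ k s 0.
Proof.
case: k => // k _ /stack kY s0 /=.
have kY0 : k%:R * t <= Y by apply: le_trans kY; rewrite ler_pM2r // ler_nat.
have rE : rad k + t = rad k.+1 by rewrite !radiusE // -natr1; ring.
by rewrite /fibX /fibZ !(straight _ _ s0).1 !(straight _ _ s0).2 rE addr0.
Qed.

Lemma layers_glued k s : (0 < k)%N -> k%:R * t < h -> S <= `|s| -> forall i, jump i k s = 0.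
Proof.
have S0' := S0; move=> k0 kh /far[sS|sS] i.
  have [|J0 J1] := @layer_jump_left k s; first lra.
  have [|EX EZ] := @glued_fibre k (S + s) k0 kh; first lra.
  by case: (ord2P i) => ->; rewrite ?J0 ?J1 ?EX ?EZ subrr.
have [|J0 J1] := @layer_jump_right k s; first lra.
have [|EX EZ] := @glued_fibre k (S - s) k0 kh; first lra.
by case: (ord2P i) => ->; rewrite ?J0 ?J1 ?EX ?EZ subrr.
Qed.

Lemma layers_split_open k s : (0 < k)%N -> k%:R * t < h -> `|s| < S -> exists i, jump i k s <> 0.
Proof.
case: k => // k _ /stack kY; rewrite ltr_norml => /andP[s1 s2].
have touch x : 0 < x -> x <= S -> fX k x t = fX k.+1 x 0 -> fZ k x t = fZ k.+1 x 0 -> False.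
  exact: fibres_touch.
apply: contrapT => no; have J i : jump i k.+1 s = 0.
  by apply: contrapT => Ji; apply: no; exists i.
have [s0|s0] := leP s 0.
  have [J0 J1] := @layer_jump_left k.+1 s s0; rewrite !J in J0 J1.
  by apply: (touch (S + s)); lra.
have [J0 J1] := @layer_jump_right k.+1 s (ltW s0); rewrite !J in J0 J1.
by apply: (touch (S - s)); lra.
Qed.

(** The axis counts to the left half: that half is mapped to nonpositive first coordinates, points
    with [0 < x.1] to positive ones. Each half is then injective by [fibres_inj]. *)
Lemma layered_map_inj L : set_inj (omega L h) u.
Proof.
have off x : omega L h x -> (lay x.2)%:R * t <= Y /\ 0 <= x.2 - (lay x.2)%:R * t < t.
  move=> [_ /andP[x0 xh]]; have /andP[l1 l2] := layer_itv t0 (ltW x0); split.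
    by apply: stack; exact: le_lt_trans l1 xh.
  by rewrite subr_ge0 l1 /=; move: l2; rewrite -natr1 mulrDl mul1r; lra.
have neg k s r : 0 <= r < t -> s < S -> fX k s r < 0.
  move=> /andP[r0' rt] sS; apply: (fibre_neg al0 al2 b0 b2 rho0 (rad0 k) (rmp0 k) (flat k)) => //.
    exact: layer_width.
  by rewrite r0' (lt_trans rt).
have npos k s r : 0 <= r < t -> s <= S -> fX k s r <= 0.
  move=> rt; rewrite le_eqVlt => /predU1P[->|sS]; last exact/ltW/neg.
  by rewrite /fibX (fibre_axis al0 b0 rho0 (rad0 k) (rmp0 k) (flat k)) //; exact: layer_width.
have main x y k k' s s' : k = lay x.2 -> k' = lay y.2 -> omega L h x -> omega L h y -> s <= S -> s' <= S ->
    fX k s (x.2 - k%:R * t) = fX k' s' (y.2 - k'%:R * t) ->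
    fZ k s (x.2 - k%:R * t) = fZ k' s' (y.2 - k'%:R * t) -> s = s' /\ x.2 = y.2.
  move=> -> -> /off[kY rt] /off[k'Y r't] sS s'S EX EZ.
  by have [-> -> /addIr] := fibres_inj al0 b0 b2 albpi rho0 R00 Y0 t0 trho steep fits kY k'Y sS s'S rt r't EX EZ.
move=> x y; rewrite !inE => Ox Oy.
have [kx rx] := off _ Ox; have [ky ry] := off _ Oy.
have [x0|x0] := leP x.1 0; have [y0|y0] := leP y.1 0.
- rewrite !layered_map_left // => -[EX EZ]; have [||E1 E2] := main x y _ _ _ _ erefl erefl Ox Oy _ _ EX EZ; [lra|lra|].
  by apply: injective_projections => //; lra.
- rewrite layered_map_left // layered_map_right ?(ltW y0) // => -[EX _]; exfalso.
  have q1 : fX (lay x.2) (S + x.1) (x.2 - (lay x.2)%:R * t) <= 0 by apply: npos => //; lra.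
  have q2 : fX (lay y.2) (S - y.1) (y.2 - (lay y.2)%:R * t) < 0 by apply: neg => //; lra.
  by rewrite EX in q1; lra.
- rewrite layered_map_right ?(ltW x0) // layered_map_left // => -[EX _]; exfalso.
  have q1 : fX (lay x.2) (S - x.1) (x.2 - (lay x.2)%:R * t) < 0 by apply: neg => //; lra.
  have q2 : fX (lay y.2) (S + y.1) (y.2 - (lay y.2)%:R * t) <= 0 by apply: npos => //; lra.
  by rewrite -EX in q2; lra.
- rewrite !layered_map_right ?ltW // => -[/oppr_inj EX EZ].
  have [||E1 E2] := main x y _ _ _ _ erefl erefl Ox Oy _ _ EX EZ; [lra|lra|].
  by apply: injective_projections => //; lra.
Qed.

End Curves.

(** * Choice of the parameters *)

Section SmallAngle.
Context {R : realType}.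
Implicit Type x : R.

Lemma sin_mvt x : 0 < x -> exists2 c, 0 < c < x & sin x = cos c * x.
Proof.
move=> x0; have csin : {within `[0, x], continuous (@sin R)}.
  by apply: continuous_subspaceT; exact: continuous_sin.
have [c cx E] := MVT x0 (fun y _ => is_derive_sin y) csin.
by exists c; [move: cx; rewrite in_itv|move: E; rewrite sin0 !subr0].
Qed.

Lemma sin_lt x : 0 < x -> sin x <= x.
Proof.
by move=> x0; have [c _ ->] := sin_mvt x0; rewrite ler_piMl ?cos_le1 // ltW.
Qed.

Lemma one_subr_cosE x : 1 - cos x = 2 * sin (x / 2) ^+ 2.
Proof.
have -> : cos x = cos (x / 2 + x / 2) by congr cos; field.
by rewrite cosD; have := cos2Dsin2 (x / 2); lra.
Qed.

Lemma one_subr_cos_le x : 0 < x -> x <= pi -> 1 - cos x <= x ^+ 2 / 2.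
Proof.
move=> x0 xpi; have pi0 := pi_gt0 R; rewrite one_subr_cosE; have := @sin_lt (x / 2).
have s0 : 0 <= sin (x / 2) by apply: sin_ge0_pi; apply/andP; split; lra.
move=> /(_ _)/wrap[|sx]; first lra.
have : sin (x / 2) ^+ 2 <= (x / 2) ^+ 2 by rewrite ler_sqr ?nnegrE //; lra.
rewrite expr_div_n; lra.
Qed.

Lemma one_subr_cos_ge x : 0 < x -> x <= 1 -> x ^+ 2 / 4 <= 1 - cos x.
Proof.
move=> x0 x1; have pi2 := pi_ge2 R; rewrite one_subr_cosE.
have [|c /andP[c0 cx] ->] := @sin_mvt (x / 2); first lra.
have cc : 1 - c ^+ 2 / 2 <= cos c by have := @one_subr_cos_le c c0; lra.
have c2 : c ^+ 2 <= (1 / 2) ^+ 2 by rewrite ler_sqr ?nnegrE; lra.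
(* As [c < 1 / 2], [cos c] is at least [7 / 8], and half of its square exceeds [1 / 4]. *)
have : (7 / 8) ^+ 2 <= cos c ^+ 2 by rewrite ler_sqr ?nnegrE; lra.
have -> : (cos c * (x / 2)) ^+ 2 = cos c ^+ 2 * x ^+ 2 / 4 by field.
move=> cc2; have x2 : 0 < x ^+ 2 by rewrite exprn_gt0.
have : (7 / 8) ^+ 2 * x ^+ 2 <= cos c ^+ 2 * x ^+ 2 by rewrite ler_wpM2r // ltW.
lra.
Qed.

Lemma subr_sin_le x : 0 < x -> x <= pi -> x - sin x <= x ^+ 3 / 2.
Proof.
move=> x0 xpi; have [c /andP[c0 cx] ->] := sin_mvt x0.
have : cos x <= cos c by apply/ltW; rewrite ltr_cos // in_itv /=; apply/andP; split; lra.
have := one_subr_cos_le x0 xpi => h1 h2.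
have : x * (1 - cos c) <= x * (x ^+ 2 / 2) by rewrite ler_wpM2l ?(ltW x0) //; lra.
rewrite (exprS x 2); lra.
Qed.

End SmallAngle.

Definition competitor {R : realType} (W : 'M[R]_2 -> R) (gamma L : R) (N : nat) (h alpha E : R) :=
  exists (u : R * R -> R * R) (gradu : R * R -> 'M[R]_2),
    [/\ SBV2 L h N u gradu,
        distr_grad_eq (omega L h `&` [set x | x.1 < - (L / 2)]) u
          (fun=> rotation alpha)
        /\ distr_grad_eq (omega L h `&` [set x | L / 2 < x.1]) u
          (fun=> rotation (- alpha)),
        W1infty (omega L h `\` closure (jump_set (omega L h) u)) u
        /\ hausdorff1 (closure (jump_set (omega L h) u) `\`
                       jump_set (omega L h) u) = 0%E,
        set_inj (omega L h) u
      & (energy W gamma L h u gradu <= E%:E)%E].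

(** * Competitors for given layer thickness and cut length *)

Section Competitors.
Context {R : realType}.
Variables (W : 'M[R]_2 -> R) (cW : R).
Hypotheses (cW0 : 0 <= cW) (HW : forall xi, 0 <= W xi <= cW * dist_SO2 xi ^+ 2).
Variables (gamma L : R) (N : nat) (h al : R).
Hypotheses (gamma0 : 0 < gamma) (L0 : 0 < L) (N0 : (0 < N)%N) (h0 : 0 < h)
  (al0 : 0 < al) (al2 : al <= pi / 2).

Local Notation competitor := (competitor W gamma L N h al).

Let eq_leW (x y : R) : x = y -> x <= y. Proof. by move->. Qed.

Lemma competitor_le E E' : E <= E' -> competitor E -> competitor E'.
Proof.
move=> EE [u [gradu [H1 H2 H3 H4 H5]]]; exists u, gradu; split=> //.
by apply: le_trans H5 _; rewrite lee_fin.
Qed.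

(** The length [S] is shared out in eighths: one for the second arc, two for the largest first arc,
    one for the longest ramp, the rest stays flat. This determines the radii [rho] and [R0]. *)
Lemma layered_competitor b S Y t n : 0 < b -> b < pi / 2 -> al + b < pi ->
  0 < S -> S <= L / 2 -> 0 <= Y -> 0 < t -> t < S / (8 * b) ->
  sin b < ramp_rate al b -> Y * (al + b) <= S / 8 -> Y * ramp_rate al b <= S / 8 ->
  (forall k, k%:R * t < h -> k%:R * t <= Y) ->
  (forall k : nat, (0 < k)%N -> k%:R * t < h ->
     exists2 l : nat, (0 < l < N)%N & k%:R * t = l%:R * h / N%:R) ->
  h <= n.+1%:R * t ->
  competitor (64 * 32 * (cW * (al + b) ^+ 2 * t ^+ 2 * h / S) + 2 * (gamma * S * n%:R)).
Proof.
move=> b0 b2 albpi S0 SL2 Y0 t0 trho steep fitsA fitsB stack match_layers hn.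
set rho := S / (8 * b) in trho; pose R0 := S / (8 * (al + b)).
have ab0 : 0 < al + b by rewrite addr_gt0.
have SL : S < L by lra.
have rho0 : 0 < rho by rewrite divr_gt0 // mulr_gt0.
have R00 : 0 < R0 by rewrite divr_gt0 // mulr_gt0.
have rhob : rho * b = S / 8 by rewrite /rho; have := lt0r_neq0 b0 => ?; field.
have R0ab : R0 * (al + b) = S / 8 by rewrite /R0; have := lt0r_neq0 ab0 => ?; field.
have fits : (R0 + Y) * (al + b) + Y * ramp_rate al b + rho * b < S.
  by rewrite mulrDl R0ab rhob; lra.
set gx := curveX al b S rho R0 Y t; set gz := curveZ al b S rho R0 Y t.
set th := angle al b S rho R0 Y t; set ka := curvature al b S rho R0 Y t.
have dgx := piecewise_deriv_curveX al0 b0 b2 rho0 R00 Y0 t0 steep fits : forall k, piecewise_deriv (gx k) (fun s => cos (th k s)).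
have dgz := piecewise_deriv_curveZ al0 b0 b2 rho0 R00 Y0 t0 steep fits : forall k, piecewise_deriv (gz k) (fun s => sin (th k s)).
have dth := piecewise_deriv_angle al b S rho R0 Y t : forall k, piecewise_deriv (th k) (ka k).
have kaK := norm_curvature al0 b0 b2 rho0 R00 Y0 t0 steep fits : forall k s, `|ka k s| <= _.
have ka0 := curvature_far al0 b0 b2 rho0 R00 Y0 t0 steep fits : forall k s, S <= `|s| -> ka k s = 0.
have glued := layers_glued al0 b0 b2 rho0 R00 Y0 t0 steep fits stack.
have split_open := layers_split_open al0 b0 b2 albpi rho0 R00 Y0 t0 trho steep fits stack.
exists (layered_map t gx gz th), (layered_grad t th ka).
have JE := jump_set_layered t0 SL dgx dgz dth glued split_open.
split.
- exact: (layered_SBV2 t0 L0 h0 S0 SL dgx dgz dth kaK glued split_open match_layers).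
- split; apply: (layered_grad_rotation t0 L0 h0 dgx dgz dth kaK ka0 glued) => [x [] //|x [_ /= xL]|k x [_ /= xL]].
  + by rewrite ler_normr; apply/orP; right; lra.
  + by apply: (angle_left al0 b0 b2 rho0 R00 Y0 t0 steep fits); lra.
  + by rewrite ler_normr; apply/orP; left; lra.
  + by apply: (angle_right al0 b0 b2 rho0 R00 Y0 t0 steep fits); lra.
- rewrite JE; split; first exact: (layered_W1infty t0 L0 h0 dgx dgz dth kaK glued).
  exact: hausdorff1_closure_delaminated.
- exact: (layered_map_inj al0 al2 b0 b2 albpi rho0 R00 Y0 t0 trho steep fits stack).
apply: le_trans (layered_energy t0 h0 S0 SL dgx dgz dth kaK ka0 glued split_open gamma0 cW0 HW hn) _.
rewrite lee_fin; apply: lerD; last by apply: eq_leW; ring.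
(* The curvature is at most [16 (al + 2 b) / S], rounded up here; [64 * 32] is twice the square of
   32, the 2 coming from the width [2 S] of the bent part. *)
have KE : 2 * (R0^-1 + rho^-1) <= 32 * (al + b) / S.
  rewrite /R0 /rho !invf_div -mulrDl mulrA ler_wpM2r ?invr_ge0 ?(ltW S0) //.
  by have := al0; lra.
have K0 : 0 <= 2 * (R0^-1 + rho^-1) by rewrite mulr_ge0 // addr_ge0 // invr_ge0 ltW.
apply: (@le_trans _ _ (cW * (t * (32 * (al + b) / S)) ^+ 2 * (2 * S * h))).
  rewrite ler_wpM2r ?mulr_ge0 ?(ltW S0) ?(ltW h0) // ler_wpM2l //.
  have q1 : 0 <= t * (2 * (R0^-1 + rho^-1)) by rewrite mulr_ge0 // ltW.
  have q2 := ler_wpM2l (ltW t0) KE.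
  by rewrite ler_sqr ?nnegrE // (le_trans q1).
by apply: eq_leW; have := lt0r_neq0 S0 => ?; field.
Qed.

(** One layer, hence [Y = 0] and no ramp; [b] need not be small and is taken of the order of [al].
    For [b = al / 2] and [S = L / 2], [(al + b) ^ 2 / S] is [9 / 2 * al ^ 2 / L]. *)
Lemma bent_competitor : 64 * 16 * h <= L -> competitor (64 * 144 * (cW * (al ^+ 2 * h ^+ 3 / L))).
Proof.
move=> hL; have al0' := al0; have al2' := al2; have h0' := h0; have L0' := L0.
have pi2 := pi_ge2 R; have /andP[_ pi4] := pihalf_02 R.
set b := al / 2; have b0 : 0 < b by rewrite divr_gt0.
have b2 : b < pi / 2 by rewrite /b; lra.
have sb := sinb_gt0 b0 b2; have sb' := sin_lt b0; have cb := cosb_gt0 b0 b2.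
have c1 : cos b < 1.
  by rewrite -(cos0 R) ltr_cos // in_itv /=; apply/andP; split; lra.
have steep : sin b < ramp_rate al b.
  rewrite /ramp_rate ltr_pdivlMr; last lra.
  have : sin b * (1 - cos b) < sin b by rewrite gtr_pMr //; lra.
  by rewrite /b in sb' *; lra.
have trho : h < L / 2 / (8 * b).
  rewrite ltr_pdivlMr ?mulr_gt0 //.
  have : h * (8 * b) <= h * 16 by rewrite ler_wpM2l ?(ltW h0) // /b; lra.
  have := h0; lra.
have few k : k%:R * h < h -> k = 0%N.
  by rewrite -[ltRHS]mul1r ltr_pM2r // -[1]/(1%:R) ltr_nat; case: k.
apply: competitor_le (layered_competitor (b := b) (S := L / 2) (Y := 0) (t := h) (n := 0%N) _ _ _ _ _ _ _ _ _ _ _ _ _ _) => //.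
- by rewrite mulr0 mulr0 addr0 /b; apply: eq_leW; field; exact: lt0r_neq0.
- by rewrite /b; lra.
- by lra.
- by lra.
- by lra.
- by move=> k /few ->; lra.
- by move=> k k0 /few kE; rewrite kE in k0.
- by lra.
Qed.

(** Each layer unites [q] of the given ones, except possibly the top one, so the cuts lie on the
    prescribed grid. The two elastic terms are the shares of [al ^ 2] and [b ^ 2]; [S] and [q]
    remain to be optimized. *)
Lemma delaminating_competitor S (q : nat) (t := q%:R * h / N%:R) :
  8 * 8 * 8 * h <= S -> S <= L / 2 -> (0 < q <= N)%N ->
  competitor (64 * 64 * (cW * (al ^+ 2 * t ^+ 2 * h / S))
    + 64 * 64 * 64 * (cW * (al * h ^+ 2 * t ^+ 2 / S ^+ 2)) + 2 * (gamma * S * h / t)).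
Proof.
move=> hS SL /andP[q0 qN]; have al0' := al0; have al2' := al2; have h0' := h0; have L0' := L0.
have pi2 := pi_ge2 R; have /andP[_ pi4] := pihalf_02 R.
have S0 : 0 < S by lra.
have NR : 0 < N%:R :> R by rewrite ltr0n.
have qR : 0 < q%:R :> R by rewrite ltr0n.
have t0 : 0 < t by rewrite divr_gt0 // mulr_gt0.
have th : t <= h by rewrite /t ler_pdivrMr // mulrC ler_pM2l // ler_nat.
have a0 : 0 < al * h / S by rewrite divr_gt0 // mulr_gt0.
(* The ramps are bounded by [8 al h / b ^ 2], which is exactly [S / 8] for this [b]. *)
pose b := 8 * Num.sqrt (al * h / S).
have b0 : 0 < b by rewrite mulr_gt0 // sqrtr_gt0.
have bb : b ^+ 2 = 64 * (al * h / S).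
  by rewrite /b exprMn sqr_sqrtr ?(ltW a0) //; congr (_ * _); ring.
(* [512 h <= S] gives [b ^ 2 <= al / 8], thus [b <= 1 / 2] and [b ^ 3 <= al / 16]: the correction
   [b - sin b] is small against [al]. *)
have small : al * h / S <= al / (8 * 8 * 8).
  have hS' : h / S <= 1 / (8 * 8 * 8) by rewrite ler_pdivrMr //; lra.
  by have := ler_wpM2l (ltW al0) hS'; lra.
have bhalf : b <= 1 / 2.
  by rewrite -ler_sqr ?nnegrE ?(ltW b0) // bb; lra.
have b3 : b ^+ 3 <= al / 16.
  rewrite exprS; have : b * b ^+ 2 <= 1 / 2 * b ^+ 2 by rewrite ler_wpM2r // sqr_ge0.
  by rewrite bb; lra.
have b2 : b < pi / 2 by lra.
have sb := sinb_gt0 b0 b2; have sb' := sin_lt b0.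
have c1 := @one_subr_cos_le _ b b0 ltac:(lra); have c2 := @one_subr_cos_ge _ b b0 ltac:(lra).
have c3 := @subr_sin_le _ b b0 ltac:(lra).
have bb0 : 0 < b ^+ 2 by rewrite exprn_gt0.
have c0 : 0 < 1 - cos b by lra.
have steep : sin b < ramp_rate al b.
  rewrite /ramp_rate ltr_pdivlMr //.
  have : sin b * (1 - cos b) <= b * (b ^+ 2 / 2) by apply: ler_pM => //; lra.
  by move: b3; rewrite exprS; lra.
have trho : t < S / (8 * b).
  have b8 : 0 < 8 * b by lra.
  rewrite ltr_pdivlMr //.
  have : t * (8 * b) <= h * 4 by apply: ler_pM; lra.
  lra.
have fitsA : h * (al + b) <= S / 8.
  have : h * (al + b) <= h * 3 by rewrite ler_wpM2l ?(ltW h0) //; lra.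
  lra.
have fitsB : h * ramp_rate al b <= S / 8.
  rewrite /ramp_rate mulrA ler_pdivrMr //.
  have h1 : h * (al + b - sin b) <= h * (2 * al) by rewrite ler_wpM2l ?(ltW h0) //; lra.
  have h2 : S / 8 * (b ^+ 2 / 4) <= S / 8 * (1 - cos b) by rewrite ler_wpM2l //; lra.
  apply: le_trans h1 _; apply: le_trans h2.
  by rewrite bb; apply: eq_leW; field; exact: lt0r_neq0.
pose n := layer t h.
have /andP[nh hn] := layer_itv t0 (ltW h0).
have stack k : k%:R * t < h -> k%:R * t <= h by move/ltW.
have layers_on_grid (k : nat) : (0 < k)%N -> k%:R * t < h ->
    exists2 l : nat, (0 < l < N)%N & k%:R * t = l%:R * h / N%:R.
  move=> k0 kh; exists (k * q)%N; last by rewrite natrM /t; field; exact: lt0r_neq0.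
  have kq : k%:R * q%:R * h < N%:R * h.
    rewrite [ltRHS]mulrC -ltr_pdivrMr //; apply: le_lt_trans kh; apply: eq_leW.
    by rewrite /t; field; exact: lt0r_neq0.
  by rewrite muln_gt0 k0 q0 /= -(ltr_nat R) natrM -(ltr_pM2r h0).
have albpi : al + b < pi by lra.
apply: competitor_le (layered_competitor b0 b2 albpi S0 SL (ltW h0) t0 trho steep fitsA fitsB stack
  layers_on_grid (ltW hn)).
have sq : (al + b) ^+ 2 <= 2 * al ^+ 2 + 2 * b ^+ 2.
  by have := sqr_ge0 (al - b); rewrite sqrrB sqrrD; lra.
apply: lerD.
  apply: (@le_trans _ _ (64 * 32 * (cW * (2 * al ^+ 2 + 2 * b ^+ 2) * t ^+ 2 * h / S))).
    have c : 0 <= cW * t ^+ 2 * h / S by rewrite divr_ge0 ?(ltW S0) // mulr_ge0 ?(ltW h0) // mulr_ge0 // sqr_ge0.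
    by have := ler_wpM2l c sq; lra.
  by rewrite bb; apply: eq_leW; field; exact: lt0r_neq0.
have nt : n%:R <= h / t by rewrite ler_pdivlMr.
by have := ler_wpM2l (mulr_ge0 (ltW gamma0) (ltW S0)) nt; lra.
Qed.

End Competitors.

(** * Optimization of layer thickness and cut length *)

Section Optimization.
Context {R : realType}.
Variables (W : 'M[R]_2 -> R) (cW : R).
Hypotheses (cW0 : 0 <= cW) (HW : forall xi, 0 <= W xi <= cW * dist_SO2 xi ^+ 2).
Variables (gamma L : R) (N : nat) (h al : R).
Hypotheses (gamma0 : 0 < gamma) (L0 : 0 < L) (N0 : (0 < N)%N) (h0 : 0 < h)
  (al0 : 0 < al) (al2 : al <= pi / 2) (hL : 64 * 16 * h <= L).
(* the first two terms of the bound are [gamma * p1] and [gamma * p2] *)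
Variables (p1 p2 : R).
Hypotheses (p10 : 0 < p1) (p20 : 0 < p2)
  (p1E : gamma * p1 ^+ 3 = al * h ^+ 4) (p2E : gamma * N%:R * p2 ^+ 2 = al ^+ 2 * h ^+ 3).

Local Notation competitor := (competitor W gamma L N h al).
Let E1 := al ^+ 2 * h ^+ 3 / L.
Let A3 := al ^+ 2 * h ^+ 3 / (L * N%:R ^+ 2).
Let A4 := al * h ^+ 4 / (L ^+ 2 * N%:R ^+ 2).

Let NR : 0 < N%:R :> R. Proof. by rewrite ltr0n. Qed.
Let E10 : 0 <= E1.
Proof. by apply: divr_ge0; rewrite ?(ltW L0) // mulr_ge0 // exprn_ge0 // ltW. Qed.
Let A30 : 0 <= A3.
Proof. by apply: divr_ge0; apply: mulr_ge0; rewrite ?exprn_ge0 // ltW. Qed.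
Let A40 : 0 <= A4.
Proof. by apply: divr_ge0; apply: mulr_ge0; rewrite ?exprn_ge0 // ltW. Qed.
Let g1 : 0 < gamma * p1. Proof. exact: mulr_gt0. Qed.
Let g2 : 0 < gamma * p2. Proof. exact: mulr_gt0. Qed.
Let al_le2 : al <= 2. Proof. by have /andP[_] := pihalf_02 R; have := al2; lra. Qed.

(** For [S = P / N] the elastic terms become [gamma p2 (p2 / P)] and [gamma p1 (p1 / P) ^ 2], and
    the cuts cost [gamma P]; this is why [P] is the maximum. If [P / N] is at least [L / 2], then
    [S = L / 2]: the elastic terms become [A3] and [A4] up to factors, and the cuts cost at most
    [gamma P]. *)
Lemma thin_layers_competitor : N%:R * (8 * 8 * 8 * h) <= p1 ->
  competitor (64 * 64 * 64 * 4 * (cW + 1) * (gamma * p1 + gamma * p2 + A3 + A4)).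
Proof.
move=> Np; have L0' := L0; have h0' := h0; have NR' := NR.
pose P := Num.max p1 p2.
have P0 : 0 < P by rewrite lt_max p10.
have Pp1 : p1 <= P by rewrite le_max lexx.
have Pp2 : p2 <= P by rewrite le_max lexx orbT.
have Ple : P <= p1 + p2 by rewrite ge_max; have := p10; have := p20 => *; apply/andP; split; lra.
have nN := lt0r_neq0 NR; have nL := lt0r_neq0 L0; have nh := lt0r_neq0 h0; have nP := lt0r_neq0 P0.
have q1N : (0 < 1 <= N)%N by [].
have gP : gamma * P <= gamma * p1 + gamma * p2 by rewrite -mulrDr ler_wpM2l // ltW.
have cA3 := mulr_ge0 cW0 A30; have cA4 := mulr_ge0 cW0 A40.
have cg1 := mulr_ge0 cW0 (ltW g1); have cg2 := mulr_ge0 cW0 (ltW g2).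
have [g1' g2' A3' A4'] : [/\ 0 <= gamma * p1, 0 <= gamma * p2, 0 <= A3 & 0 <= A4].
  by split=> //; exact: ltW.
have [LP|PL] := leP (L / 2) (P / N%:R).
  have hS : 8 * 8 * 8 * h <= L / 2 by have := hL; lra.
  apply: competitor_le (delaminating_competitor cW0 HW gamma0 L0 N0 h0 al0 al2 hS (lexx _) q1N).
  have -> : al ^+ 2 * (1%:R * h / N%:R) ^+ 2 * h / (L / 2) = 2 * A3.
    by rewrite /A3; field; rewrite nN nL.
  have -> : al * h ^+ 2 * (1%:R * h / N%:R) ^+ 2 / (L / 2) ^+ 2 = 4 * A4.
    by rewrite /A4; field; rewrite nN nL.
  have -> : gamma * (L / 2) * h / (1%:R * h / N%:R) = gamma * (L / 2 * N%:R).
    by field; rewrite nN nh.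
  have : gamma * (L / 2 * N%:R) <= gamma * P by rewrite ler_wpM2l ?(ltW gamma0) // -ler_pdivlMr.
  move: (A3) (A4) A3' A4' cA3 cA4 => a3 a4 A3' A4' cA3 cA4; lra.
have hS : 8 * 8 * 8 * h <= P / N%:R by rewrite ler_pdivlMr //; lra.
apply: competitor_le (delaminating_competitor cW0 HW gamma0 L0 N0 h0 al0 al2 hS (ltW PL) q1N).
have -> : al ^+ 2 * (1%:R * h / N%:R) ^+ 2 * h / (P / N%:R) = gamma * p2 * (p2 / P).
  transitivity (al ^+ 2 * h ^+ 3 / (N%:R * P)); first by field; rewrite nN nP.
  by rewrite -p2E; field; rewrite nN nP.
have -> : al * h ^+ 2 * (1%:R * h / N%:R) ^+ 2 / (P / N%:R) ^+ 2 = gamma * p1 * (p1 / P) ^+ 2.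
  transitivity (al * h ^+ 4 / P ^+ 2); first by field; rewrite nN nP.
  by rewrite -p1E; field.
have -> : gamma * (P / N%:R) * h / (1%:R * h / N%:R) = gamma * P.
  by field; rewrite nN nh.
have r2 : gamma * p2 * (p2 / P) <= gamma * p2 by rewrite ler_piMr // ler_pdivrMr // mul1r.
have r1 : gamma * p1 * (p1 / P) ^+ 2 <= gamma * p1.
  by rewrite ler_piMr // expr_le1 // ?divr_ge0 ?(ltW P0) ?(ltW p10) // ler_pdivrMr // mul1r.
have := ler_wpM2l cW0 r1; have := ler_wpM2l cW0 r2.
move: (A3) (A4) A3' A4' cA3 cA4 => a3 a4 A3' A4' cA3 cA4; lra.
Qed.

(** [S = 512 h] is the shortest admissible cut, and the thickness is adjusted by merging layers. *)
Lemma thick_layers_competitor : 8 * 8 * 8 * h < p1 -> p1 < N%:R * (8 * 8 * 8 * h) ->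
  competitor ((17 * 8 * 8 * 8 * (8 * 8 * 8) * cW + 4) * (gamma * p1)).
Proof.
move=> hp pN; have L0' := L0; have h0' := h0; have NR' := NR.
(* [mu] is the desired number of layers. As [q] is the integer part of [N / mu] and at least 1,
   [t = q h / N] lies between [h / (2 mu)] and [h / mu]. *)
pose mu := p1 / (8 * 8 * 8 * h); pose q := layer mu N%:R.
have nh := lt0r_neq0 h0; have nN := lt0r_neq0 NR.
have hh : 0 < 8 * 8 * 8 * h by lra.
have mu1 : 1 < mu by rewrite /mu ltr_pdivlMr // mul1r.
have mu0 : 0 < mu by lra.
have muN : mu < N%:R by rewrite /mu ltr_pdivrMr.
have muE : mu * (8 * 8 * 8 * h) = p1 by rewrite /mu; field.
have /andP[qmu Nq] := layer_itv mu0 (ltW NR).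
rewrite -/q in qmu Nq.
have q0 : (0 < q)%N by rewrite lt0n; apply/eqP => qE; move: Nq; rewrite qE; lra.
have qR : 1 <= q%:R :> R by rewrite ler1n.
have qN : (q <= N)%N.
  rewrite -(ler_nat R); apply: le_trans qmu; rewrite ler_peMr //; lra.
have Nq2 : N%:R <= 2 * q%:R * mu.
  have qq : q.+1%:R <= 2 * q%:R :> R by rewrite -natr1; lra.
  by have := ler_wpM2r (ltW mu0) qq; lra.
have hS : 8 * 8 * 8 * h <= L / 2 by have := hL; lra.
have qN' : (0 < q <= N)%N by rewrite q0.
apply: competitor_le (delaminating_competitor cW0 HW gamma0 L0 N0 h0 al0 al2 (lexx _) hS qN').
set t := q%:R * h / N%:R.
have t0 : 0 < t by rewrite divr_gt0 // mulr_gt0 //; lra.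
have nt := lt0r_neq0 t0.
have tp : t * mu <= h.
  have -> : t * mu = q%:R * mu / N%:R * h by rewrite /t; field.
  by rewrite ler_piMl ?(ltW h0) // ler_pdivrMr // mul1r.
have ht : h / t <= 2 * mu.
  have -> : h / t = N%:R / q%:R by rewrite /t; field; rewrite nh nN lt0r_neq0 //; lra.
  by rewrite ler_pdivrMr; lra.
have g1' := ltW g1.
have att : al * t ^+ 2 <= 8 * 8 * 8 * (8 * 8 * 8) * (gamma * p1).
  have : al * (t * mu) ^+ 2 <= al * h ^+ 2.
    by rewrite ler_wpM2l ?(ltW al0) // ler_sqr ?nnegrE ?(ltW h0) // mulr_ge0 // ltW.
  have -> : al * h ^+ 2 = 8 * 8 * 8 * (8 * 8 * 8) * (gamma * p1) * mu ^+ 2.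
    have -> : 8 * 8 * 8 * (8 * 8 * 8) * (gamma * p1) * mu ^+ 2 = gamma * p1 ^+ 3 / h ^+ 2 by rewrite /mu; field.
    by rewrite p1E; field.
  have mu20 : 0 < mu ^+ 2 by rewrite exprn_gt0.
  move=> H; rewrite -(ler_pM2r mu20).
  by rewrite (_ : al * t ^+ 2 * mu ^+ 2 = al * (t * mu) ^+ 2) //; ring.
(* With its numerical factor the first elastic term is at most [16 cW al t ^ 2], by [al <= 2], and
   the second is [cW al t ^ 2]: hence the 17. *)
have -> : al ^+ 2 * t ^+ 2 * h / (8 * 8 * 8 * h) = al * (al * t ^+ 2) / (8 * 8 * 8) by field.
have -> : al * h ^+ 2 * t ^+ 2 / (8 * 8 * 8 * h) ^+ 2 = al * t ^+ 2 / (8 * 8 * 8 * (8 * 8 * 8)) by field.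
have -> : gamma * (8 * 8 * 8 * h) * h / t = gamma * (8 * 8 * 8 * h) * (h / t) by field.
have jump : gamma * (8 * 8 * 8 * h) * (h / t) <= 2 * (gamma * p1).
  have := ler_wpM2l (mulr_ge0 (ltW gamma0) (ltW hh)) ht.
  by rewrite -muE; lra.
have at0 : 0 <= al * t ^+ 2 by rewrite mulr_ge0 ?sqr_ge0 // ltW.
have := ler_wpM2r at0 al_le2 => aat.
have := ler_wpM2l cW0 aat; have := ler_wpM2l cW0 att.
lra.
Qed.

Lemma optimal_competitor :
  competitor (64 * 64 * 64 * 64 * (cW + 1) * Num.min E1 (gamma * p1 + gamma * p2 + A3 + A4)).
Proof.
have [A3' A4' E1' g1' g2'] : [/\ 0 <= A3, 0 <= A4, 0 <= E1, 0 <= gamma * p1 & 0 <= gamma * p2].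
  by split=> //; exact: ltW.
have bent : competitor (64 * 144 * (cW * E1)) by exact: bent_competitor.
have cW0' := cW0; have nL := lt0r_neq0 L0.
have [EE|EE] := leP E1 (gamma * p1 + gamma * p2 + A3 + A4).
  apply: competitor_le bent.
  by have := mulr_ge0 cW0 E1'; move: (E1) E1' => e *; lra.
have sum_ge : gamma * p1 <= gamma * p1 + gamma * p2 + A3 + A4 by move: (A3) (A4) A3' A4' => a3 a4 *; lra.
have scale c : 0 <= c -> c <= 64 * 64 * 64 * 64 * (cW + 1) ->
    c * (gamma * p1) <= 64 * 64 * 64 * 64 * (cW + 1) * (gamma * p1 + gamma * p2 + A3 + A4).
  by move=> c0 cC; apply: ler_pM.
have [hp|hp] := ltP (8 * 8 * 8 * h) p1; last first.
  apply: competitor_le bent.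
  (* If [p1 <= 512 h], the relation for [p1] bounds [al h ^ 2] by a multiple of [gamma p1], so the
     plate without cuts already meets the second bound. *)
  have E1le : E1 <= 8 * 8 * 8 * (gamma * p1).
    have al_h : al * h ^+ 2 <= 8 * 8 * 8 * (8 * 8 * 8) * (gamma * p1).
      have h20 : 0 < h ^+ 2 by rewrite exprn_gt0.
      rewrite -(ler_pM2r h20) (_ : al * h ^+ 2 * h ^+ 2 = gamma * p1 ^+ 3); last by rewrite p1E; ring.
      have : p1 ^+ 2 <= (8 * 8 * 8 * h) ^+ 2 by rewrite ler_sqr ?nnegrE ?(ltW p10) // (le_trans (ltW p10)).
      by move=> /(ler_wpM2l g1'); rewrite exprMn (exprS p1 2); lra.
    have -> : E1 = al * (al * h ^+ 2) * (h / L) by rewrite /E1; field.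
    have hL' : h / L <= 1 / (64 * 16) by rewrite ler_pdivrMr //; have := hL; lra.
    have ah0 : 0 <= al * h ^+ 2 by rewrite mulr_ge0 ?sqr_ge0 // ltW.
    have aah0 := mulr_ge0 (ltW al0) ah0.
    have := ler_wpM2l aah0 hL'; have := ler_wpM2r ah0 al_le2; lra.
  have := scale (64 * 144 * cW * 8 * 8 * 8); have := ler_wpM2l cW0 E1le.
  move=> q1 /(_ _)/wrap[|/(_ _)/wrap[|]]; lra.
have [Np|pN] := leP (N%:R * (8 * 8 * 8 * h)) p1.
  apply: competitor_le (thin_layers_competitor Np).
  apply: ler_wpM2r; [exact: le_trans sum_ge|lra].
by apply: competitor_le (thick_layers_competitor hp pN); apply: scale; lra.
Qed.

End Optimization.

Lemma powR_divnn (R : realType) (x : R) (m n : nat) : 0 <= x -> (0 < n)%N ->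
  (x `^ (m%:R / n%:R)) ^+ n = x ^+ m.
Proof.
move=> x0 n0; rewrite -[LHS]powR_mulrn ?powR_ge0 // -powRrM divfK ?powR_mulrn //.
by rewrite pnatr_eq0 -lt0n.
Qed.

Theorem theorem3p4 (R : realType) (W : 'M[R]_2 -> R) (HW : elastic_density W) :
  exists C eta : R, 0 < C /\ 0 < eta <= 1 /\
  forall (L gamma : R) (N : nat) (h alpha : R),
    0 < L -> 0 < gamma -> (1 <= N)%N -> 0 < h <= eta * L ->
    0 < alpha <= pi / 2 ->
  exists (u : R * R -> R * R) (gradu : R * R -> 'M[R]_2),
    [/\ SBV2 L h N u gradu,
        distr_grad_eq (omega L h `&` [set x | x.1 < - (L / 2)]) u
          (fun=> rotation alpha)
        /\ distr_grad_eq (omega L h `&` [set x | L / 2 < x.1]) u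
          (fun=> rotation (- alpha)),
        W1infty (omega L h `\` closure (jump_set (omega L h) u)) u
        /\ hausdorff1 (closure (jump_set (omega L h) u) `\`
                       jump_set (omega L h) u) = 0%E,
        set_inj (omega L h) u
      & (energy W gamma L h u gradu <=
          (C * Num.min (alpha ^+ 2 * h ^+ 3 / L)
            (alpha `^ (1 / 3) * gamma `^ (2 / 3) * h `^ (4 / 3)
             + alpha * gamma `^ (1 / 2) * h `^ (3 / 2) / N%:R `^ (1 / 2)
             + alpha ^+ 2 * h ^+ 3 / (L * N%:R ^+ 2)
             + alpha * h ^+ 4 / (L ^+ 2 * N%:R ^+ 2)))%:E)%E].
Proof.
case: HW => W0 _ [cW cW0 cWP].
have HW xi : 0 <= W xi <= cW * dist_SO2 xi ^+ 2.
  by rewrite W0 /=; case/andP: (cWP xi).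
(* [64 ^ 4] dominates the constants of all cases, and [cW + 1] covers elastic terms and cuts alike.
   The ratio [1 / 1024] makes [L / 2] at least [512 h], the shortest admissible cut. *)
exists (64 * 64 * 64 * 64 * (cW + 1)), (64 * 16)^-1; split; first lra.
split; first lra.
move=> L gamma N h al L0 gamma0 N0 /andP[h0 hL] /andP[al0 al2].
have NR : 0 < N%:R :> R by rewrite ltr0n.
set A1 := al `^ (1 / 3) * gamma `^ (2 / 3) * h `^ (4 / 3).
set A2 := al * gamma `^ (1 / 2) * h `^ (3 / 2) / N%:R `^ (1 / 2).
have A10 : 0 < A1 by rewrite !mulr_gt0 // powR_gt0.
have A20 : 0 < A2 by rewrite !mulr_gt0 ?invr_gt0 // powR_gt0.
(* The real exponents are used only through the cube of [A1] and the square of [A2], which are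
   polynomial in the data up to division by [N]. *)
have A1E : A1 ^+ 3 = al * gamma ^+ 2 * h ^+ 4.
  rewrite /A1 !exprMn (powR_divnn 1 (ltW al0) (isT : (0 < 3)%N)).
  by rewrite (powR_divnn 2 (ltW gamma0) (isT : (0 < 3)%N)) (powR_divnn 4 (ltW h0) (isT : (0 < 3)%N)).
have A2E : A2 ^+ 2 = al ^+ 2 * gamma * h ^+ 3 / N%:R.
  rewrite /A2 !exprMn exprVn (powR_divnn 1 (ltW gamma0) (isT : (0 < 2)%N)).
  by rewrite (powR_divnn 3 (ltW h0) (isT : (0 < 2)%N)) (powR_divnn 1 (ltW NR) (isT : (0 < 2)%N)).
have ng := lt0r_neq0 gamma0.
have p1E : gamma * (A1 / gamma) ^+ 3 = al * h ^+ 4 by rewrite expr_div_n A1E; field.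
have p2E : gamma * N%:R * (A2 / gamma) ^+ 2 = al ^+ 2 * h ^+ 3.
  by rewrite expr_div_n A2E; field; rewrite ng lt0r_neq0.
have hL' : 64 * 16 * h <= L by move: hL; rewrite ler_pdivlMl //; lra.
have := optimal_competitor (ltW cW0) HW gamma0 L0 N0 h0 al0 al2 hL'
  (divr_gt0 A10 gamma0) (divr_gt0 A20 gamma0) p1E p2E.
by rewrite ![gamma * (_ / _)]mulrC !divfK.
Qed.
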